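(* Let $\widetilde M$ be a complete, simply connected visibility Riemannian manifold with no conjugate points, and let $\Gamma$ be a non-elementary discrete subgroup of $\mathrm{Iso}(\widetilde M)$. Let $\{\mu_q\}_{q\in\widetilde M}$ be the Patterson--Sullivan measure and let $K\subset\widetilde M$ be a compact set. Then for every sufficiently large $R>0$ there is $C>0$ such that for every $\alpha\in\Gamma$ and every pair of points $p,q\in K$, $$\frac1C\le\frac{\mu_p(\mathrm{pr}_p(B(\alpha q,R)))}{e^{-\delta_\Gamma d(p,\alpha q)}}\le C.$$
   Context: All geodesics have unit speed; $d$ is the Riemannian distance; $B(q,r)$ is the open ball. No conjugate points: no geodesic carries a non-trivial Jacobi field vanishing at two distinct parameters. For $p\in\widetilde M$, $\measuredangle_p(x,y)$ is the angle at $p$ between the geodesics from $p$ to $x$ and to $y$. $\widetilde M$ satisfies the visibility axiom (is a visibility manifold) if for all $p\in\widetilde M$, $\epsilon>0$ there is $R=R(p,\epsilon)>0$ such that every geodesic (segment) $c:[a,b]\to\widetilde M$ ($a,b$ possibly infinite) with $d(p,c)\ge R$ satisfies $\measuredangle_p(c(a),c(b))\le\epsilon$. Geodesics $c_1,c_2$ are positively asymptotic if $d(c_1(t),c_2(t))$ is bounded for $t\ge0$; the ideal boundary $\widetilde M(\infty)$ is the set of asymptote classes and $c(+\infty)$ is the class of $c$. For $p\in\widetilde M$ and $x\in\widetilde M\cup\widetilde M(\infty)$, $x\ne p$, $c_{p,x}$ is the unique geodesic with $c_{p,x}(0)=p$ going to $x$ (with $c_{p,x}(+\infty)=x$ if $x\in\widetilde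 M(\infty)$). The cone topology on $\widetilde M\cup\widetilde M(\infty)$ is generated by the open sets of $\widetilde M$ and the truncated cones $\{x:\measuredangle(c_{p,x}'(0),v)<\epsilon,\ d(p,x)>r\}$, $v\in T^1_p\widetilde M$. Isometries act on $\widetilde M(\infty)$ by $\alpha(c(+\infty))=(\alpha\circ c)(+\infty)$. The shadow of $B(q,r)$ from $p$ is $\mathrm{pr}_p(B(q,r))=\{c_{p,z}(+\infty): z\in B(q,r),\ z\neq p\}\subset\widetilde M(\infty)$. $L(\Gamma)=\overline{\Gamma(p)}\cap\widetilde M(\infty)$ (independent of $p$); $\Gamma$ is non-elementary if $\#L(\Gamma)=\infty$. Busemann function: $\beta_\xi(p,x)=\lim_{t\to\infty}(d(p,c_{x,\xi}(t))-t)$. Patterson--Sullivan measure. $P(s,p,q)=\sum_{\alpha\in\Gamma}e^{-s\,d(p,\alpha q)}$, $\delta_\Gamma=\inf\{s\ge0:P(s,p,q)<\infty\}$ (independent of $p,q$; understood finite). An $r$-dimensional conformal density is a family of finite Borel measures $\{\mu_p\}_{p\in\widetilde M}$ on $\widetilde M(\infty)$ with $\mathrm{supp}\,\mu_p\subset L(\Gamma)$, $\frac{d\mu_p}{d\mu_q}(\xi)=e^{-r\beta_\xi(p,q)}$ almost everywhere, and $\mu_{\alpha p}(\alpha A)=\mu_p(A)$ for all Borel $A$, $\alpha\in\Gamma$. Let $h:\mathbb R^+\to\mathbb R^+$ be Patterson's non-decreasing function (for every $\epsilon>0$ there is $r_0$ with $h(r+t)\le e^{\epsilon t}h(r)$ for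 $r\ge r_0$, $t\ge0$) such that $\widetilde P(s,p,q)=\sum_\alpha h(d(p,\alpha q))e^{-s\,d(p,\alpha q)}$ has critical exponent $\delta_\Gamma$ and diverges at $\delta_\Gamma$ ($h\equiv1$ if $P$ already diverges at $\delta_\Gamma$). Fix $q$; a Patterson--Sullivan measure is a $\delta_\Gamma$-dimensional conformal density $\{\mu_p\}$ obtained as weak-$*$ limits (on the compact space $\widetilde M\cup\widetilde M(\infty)$) $\mu_p=\lim_n\mu_{p,q,s_n}$ for a sequence $s_n\downarrow\delta_\Gamma$, where $\mu_{p,q,s}=\widetilde P(s,q,q)^{-1}\sum_\alpha h(d(p,\alpha q))e^{-s\,d(p,\alpha q)}\delta_{\alpha q}$ ($\delta_{\alpha q}$ the Dirac mass). *)

(* Defs.v *)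
From HB Require Import structures.
From mathcomp Require Import all_boot all_order all_algebra.
From mathcomp Require Import all_classical all_reals all_analysis.

Set Implicit Arguments.
Unset Strict Implicit.
Unset Printing Implicit Defensive.

Import Order.TTheory GRing.Theory Num.Theory.
Import numFieldNormedType.Exports.

Local Open Scope classical_set_scope.
Local Open Scope ring_scope.

Section Euclidean.
Context {R : realType} {n : nat}.
Notation V := 'rV[R]_n.

Definition partial (k : 'I_n) (f : V -> R) : V -> R := 'D_(delta_mx 0 k) f.

Fixpoint class_C (m : nat) (U : set V) (f : V -> R) : Prop :=
  match m with
  | 0%N => forall y, U y -> {for y, continuous f}
  | m'.+1 =>
      (forall y k, U y -> derivable f y (delta_mx 0 k)) /\
      (forall k, class_C m' U (partial k f))
  end.

(* Only meaningful for open U. *)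
Definition smooth_on (U : set V) (f : V -> R) : Prop :=
  forall m, class_C m U f.

Section Metric.
Variable g : V -> 'M[R]_n.

(* Gamma^k_{ab} *)
Definition christoffel (y : V) (k a b : 'I_n) : R :=
  2^-1 * \sum_l invmx (g y) k l *
    (partial a (fun z => g z b l) y + partial b (fun z => g z a l) y
     - partial l (fun z => g z a b) y).

Definition christoffel_form (y u v : V) : V :=
  \row_k \sum_a \sum_b christoffel y k a b * u 0 a * v 0 b.

(* R^l_{abc}, where R(d_a, d_b) d_c = \sum_l R^l_{abc} d_l and
   R(X, Y) Z = D_X D_Y Z - D_Y D_X Z - D_[X, Y] Z *)
Definition riemann_coef (y : V) (l a b c : 'I_n) : R :=
  partial a (fun z => christoffel z l b c) y
  - partial b (fun z => christoffel z l a c) y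
  + \sum_m (christoffel y l a m * christoffel y m b c
            - christoffel y l b m * christoffel y m a c).

Definition curvature (y X Y Z : V) : V :=
  \row_l \sum_a \sum_b \sum_c
    riemann_coef y l a b c * X 0 a * Y 0 b * Z 0 c.

(* In coordinates: y is the curve, J a vector field along it. *)
Definition cov_deriv (y J : R -> V) (t : R) : V :=
  derive1 J t + christoffel_form (y t) (derive1 y t) (J t).

End Metric.
End Euclidean.

(* The smooth atlas is indexed by chart_idx and chart_inv i is only relevant
   on the image of chart_dom i.  metric i is the matrix (g_ab) of the metric
   tensor in the chart i; with row vectors, the matrix of the differential of
   a map f acts on the right and is 'J f y.  Each point x has a preferred chart
   chart_at x, in which tangent vectors at x are written.  The manifold is
   nonempty since its carrier is pointed. *)
Structure riemannianManifold (R : realType) (n : nat) := RiemannianManifold {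
  carrier :> ptopologicalType;
  chart_idx : Type;
  chart_dom : chart_idx -> set carrier;
  chart : chart_idx -> carrier -> 'rV[R]_n;
  chart_inv : chart_idx -> 'rV[R]_n -> carrier;
  chart_at : carrier -> chart_idx;
  metric : chart_idx -> 'rV[R]_n -> 'M[R]_n;
  manifold_hausdorff : hausdorff_space carrier;
  manifold_second_countable : @second_countable carrier;
  chart_at_dom : forall x, chart_dom (chart_at x) x;
  chart_dom_open : forall i, open (chart_dom i);
  chart_img_open : forall i, open (chart i @` chart_dom i);
  chart_invK : forall i x, chart_dom i x -> chart_inv i (chart i x) = x;
  chart_continuous : forall i x, chart_dom i x -> {for x, continuous (chart i)};
  chart_inv_continuous : forall i x, chart_dom i x ->
    {for chart i x, continuous (chart_inv i)};
  chart_smooth : forall i j k,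
    smooth_on (chart i @` (chart_dom i `&` chart_dom j))
      (fun y => chart j (chart_inv i y) 0 k);
  metric_smooth : forall i a b,
    smooth_on (chart i @` chart_dom i) (fun y => metric i y a b);
  metric_sym : forall i x, chart_dom i x ->
    (metric i (chart i x))^T = metric i (chart i x);
  metric_pos : forall i x (v : 'rV[R]_n), chart_dom i x -> v != 0 ->
    0 < (v *m metric i (chart i x) *m v^T) 0 0;
  metric_compat : forall i j x, chart_dom i x -> chart_dom j x ->
    let D := 'J (chart j \o chart_inv i) (chart i x) in
    metric i (chart i x) = D *m metric j (chart j x) *m D^T
}.

Definition path_connected_space (R : realType) (T : topologicalType) : Prop :=
  forall x y : T, exists f : R -> T,
    [/\ {within `[0, 1]%classic, continuous f}, f 0 = x & f 1 = y].

Definition loops_contract (R : realType) (T : topologicalType) : Prop :=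
  forall f : R -> T, {within `[0, 1]%classic, continuous f} -> f 0 = f 1 ->
  exists H : R * R -> T,
    [/\ {within `[0, 1]%classic `*` `[0, 1]%classic, continuous H},
        forall t, t \in `[0, 1] -> H (0, t) = f t /\ H (1, t) = f 0
      & forall s, s \in `[0, 1] -> H (s, 0) = f 0 /\ H (s, 1) = f 0].

Definition simply_connected (R : realType) (T : topologicalType) : Prop :=
  path_connected_space R T /\ loops_contract R T.

Section Riemannian.
Context {R : realType} {n : nat} (M : riemannianManifold R n).
Implicit Types (p q x z : M) (c : R -> M) (v w : 'rV[R]_n) (t : R).

Definition inner x v w : R :=
  (v *m metric (chart_at x) (chart (chart_at x) x) *m w^T) 0 0.

Definition tnorm x v : R := Num.sqrt (inner x v v).

Definition tangle x v w : R := acos (inner x v w / (tnorm x v * tnorm x w)).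

Definition velocity c t : 'rV[R]_n := derive1 (chart (chart_at (c t)) \o c) t.

Definition curve_C1 c : Prop :=
  continuous c /\
  forall i t, chart_dom i (c t) ->
    derivable (chart i \o c) t 1 /\ {for t, continuous (derive1 (chart i \o c))}.

Definition curve_length c : R :=
  \int[lebesgue_measure]_(t in `[0, 1]) tnorm (c t) (velocity c t).

(* pw_joins x y L: some piecewise C^1 curve from x to y has length L.
   The pieces are restrictions to [0, 1] of curves defined on R; this is no
   restriction on the curve, as a C^1 curve on [0, 1] extends to R. *)
Inductive pw_joins : M -> M -> R -> Prop :=
| pw_refl x : pw_joins x x 0
| pw_cons c y L : curve_C1 c -> pw_joins (c 1) y L ->
    pw_joins (c 0) y (curve_length c + L).

Definition dist x (y : M) : R := inf [set L | pw_joins x y L].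

Definition dball q (r : R) : set M := [set x | dist q x < r].

(* Geodesics have unit speed and are parametrized by the whole line. *)
Definition is_geodesic c : Prop :=
  [/\ continuous c,
      forall t, tnorm (c t) (velocity c t) = 1
    & forall i t, chart_dom i (c t) ->
      let u := chart i \o c in
      [/\ derivable u t 1, derivable (derive1 u) t 1
        & derive1 (derive1 u) t
          + christoffel_form (metric i) (u t) (derive1 u t) (derive1 u t)
          = 0]].

Definition complete_manifold : Prop :=
  forall x v, tnorm x v = 1 ->
    exists c, [/\ is_geodesic c, c 0 = x & velocity c 0 = v].

(* J i is the expression in the chart i of a vector field along c; its value at
   t is only relevant if c t is in the domain of the chart. *)
Definition vector_field_along c (J : chart_idx M -> R -> 'rV[R]_n) : Prop :=
  forall i j t, chart_dom i (c t) -> chart_dom j (c t) ->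
    J j t = J i t *m 'J (chart j \o chart_inv i) (chart i (c t)).

Definition field_zero c (J : chart_idx M -> R -> 'rV[R]_n) t : Prop :=
  forall i, chart_dom i (c t) -> J i t = 0.

Definition is_jacobi c (J : chart_idx M -> R -> 'rV[R]_n) : Prop :=
  vector_field_along c J /\
  forall i t, chart_dom i (c t) ->
    let u := chart i \o c in
    let DJ := cov_deriv (metric i) u (J i) in
    [/\ derivable (J i) t 1, derivable DJ t 1
      & cov_deriv (metric i) u DJ t
        + curvature (metric i) (u t) (J i t) (derive1 u t) (derive1 u t) = 0].

Definition no_conjugate_points : Prop :=
  forall c J, is_geodesic c -> is_jacobi c J ->
  forall t1 t2, t1 != t2 -> field_zero c J t1 -> field_zero c J t2 ->
  forall t, field_zero c J t.

Definition smooth_map (f : M -> M) : Prop :=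
  continuous f /\
  forall i j k,
    smooth_on (chart i @` (chart_dom i `&` f @^-1` chart_dom j))
      (fun y => chart j (f (chart_inv i y)) 0 k).

Definition preserves_metric (f : M -> M) : Prop :=
  forall i j x, chart_dom i x -> chart_dom j (f x) ->
    let D := 'J (chart j \o f \o chart_inv i) (chart i x) in
    metric i (chart i x) = D *m metric j (chart j (f x)) *m D^T.

Definition is_isometry (f : M -> M) : Prop :=
  [/\ smooth_map f, preserves_metric f
    & exists g, [/\ smooth_map g, cancel f g & cancel g f]].

(* The isometry group carries the compact-open topology. *)
Definition discrete_isometry_group (Gamma : set (M -> M)) : Prop :=
  [/\ Gamma `<=` is_isometry,
      Gamma id,
      forall a b, Gamma a -> Gamma b -> Gamma (a \o b),
      forall a, Gamma a -> exists b, [/\ Gamma b, cancel a b & cancel b a]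
    & forall a, Gamma a ->
      isolated (Gamma : set {compact-open, M -> M}) a].

Definition asymptotic c1 c2 : Prop :=
  exists C : R, forall t, 0 <= t -> dist (c1 t) (c2 t) <= C.

Definition asymptote_class c : set (R -> M) :=
  [set c' | is_geodesic c' /\ asymptotic c c'].

Definition ideal_boundary : Type :=
  {xi : set (R -> M) | exists2 c, is_geodesic c & xi = asymptote_class c}.

HB.instance Definition _ := gen_eqMixin ideal_boundary.
HB.instance Definition _ := gen_choiceMixin ideal_boundary.

(* xi = c(+oo) *)
Definition at_infinity c (xi : ideal_boundary) : Prop := sval xi c.

Definition bordification : Type := (M + ideal_boundary)%type.

HB.instance Definition _ := gen_eqMixin bordification.
HB.instance Definition _ := gen_choiceMixin bordification.
HB.instance Definition _ := isPointed.Build bordification (inl point).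

Definition of_point x : bordification := inl x.
Definition of_ideal (xi : ideal_boundary) : bordification := inr xi.

Definition goes_to c (x : bordification) : Prop :=
  match x with
  | inl z => exists2 t, 0 < t & c t = z
  | inr xi => at_infinity c xi
  end.

(* The geodesic c_{p,x}.  If there were none, this would be the constant curve,
   whose (zero) velocity is at angle pi/2 from every vector. *)
Definition geod p (x : bordification) : R -> M :=
  xget (cst p) [set c | [/\ is_geodesic c, c 0 = p & goes_to c x]].

Definition angle p (x y : bordification) : R :=
  tangle p (velocity (geod p x) 0) (velocity (geod p y) 0).

(* x = c(e), where c(-oo) is the point at infinity of the reversed curve. *)
Definition endpoint c (e : \bar R) (x : bordification) : Prop :=
  match e, x with
  | EFin t, inl z => z = c t
  | +oo%E, inr xi => at_infinity c xi
  | -oo%E, inr xi => at_infinity (fun t => c (- t)) xi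
  | _, _ => False
  end.

Definition visibility : Prop :=
  forall p (eps : R), 0 < eps -> exists2 r : R, 0 < r &
  forall c (a b : \bar R) (x y : bordification),
    is_geodesic c -> (a < b)%E -> endpoint c a x -> endpoint c b y ->
    (forall t, (a <= t%:E)%E -> (t%:E <= b)%E -> r <= dist p (c t)) ->
    angle p x y <= eps.

Definition farther p (r : R) (x : bordification) : Prop :=
  match x with inl z => r < dist p z | inr _ => True end.

Definition truncated_cone p v (eps r : R) : set bordification :=
  [set x | tangle p (velocity (geod p x) 0) v < eps /\ farther p r x].

Definition cone_subbase : set (set bordification) :=
  [set of_point @` U | U in [set U : set M | open U]] `|`
  [set A | exists p v eps r,
    [/\ tnorm p v = 1, 0 < eps, 0 < r & A = truncated_cone p v eps r]].

HB.instance Definition _ :=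
  isSubBaseTopological.Build bordification cone_subbase idfun.

Definition borel_bordification : Type :=
  g_sigma_algebraType (@open bordification).

HB.instance Definition _ := Measurable.on borel_bordification.

(* pr_p (B(q, r)) *)
Definition shadow p q (r : R) : set ideal_boundary :=
  [set xi | exists z, [/\ dball q r z, z <> p
                        & at_infinity (geod p (of_point z)) xi]].

(* beta_xi(p, x) *)
Definition busemann (xi : ideal_boundary) p x : R :=
  lim ((dist p (geod x (of_ideal xi) t) - t) @[t --> +oo]).

(* alpha(A) for A in the ideal boundary *)
Definition ideal_image (a : M -> M) (A : set ideal_boundary) :
    set ideal_boundary :=
  [set eta | exists xi c,
    [/\ A xi, at_infinity c xi & at_infinity (a \o c) eta]].

Definition limit_set (Gamma : set (M -> M)) p : set ideal_boundary :=
  [set xi | closure [set of_point (a p) | a in Gamma] (of_ideal xi)].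

Definition non_elementary (Gamma : set (M -> M)) p : Prop :=
  infinite_set (limit_set Gamma p).

Definition poincare_series (Gamma : set (M -> M)) (s : R) p q : \bar R :=
  \esum_(a in Gamma) (expR (- s * dist p (a q)))%:E.

Definition modified_series (h : R -> {posnum R}) (Gamma : set (M -> M)) (s : R)
    p q : \bar R :=
  \esum_(a in Gamma)
    ((h (dist p (a q)))%:num * expR (- s * dist p (a q)))%:E.

(* +oo if the series F diverges for all s *)
Definition critical_exponent (F : R -> \bar R) : \bar R :=
  ereal_inf [set s%:E | s in [set s : R | 0 <= s /\ (F s < +oo)%E]].

Definition patterson_function (Gamma : set (M -> M)) (delta : R)
    (h : R -> {posnum R}) : Prop :=
  [/\ forall t1 t2, 0 <= t1 -> t1 <= t2 -> (h t1)%:num <= (h t2)%:num,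
      forall eps : R, 0 < eps -> exists r0 : R, forall r t : R,
        0 <= r -> r0 <= r -> 0 <= t ->
        (h (r + t))%:num <= expR (eps * t) * (h r)%:num,
      forall p q,
        critical_exponent (fun s => modified_series h Gamma s p q) = delta%:E
        /\ modified_series h Gamma delta p q = +oo%E
    & (forall p q, poincare_series Gamma delta p q = +oo%E) ->
      forall t, 0 <= t -> (h t)%:num = 1].

End Riemannian.

(* The measure \sum_(i in I) w i * \d_(f i). *)
Section WeightedDirac.
Context {R : realType} {d : measure_display} {T : measurableType d}
  {J : choiceType}.
Variables (I : set J) (w : J -> {nonneg R}) (f : J -> T).
Local Open Scope ereal_scope.

Definition weighted_dirac (A : set T) : \bar R :=
  \esum_(i in I) ((w i)%:num%:E * \d_(f i) A).

Let weighted_dirac0 : weighted_dirac set0 = 0.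
Proof. by apply: esum1 => i _; rewrite measure0 mule0. Qed.

Let weighted_dirac_ge0 A : 0 <= weighted_dirac A.
Proof. by apply: esum_ge0 => i _; rewrite mule_ge0// lee_fin. Qed.

Let weighted_dirac_sigma_additive : semi_sigma_additive weighted_dirac.
Proof.
move=> F mF tF mUF; rewrite /weighted_dirac.
have -> : \esum_(i in I) ((w i)%:num%:E * \d_(f i) (\bigcup_k F k)) =
    \sum_(k <oo) \esum_(i in I) ((w i)%:num%:E * \d_(f i) (F k)).
  have h0 i k : 0 <= (w i)%:num%:E * \d_(f i) (F k).
    by rewrite mule_ge0// lee_fin.
  rewrite nneseries_esumT; last by move=> k; apply: esum_ge0.
  rewrite esum_esum//.
  transitivity (\esum_(i in I) \esum_(k in [set: nat])
      ((w i)%:num%:E * \d_(f i) (F k))).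
    apply: eq_esum => i _.
    rewrite measure_bigcup// -nneseries_esumT// nneseriesZl//.
    by congr (_ * _); apply: eq_eseriesl => k; rewrite in_setT.
  rewrite esum_esum//.
  rewrite (reindex_esum ([set: nat] `*`` fun=> I) _ (fun x => (x.2, x.1)))//.
  split.
  - by move=> [k i] /= [].
  - by move=> [k i] [k' i'] _ _ /= [-> ->].
  - by move=> [i k] /= [Ii _]; exists (k, i).
by apply: is_cvg_nneseries => k _ _; apply: esum_ge0 => i _;
  rewrite mule_ge0// lee_fin.
Qed.

HB.instance Definition _ := isMeasure.Build d T R weighted_dirac
  weighted_dirac0 weighted_dirac_ge0 weighted_dirac_sigma_additive.

End WeightedDirac.

Section PattersonSullivan.
Context {R : realType} {n : nat} (M : riemannianManifold R n).
Implicit Types (Gamma : set (M -> M)) (p q o : M) (s r : R)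
  (h : R -> {posnum R}).

(* Finite Borel measures on the ideal boundary are viewed as Borel measures on
   the bordification for which M is a null set. *)
Definition boundary_measures : Type :=
  M -> {finite_measure set (borel_bordification M) -> \bar R}.

Definition support (mu : set (borel_bordification M) -> \bar R) :
    set (bordification M) :=
  [set x | forall U : set (bordification M), open U -> U x -> (0 < mu U)%E].

(* The limit set does not depend on the point o. *)
Definition conformal_density Gamma o r (mu : boundary_measures) : Prop :=
  [/\ forall p, mu p (range (@of_point _ _ M)) = 0%E,
      forall p, support (mu p) `<=` @of_ideal _ _ M @` limit_set Gamma o,
      forall p q, mu p `<< mu q /\
        {ae mu q, forall x, forall xi, x = of_ideal xi ->
          Radon_Nikodym (charge_of_finite_measure (mu p)) (mu q) x
          = (expR (- r * busemann xi p q))%:E}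
    & forall a p (A : set (ideal_boundary M)), Gamma a ->
        measurable (@of_ideal _ _ M @` A : set (borel_bordification M)) ->
        mu (a p) (@of_ideal _ _ M @` ideal_image a A)
        = mu p (@of_ideal _ _ M @` A)].

Definition ps_weight h s p q (a : M -> M) : {nonneg R} :=
  ((h (dist p (a q)))%:num * expR (- s * dist p (a q)))%:nng.

Lemma ps_norm_ge0 h Gamma s q :
  0 <= (fine (modified_series h Gamma s q q))^-1.
Proof.
by rewrite invr_ge0 fine_ge0// esum_ge0.
Qed.

(* mu_{p,q,s} *)
Definition ps_approx h Gamma p q s :
    {measure set (borel_bordification M) -> \bar R} :=
  mscale (NngNum (ps_norm_ge0 h Gamma s q))
    (weighted_dirac Gamma (ps_weight h s p q)
      (fun a => of_point (a q) : borel_bordification M)).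

Definition weak_star_cvg
    (mu_ : nat -> {measure set (borel_bordification M) -> \bar R})
    (mu : {measure set (borel_bordification M) -> \bar R}) : Prop :=
  forall f : bordification M -> R, continuous f ->
    (\int[mu_ k]_x (f x)%:E @[k --> \oo] --> \int[mu]_x (f x)%:E)%E.

Definition patterson_sullivan Gamma q (delta : R) h
    (mu : boundary_measures) : Prop :=
  conformal_density Gamma q delta mu /\
  exists s_ : nat -> R,
    [/\ forall k, delta < s_ k,
        forall k, s_ k.+1 <= s_ k,
        s_ k @[k --> \oo] --> delta
      & forall p, weak_star_cvg (fun k => ps_approx h Gamma p q (s_ k)) (mu p)].

End PattersonSullivan.

(* Main.v *)
(** Completeness and the absence of conjugate points make the exponential map at
    p a local diffeomorphism, and by the Gauss lemma the lift of a curve through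
    it moves radially no faster than the curve itself.  Hence paths lift, simple
    connectedness makes the exponential map a homeomorphism, and
    d(p, exp_p v) = |v|.

    Visibility, applied to tails of geodesics, gives the existence and the
    uniqueness of the rays c_{p,xi}.  It also shows that beta_xi(x, q) >=
    d(x, q) - 2r for xi in the shadow of B(q, r) from x, because the geodesic
    from x to c_{q,xi}(t) converges to c_{x,xi} as t grows, while beta_xi(x, q) <=
    d(x, q) always holds.  So mu_x(shadow) is comparable to
    e^{-delta d(x, q)} mu_q(shadow), and by equivariance only a lower bound for
    mu_o(shadow) is missing.  By visibility the complement of a shadow of large
    radius is seen from o under a small angle, so by compactness of the unit
    sphere such a bound holds unless mu_o is concentrated at a point xi.

    In that case Gamma fixes xi.  Two elements of Gamma moving o close to
    distinct limit points other than xi generate a free semigroup by a ping-pong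
    argument in the complement of a cone around xi, whence delta > 0.  Comparing
    the masses of xi for mu_{alpha o} and mu_o now gives beta_xi(alpha o, o) = 0
    for all alpha in Gamma, whereas beta_xi(alpha o, o) >= d(alpha o, o) - 2R
    when alpha o is close to a limit point other than xi. *)

Require Import Defs.
From HB Require Import structures.
From mathcomp Require Import all_boot all_order all_algebra.
From mathcomp Require Import all_classical all_reals all_analysis.
From mathcomp Require Import measurable_realfun.
From mathcomp Require Import ring lra.

Set Implicit Arguments.
Unset Strict Implicit.
Unset Printing Implicit Defensive.

Import Order.TTheory GRing.Theory Num.Theory.
Import numFieldNormedType.Exports.

Local Open Scope classical_set_scope.
Local Open Scope ring_scope.

(** The definitions supply little, and this shapes the first half. [complete_manifold] gives
    geodesics but no flow, so smooth dependence on initial vectors is derived from Lipschitz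
    estimates. [dist] is an infimum over curves, seen to be attained and definite only once the
    exponential map is a bijection. Isometries are smooth maps preserving the metric tensor; the
    equality case of the Gauss lemma shows that they map geodesics to geodesics.

    Path lifting takes two stages: the Gauss bound controls only curves that have a speed, whereas
    loops and homotopies are merely continuous. So straight segments in charts are lifted, and the
    ends of their lifts are local sections over evenly covered neighbourhoods.

    In the second half equivariance moves the ball back to a centre [q] in [K], while the viewpoint
    ranges over all of [M]; every estimate must be uniform in the viewpoint. Angles are replaced by
    chords |u - v| of unit vectors. The threshold for the radius is a visibility constant at [o]
    plus the distance within which [K] lies from [o]. *)

Ltac pos := first [ done | assumption | (apply: ltW; assumption)
  | (apply: divr_gt0; pos) | (apply: divr_ge0; pos)
  | (apply: mulr_gt0; pos) | (apply: mulr_ge0; pos)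
  | (apply: addr_gt0; pos) | (apply: ltr_wpDr; pos) | (apply: ltr_wpDl; pos)
  | (apply: addr_ge0; pos)
  | (apply: exprn_gt0; pos) | (apply: exprn_ge0; pos) | (apply: ltW; pos) ].

(** * Calculus on the line *)

Section RealInduction.
Context {R : realType}.

(** The supremum of the initial segments on which [P] holds satisfies [P] by the third premise, and
    by the second it cannot lie below [b]. Below, this serves as the compactness and the
    connectedness of segments. *)
Lemma real_induction (a b : R) (P : R -> Prop) : P a ->
  (forall x, a <= x < b -> (forall y, a <= y <= x -> P y) ->
    exists2 e, 0 < e & forall y, x < y < x + e -> y <= b -> P y) ->
  (forall x, a < x <= b -> (forall y, a <= y < x -> P y) -> P x) ->
  forall x, a <= x <= b -> P x.
Proof.
move=> Pa Popen Pclosed.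
have [ba|ab] := ltP b a.
  by move=> x /andP[ax xb]; move: (le_trans ax xb); rewrite leNgt ba.
pose S := [set x | a <= x <= b /\ forall y, a <= y <= x -> P y].
have Sa : S a.
  by split; rewrite ?lexx// => y /andP[ay ya]; rewrite (@le_anti _ _ y a) ?ya.
have Sb : ubound S b by move=> x [/andP[]].
have hS : has_sup S by split; [exists a | exists b].
set s := sup S.
have as_ : a <= s by exact: ub_le_sup hS.2 _ Sa.
have sb : s <= b by exact: ge_sup hS.1 Sb.
have Plt y : a <= y < s -> P y.
  move=> /andP[ay ys]; have [x [_ Px] yx] := sup_gt hS.1 ys.
  by apply: Px; rewrite ay ltW.
have Ps y : a <= y <= s -> P y.
  move=> /andP[ay]; rewrite le_eqVlt => /orP[/eqP ->|ys]; last first.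
    by apply: Plt; rewrite ay.
  have [<-//|sa] := eqVneq a s.
  by apply: Pclosed Plt; rewrite lt_neqAle sa as_.
have bs : b <= s.
  rewrite leNgt; apply/negP => ltsb.
  have [|e e0 Pe] := Popen s _ Ps; first by rewrite as_.
  pose x := Num.min b (s + e / 2).
  have xs : s < x by rewrite lt_min ltsb ltrDl divr_gt0.
  suff /(ub_le_sup hS.2) : S x by rewrite leNgt xs.
  split; first by rewrite (le_trans as_ (ltW xs)) ge_min lexx.
  move=> y /andP[ay yx]; have [ys|ys] := leP y s; first by apply: Ps; rewrite ay.
  move: yx; rewrite le_min => /andP[yb yse]; apply: Pe => //.
  rewrite ys (le_lt_trans yse)// ltrD2l ltr_pdivrMr// mulr_natr mulr2n.
  by rewrite ltrDl.
by move=> x /andP[ax xb]; apply: Ps; rewrite ax (le_trans xb).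
Qed.

(** Connectedness of the line, in the form that carries a property of one time along a whole curve:
    near each [x] it suffices to pass from any time to any other. *)
Lemma locally_constant (P : R -> Prop) (t0 : R) : P t0 ->
  (forall x, exists2 e, 0 < e &
     forall s t, `|s - x| < e -> `|t - x| < e -> P s -> P t) ->
  forall t, P t.
Proof.
move=> P0 loc t.
suff H (Q : R -> Prop) : Q 0 -> (forall x, exists2 e, 0 < e &
     forall s t, `|s - x| < e -> `|t - x| < e -> Q s -> Q t) ->
    forall x, 0 <= x -> Q x.
  have [tt|tt] := leP t0 t.
    have := H (fun x => P (t0 + x)); rewrite addr0 => /(_ P0).
    rewrite -[in X in _ -> P X](subrKC t0 t); apply; last by rewrite subr_ge0.
    move=> x; have [e e0 he] := loc (t0 + x); exists e => // r s hr hs.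
    by apply: he; rewrite opprD addrACA subrr add0r.
  have := H (fun x => P (t0 - x)); rewrite subr0 => /(_ P0).
  rewrite -[in X in _ -> P X](subKr t0 t); apply; last by rewrite subr_ge0 ltW.
  move=> x; have [e e0 he] := loc (t0 - x); exists e => // r s hr hs.
  have E u : t0 - u - (t0 - x) = - (u - x) by ring.
  by apply: he; rewrite E normrN.
move=> Q0 locQ x x0.
apply: (@real_induction 0 x) => //; rewrite ?x0 ?lexx//.
  move=> y /andP[y0 yx] Qy; have [e e0 he] := locQ y; exists e => // z yz _.
  apply: (he y); rewrite ?subrr ?normr0//; last by apply: Qy; rewrite y0 lexx.
  by case/andP: yz => y1 y2; rewrite ger0_norm ?subr_ge0 ?ltW// ltrBlDl.
move=> y /andP[y0 yx] Qy; have [e e0 he] := locQ y.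
pose z := Num.max 0 (y - e / 2).
have zy : z < y by rewrite gt_max y0/= ltrBlDr ltrDl divr_gt0.
apply: (he z); rewrite ?subrr ?normr0//; last first.
  by apply: Qy; rewrite zy le_max lexx.
rewrite distrC ger0_norm ?subr_ge0 ?ltW// ltrBlDl -ltrBlDr lt_max.
by apply/orP; right; rewrite ltrD2l ltrN2 ltr_pdivrMr// mulr_natr mulr2n ltrDl.
Qed.

End RealInduction.

Section CurveDerivatives.
Context {R : realType} {W : normedModType R}.
Implicit Types (f : R -> W) (t : R).

(** The derivative as a first-order approximation: without a quotient the case [s = t] is included,
    and such estimates can be added. *)
Lemma is_deriveP f t d :
  is_derive t 1 f d <-> forall e : R, 0 < e -> exists2 r : R, 0 < r &
    forall s : R, `|s - t| < r ->
      `|f s - f t - (s - t) *: d| <= e * `|s - t|.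
Proof.
split=> [[df dfE] e e0|H].
  move/cvgrPdist_le : df => /(_ _ e0)[/= r r0 hr]; exists r => // s sr.
  rewrite -/(derive f t 1) dfE in hr.
  have [->|st] := eqVneq s t; first by rewrite !subrr scale0r subr0 !normr0 mulr0.
  have st0 : s - t != 0 by rewrite subr_eq0.
  have := hr (s - t); rewrite /= sub0r normrN => /(_ sr st0).
  rewrite [_%:A]mulr1 subrK.
  have -> : f s - f t - (s - t) *: d =
      - ((s - t) *: (d - (s - t)^-1 *: (f s - f t))).
    by rewrite scalerBr scalerA mulfV// scale1r opprB.
  by move=> h; rewrite normrN normrZ mulrC ler_pM2r// normr_gt0.
have c : (h^-1 *: (f (h *: 1 + t) - f t)) @[h --> 0^'] --> d.
  apply/cvgrPdist_le => e e0; have [r r0 hr] := H e e0.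
  exists r => //= h; rewrite /= sub0r normrN => hr' h0.
  have := hr (h + t); rewrite addrK => /(_ hr').
  rewrite [_%:A]mulr1 => hh.
  have h1 : 0 < `|h| by rewrite normr_gt0.
  rewrite -(ler_pM2l h1) -normrZ scalerBr scalerA mulfV// scale1r mulrC.
  by rewrite distrC.
by apply: DeriveDef; [apply/cvg_ex; exists d|exact/cvg_lim].
Qed.

Lemma is_derive_cont f t d : is_derive t 1 f d ->
  forall e : R, 0 < e -> exists2 r : R, 0 < r &
    forall s : R, `|s - t| < r -> `|f s - f t| < e.
Proof.
move=> /is_deriveP /(_ _ ltr01)[r r0 hr] e e0.
have d1 : 0 < 1 + `|d| by rewrite ltr_wpDr.
exists (Num.min r (e / (1 + `|d|))); first by rewrite lt_min r0 divr_gt0.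
move=> s; rewrite lt_min => /andP[/hr h1 h2].
rewrite -(subrK ((s - t) *: d) (f s - f t)) (le_lt_trans (ler_normD _ _))//.
apply: (@le_lt_trans _ _ ((1 + `|d|) * `|s - t|)).
  by rewrite mulrDl lerD// normrZ mulrC.
by rewrite mulrC -ltr_pdivlMr.
Qed.

Lemma is_derive_scalel (w : W) t : is_derive t 1 (fun u : R => u *: w) w.
Proof.
apply/is_deriveP => e e0; exists 1 => // s _.
by rewrite -scalerBl subrr normr0 mulr_ge0// ltW.
Qed.

Lemma dnbhs0_norm_le f (l x : W) (e q : R) : 0 < q -> f k @[k --> 0^'] --> l ->
  (forall k : R, k != 0 -> `|k| < q -> `|x - f k| <= e) -> `|x - l| <= e.
Proof.
move=> q0 /cvgrPdist_le c h; apply/ler_addgt0Pr => m m0.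
have N : \forall u \near (0 : R)^', u != 0 /\ `|u| < q.
  by exists q => //= u; rewrite /= sub0r normrN => uq u0.
have [k [[k0 kq] hk]] := filter_ex (filterI N (c _ m0)).
rewrite -(subrKA (f k)) (le_trans (ler_normD _ _))// lerD ?h//.
by rewrite distrC.
Qed.

(** Vector-valued functions have no mean value theorem. With the slightly larger slope [K + k] the
    bound propagates by real induction; [k] is chosen so that the total excess over [[a, b]] is
    [e]. *)
Lemma mean_value_inequality f f' (a b K : R) : a <= b ->
  (forall t : R, a <= t <= b -> is_derive t 1 f (f' t)) ->
  (forall t : R, a <= t <= b -> `|f' t| <= K) ->
  `|f b - f a| <= K * (b - a).
Proof.
move=> ab df bf; apply/ler_addgt0Pr => e e0.
have [ba|{}ab] := leP b a.
  by rewrite (@le_anti _ _ b a) ?ba// !subrr normr0 mulr0 add0r ltW.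
have K0 : 0 <= K by rewrite (le_trans _ (bf a _))// lexx ltW.
pose k := e / (b - a); have k0 : 0 < k by rewrite divr_gt0// subr_gt0.
have -> : K * (b - a) + e = (K + k) * (b - a).
  by rewrite mulrDl [k * _]mulfVK// subr_eq0 gt_eqF.
pose P t := `|f t - f a| <= (K + k) * (t - a).
apply: (@real_induction _ a b P) => //; rewrite ?(ltW ab) ?lexx//.
- by rewrite /P !subrr normr0 mulr0.
- move=> x /andP[ax xb] /(_ x); rewrite ax lexx /P => /(_ isT) Px.
  have xab : a <= x <= b by rewrite ax ltW.
  have /is_deriveP/(_ _ k0)[r r0 hr] := df x xab.
  exists r => // y /andP[xy yr] yb.
  have yx0 : 0 <= y - x by rewrite subr_ge0 ltW.
  have := hr y; rewrite ger0_norm// ltrBlDl => /(_ yr) h.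
  rewrite -(subrKA (f x)) (le_trans (ler_normD _ _))//.
  have -> : (K + k) * (y - a) = (K + k) * (y - x) + (K + k) * (x - a) by ring.
  rewrite lerD//.
  rewrite -(subrK ((y - x) *: f' x) (f y - f x)) (le_trans (ler_normD _ _))//.
  rewrite mulrDl [leRHS]addrC lerD// normrZ ger0_norm// mulrC ler_wpM2r//.
  exact: bf.
- move=> x /andP[ax xb] Px; rewrite /P; apply/ler_addgt0Pr => m m0.
  have xab : a <= x <= b by rewrite xb ltW.
  have [r r0 hr] := is_derive_cont (df x xab) m0.
  pose y := Num.max a (x - r / 2).
  have yx : y < x by rewrite gt_max ax ltrBlDr ltrDl divr_gt0.
  have ay : a <= y by rewrite le_max lexx.
  have yr : `|y - x| < r.
    rewrite distrC ger0_norm ?subr_ge0 ?(ltW yx)// ltrBlDl -ltrBlDr lt_max.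
    by rewrite ltrD2l ltrN2 gtr_pMr// invf_lt1// ltr1n orbT.
  have h := hr _ yr.
  rewrite -(subrKA (f y)) (le_trans (ler_normD _ _))// addrC lerD//.
    rewrite (le_trans (Px y _)) ?ay// ler_wpM2l ?addr_ge0 ?(ltW k0)//.
    by rewrite lerD2r ltW.
  by rewrite distrC ltW.
Qed.

(* On a time interval of length at most 1/(2L) the Gronwall estimate follows
   from the mean value inequality without an exponential. *)
Lemma gronwall_half f f' (s t L e : R) : 0 <= L -> 0 <= e ->
  L * `|t - s| <= 2^-1 ->
  (forall r : R, `|r - s| <= `|t - s| -> is_derive r 1 f (f' r)) ->
  (forall r : R, `|r - s| <= `|t - s| -> `|f' r| <= L * `|f r| + e) ->
  `|f t| <= 2 * `|f s| + 2 * e * `|t - s|.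
Proof.
move=> L0 e0 Ls df bf; set h := `|t - s| in Ls df bf *.
have h0 : 0 <= h by exact: normr_ge0.
have sh : s - h <= s + h by rewrite lerD2l (le_trans (y := 0)) ?oppr_le0.
have cf : {within `[s - h, s + h], continuous (fun r => `|f r|)}.
  apply: continuous_in_subspaceT => r; rewrite inE/= in_itv/= => hr.
  have rs : `|r - s| <= h by rewrite ler_distl.
  apply: cvg_norm; apply/cvgrPdist_lt => d d0.
  have [q q0 hq] := is_derive_cont (df _ rs) d0.
  by exists q => //= u; rewrite /= distrC => /hq; rewrite distrC.
have [c hc fc] := EVT_max sh cf.
have hcs : `|c - s| <= h by move: hc; rewrite in_itv/= ler_distl.
have bnd r : `|r - s| <= h -> `|f r| <= `|f s| + (L * `|f c| + e) * h.
  move=> rs.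
  have K r' : `|r' - s| <= h -> `|f' r'| <= L * `|f c| + e.
    move=> r's; rewrite (le_trans (bf _ r's))// lerD2r ler_wpM2l// fc//.
    by rewrite in_itv/= -ler_distl.
  rewrite -lerBlDl (le_trans (lerB_dist _ _))//.
  have M0 : 0 <= L * `|f c| + e by rewrite addr_ge0// mulr_ge0.
  have [sr|rs'] := leP s r.
    have sr' : `|r - s| = r - s by rewrite ger0_norm// subr_ge0.
    have su u : s <= u <= r -> `|u - s| <= h.
      move=> /andP[su ur]; rewrite ger0_norm ?subr_ge0//.
      by rewrite (le_trans _ rs)// sr' lerD2r.
    rewrite (le_trans (mean_value_inequality sr (fun u hu => df _ (su u hu))
      (fun u hu => K _ (su u hu))))//.
    by rewrite ler_wpM2l// -sr'.
  have sr' : `|r - s| = s - r by rewrite distrC ger0_norm// subr_ge0 ltW.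
  rewrite distrC.
  have su u : r <= u <= s -> `|u - s| <= h.
    move=> /andP[su ur]; rewrite distrC ger0_norm ?subr_ge0//.
    by rewrite (le_trans _ rs)// sr' lerD2l lerN2.
  rewrite (le_trans (mean_value_inequality (ltW rs') (fun u hu => df _ (su u hu))
    (fun u hu => K _ (su u hu))))//.
  by rewrite ler_wpM2l// -sr'.
(* The bound [bnd] at the maximum [c] contains |f c| itself, but with a factor [L * h] of at most
   1/2, so it is absorbed on the left. *)
have fc2 : `|f c| <= 2 * (`|f s| + e * h).
  have := bnd c hcs; have : L * `|f c| * h <= 2^-1 * `|f c|.
    by rewrite mulrAC ler_wpM2r.
  move: (L * `|f c|) => X; rewrite mulrDl; nra.
apply: (le_trans (y := `|f c|)); last by rewrite -mulrA -mulrDr.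
by apply: fc; rewrite in_itv/= -ler_distl.
Qed.

End CurveDerivatives.

(* Equalities in a module over a commutative ring, decided by comparing the
   coefficients of the atoms. *)
Section ModuleTactic.
Context {R : comPzRingType} {V : lmodType R}.

Inductive lexp :=
  LVar of nat | LZero | LAdd of lexp & lexp | LOpp of lexp | LScale of R & lexp.

Fixpoint leval (env : seq V) (e : lexp) : V :=
  match e with
  | LVar i => env`_i
  | LZero => 0
  | LAdd a b => leval env a + leval env b
  | LOpp a => - leval env a
  | LScale c a => c *: leval env a
  end.

Fixpoint lcoef (i : nat) (e : lexp) : R :=
  match e with
  | LVar j => if i == j then 1 else 0
  | LZero => 0
  | LAdd a b => lcoef i a + lcoef i b
  | LOpp a => - lcoef i a
  | LScale c a => c * lcoef i a
  end.

Fixpoint lsame (k : nat) (e f : lexp) : Prop :=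
  match k with
  | 0%N => True
  | k'.+1 => lcoef k' e = lcoef k' f /\ lsame k' e f
  end.

Lemma leval_coef env e :
  leval env e = \sum_(i < size env) lcoef i e *: env`_i.
Proof.
elim: e => [j||a IHa b IHb|a IHa|c a IHa] /=.
- have [js|js] := ltnP j (size env).
    rewrite (bigD1 (Ordinal js))//= eqxx scale1r big1 ?addr0// => i ij.
    by case: eqP => [E|_]; [case/eqP: ij; exact: val_inj|rewrite scale0r].
  rewrite nth_default// big1// => i _; case: eqP => [E|_]; last by rewrite scale0r.
  by have := ltn_ord i; rewrite E ltnNge js.
- by rewrite big1// => i _; rewrite scale0r.
- by rewrite IHa IHb -big_split; apply: eq_bigr => i _; rewrite scalerDl.
- by rewrite IHa -sumrN; apply: eq_bigr => i _; rewrite scaleNr.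
- by rewrite IHa scaler_sumr; apply: eq_bigr => i _; rewrite scalerA.
Qed.

Lemma leval_eq env e f : lsame (size env) e f -> leval env e = leval env f.
Proof.
move=> h; rewrite !leval_coef; apply: eq_bigr => i _; congr (_ *: _).
suff H k : lsame k e f -> (i < k)%N -> lcoef i e = lcoef i f by exact: H h _.
elim: k => // k IH /= [h1 h2]; rewrite ltnS leq_eqVlt => /orP[/eqP ->//|].
exact: IH.
Qed.

End ModuleTactic.

Ltac lmod_find x l :=
  match l with
  | x :: _ => constr:(0%N)
  | _ :: ?l' => let k := lmod_find x l' in constr:(S k)
  end.
Ltac lmod_add x l :=
  match l with
  | _ => let k := lmod_find x l in l
  | _ => let T := type of x in
      let rec app l := lazymatch l with
        | ?y :: ?l' => let r := app l' in constr:(y :: r)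
        | _ => constr:([:: x]) end in app l
  end.
Ltac lmod_atoms l t :=
  lazymatch t with
  | (?a + ?b)%R => let l1 := lmod_atoms l a in lmod_atoms l1 b
  | (- ?a)%R => lmod_atoms l a
  | (_ *: ?a)%R => lmod_atoms l a
  | 0%R => l
  | _ => lmod_add t l
  end.
Ltac lmod_reify R l t :=
  lazymatch t with
  | (?a + ?b)%R => let x := lmod_reify R l a in let y := lmod_reify R l b in
      constr:(@LAdd R x y)
  | (- ?a)%R => let x := lmod_reify R l a in constr:(@LOpp R x)
  | (?c *: ?a)%R => let x := lmod_reify R l a in constr:(@LScale R c x)
  | 0%R => constr:(@LZero R)
  | _ => let k := lmod_find t l in constr:(@LVar R k)
  end.
Ltac lmod_eq R :=
  lazymatch goal with
  | |- @eq ?V ?a ?b =>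
    let l0 := lmod_atoms (@nil V) a in
    let l := lmod_atoms l0 b in
    let x := lmod_reify R l a in
    let y := lmod_reify R l b in
    refine (@leval_eq _ _ l x y _);
    cbn [size lsame lcoef eq_op]; rewrite /=;
    repeat (split; [try ring|]); try exact I
  end.

(** * Strict differentiability and the inverse function theorem *)

Section NearNorm.
Context {R : realType} {V : normedModType R}.

Lemma near_normP (x : V) (P : V -> Prop) : (\forall y \near x, P y) <->
  exists2 r : R, 0 < r & forall y, `|y - x| < r -> P y.
Proof.
split=> [/nbhs_ballP[r r0 hr]|[r r0 hr]].
  exists r => // y yr; apply: hr.
  by rewrite -ball_normE /= distrC.
apply/nbhs_ballP; exists r => //= y.
by rewrite -ball_normE /= distrC; exact: hr.
Qed.

End NearNorm.

(** * Bounded linear maps *)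

Section BoundedLinear.
Context {R : realType}.
Implicit Types V W X : normedModType R.

(** A predicate on plain functions, so that derivatives can be explicit formulas without an inferred
    linear structure. The condition [0 < C] allows division by the bound. *)
Definition blin V W (L : V -> W) : Prop :=
  (forall (a : R) x y, L (a *: x + y) = a *: L x + L y) /\
  exists2 C : R, 0 < C & forall h, `|L h| <= C * `|h|.

Lemma blinD V W (L : V -> W) : blin L -> {morph L : x y / x + y}.
Proof. by move=> [lin _] x y; have := lin 1 x y; rewrite !scale1r. Qed.

Lemma blin0 V W (L : V -> W) : blin L -> L 0 = 0.
Proof.
by move=> bL; apply: (addrI (L 0)); rewrite -(blinD bL) !addr0.
Qed.

Lemma blinZ V W (L : V -> W) : blin L -> forall (a : R) x, L (a *: x) = a *: L x.
Proof.
by move=> bL a x; have := bL.1 a x 0; rewrite (blin0 bL) !addr0.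
Qed.

Lemma blinN V W (L : V -> W) : blin L -> {morph L : x / - x}.
Proof. by move=> bL x; rewrite -scaleN1r (blinZ bL) scaleN1r. Qed.

Lemma blinB V W (L : V -> W) : blin L -> {morph L : x y / x - y}.
Proof. by move=> bL x y; rewrite (blinD bL) (blinN bL). Qed.

Lemma blin_cst0 V W : blin (fun _ : V => 0 : W).
Proof.
split=> [a x y|]; first by rewrite scaler0 addr0.
by exists 1 => // h; rewrite normr0 mul1r.
Qed.

Lemma blin_id V : blin (@id V).
Proof. by split=> //; exists 1 => // h; rewrite mul1r. Qed.

Lemma blin_add V W (L K : V -> W) : blin L -> blin K -> blin (fun h => L h + K h).
Proof.
move=> [lL [C C0 hC]] [lK [D D0 hD]]; split=> [a x y|].
  by rewrite lL lK scalerDr addrACA.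
exists (C + D); first exact: addr_gt0.
by move=> h; rewrite (le_trans (ler_normD _ _))// mulrDl lerD.
Qed.

Lemma blin_comp V W X (L : V -> W) (K : W -> X) :
  blin L -> blin K -> blin (fun h => K (L h)).
Proof.
move=> [lL [C C0 hC]] [lK [D D0 hD]]; split=> [a x y|]; first by rewrite lL lK.
exists (D * C); first exact: mulr_gt0.
by move=> h; rewrite (le_trans (hD _))// -mulrA ler_wpM2l// ltW.
Qed.

Lemma blin_scale V (a : R) : blin (fun h : V => a *: h).
Proof.
split=> [b x y|]; first by rewrite scalerDr !scalerA mulrC.
exists (`|a| + 1) => [|h]; first by rewrite ltr_wpDl.
by rewrite normrZ ler_wpM2r// lerDl.
Qed.

Lemma blin_scalel V (v : V) : blin (fun h : R => h *: v).
Proof.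
split=> [b x y|]; first by rewrite scalerDl scalerA.
exists (`|v| + 1) => [|h]; first by rewrite ltr_wpDl.
by rewrite normrZ mulrC ler_wpM2r// lerDl.
Qed.

Lemma blin_opp V : blin (fun h : V => - h).
Proof.
have := blin_scale V (-1).
by under eq_fun do rewrite scaleN1r.
Qed.

Lemma blin_fst V W : blin (fun h : V * W => h.1).
Proof.
split=> // ; exists 1 => // h.
by rewrite mul1r [`|h|]prod_normE le_max lexx.
Qed.

Lemma blin_snd V W : blin (fun h : V * W => h.2).
Proof.
split=> // ; exists 1 => // h.
by rewrite mul1r [`|h|]prod_normE le_max lexx orbT.
Qed.

Lemma blin_pair V W X (L : V -> W) (K : V -> X) :
  blin L -> blin K -> blin (fun h => (L h, K h)).
Proof.
move=> [lL [C C0 hC]] [lK [D D0 hD]]; split=> [a x y|]; first by rewrite lL lK.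
exists (C + D) => [|h]; first exact: addr_gt0.
rewrite prod_normE ge_max /= (le_trans (hC _)) ?(le_trans (hD _))//.
  by rewrite ler_wpM2r// lerDr ltW.
by rewrite ler_wpM2r// lerDl ltW.
Qed.

Lemma mx_normP m n (A : 'M[R]_(m, n)) (e : R) : 0 <= e ->
  (forall i j, `|A i j| <= e) <-> `|A| <= e.
Proof.
move=> e0; rewrite [X in _ <-> X <= _]mx_normrE; split=> [h|/bigmax_leP[_ h] i j].
  by apply/bigmax_leP; split=> // -[i j] _; exact: h.
exact: (h (i, j)).
Qed.

Lemma mx_norm_coord m n (A : 'M[R]_(m, n)) i j : `|A i j| <= `|A|.
Proof. exact: (mx_normP A (normr_ge0 A)).2. Qed.

Lemma blin_coord n (i : 'I_n) : blin (fun h : 'rV[R]_n => h 0 i).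
Proof.
split=> [a x y|]; first by rewrite !mxE.
by exists 1 => // h; rewrite mul1r mx_norm_coord.
Qed.

Lemma blin_sum V W (I : Type) (r : seq I) (L : I -> V -> W) :
  (forall i, blin (L i)) -> blin (fun h => \sum_(i <- r) L i h).
Proof.
move=> bL; elim: r => [|i r ih].
  by under eq_fun do rewrite big_nil; exact: blin_cst0.
by under eq_fun do rewrite big_cons; exact: blin_add.
Qed.

Lemma blin_mx V m n (L : 'I_m -> 'I_n -> V -> R) : (forall i j, blin (L i j)) ->
  blin (fun h => \matrix_(i, j) L i j h : 'M[R]_(m, n)).
Proof.
move=> bL; split=> [a x y|].
  by apply/matrixP => i j; rewrite !mxE (bL i j).1.
have hC i j : exists C : R, 0 < C /\ forall h, `|L i j h| <= C * `|h|.
  by have [C C0 hC] := (bL i j).2; exists C.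
pose C i j := sval (cid (hC i j)).
have C0 i j : 0 < C i j by rewrite /C; case: cid => ? [].
have CP i j h : `|L i j h| <= C i j * `|h| by rewrite /C; case: cid => ? [].
exists (1 + \sum_i \sum_j C i j) => [|h].
  by rewrite ltr_wpDr// sumr_ge0// => i _; rewrite sumr_ge0// => j _; exact: ltW.
have S0 i j : C i j <= 1 + \sum_i \sum_j C i j.
  rewrite (bigD1 i)//= (bigD1 j)//= addrCA -addrA lerDl !addr_ge0 ?ler01 ?sumr_ge0//.
    by move=> *; exact: ltW.
  by move=> *; rewrite sumr_ge0// => *; exact: ltW.
have ge0 : 0 <= 1 + \sum_i \sum_j C i j.
  by rewrite addr_ge0// sumr_ge0// => *; rewrite sumr_ge0// => *; exact: ltW.
apply/mx_normP => [|i j]; first by rewrite mulr_ge0.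
by rewrite !mxE (le_trans (CP i j h))// ler_wpM2r.
Qed.

Lemma blin_mulr (a : R) : blin (fun h : R => h * a).
Proof. exact: (@blin_scalel R a). Qed.

Lemma blin_mulmx m n (D : 'M[R]_(m, n)) : blin (fun h : 'rV[R]_m => h *m D).
Proof.
have -> : (fun h : 'rV[R]_m => h *m D) =
    (fun h => \matrix_(i, j) \sum_k h 0 k * D k j).
  by apply/funext => h; apply/matrixP => i j; rewrite !mxE ord1.
apply: blin_mx => i j; apply: blin_sum => k.
exact: (blin_comp (blin_coord k) (blin_mulr (D k j))).
Qed.

Lemma blin_rV m n (L : 'rV[R]_m -> 'rV[R]_n) : blin L ->
  exists D : 'M[R]_(m, n), forall h, L h = h *m D.
Proof.
move=> bL; exists (\matrix_k L (delta_mx 0 k)) => h.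
rewrite mulmx_sum_row {1}[h]row_sum_delta.
transitivity (\sum_j h 0 j *: L (delta_mx 0 j)).
  elim/big_rec2: _ => [|i x y _ <-]; first exact: blin0.
  by rewrite bL.1.
by apply: eq_bigr => j _; rewrite rowK.
Qed.

End BoundedLinear.

(* Strict differentiability at a point: the notion suited to the inverse
   function theorem and to the dependence of solutions of differential
   equations on initial conditions. *)
Section StrictDifferentiability.
Context {R : realType}.
Implicit Types V W X : normedModType R.

Definition sdiff V W (f : V -> W) (x : V) (L : V -> W) : Prop :=
  blin L /\ forall e : R, 0 < e -> exists2 r : R, 0 < r &
    forall y z, `|y - x| < r -> `|z - x| < r ->
      `|f y - f z - L (y - z)| <= e * `|y - z|.

Lemma sdiff_ext V W (f : V -> W) x L L' : sdiff f x L -> L =1 L' -> sdiff f x L'.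
Proof. by move=> h /funext <-. Qed.

Lemma sdiff_near V W (f g : V -> W) x L : sdiff f x L ->
  (\forall y \near x, f y = g y) -> sdiff g x L.
Proof.
move=> [bL h] /near_normP[s s0 hs]; split=> // e /h[r r0 hr].
exists (Num.min r s) => [|y z]; first by rewrite lt_min r0.
rewrite !lt_min => /andP[yr ys] /andP[zr zs].
by rewrite -!hs ?hr.
Qed.

Lemma sdiff_lipschitz V W (f : V -> W) x L : sdiff f x L ->
  exists2 C : R, 0 < C & exists2 r : R, 0 < r & forall y z, `|y - x| < r -> `|z - x| < r ->
    `|f y - f z| <= C * `|y - z|.
Proof.
move=> [[lL [C C0 hC]] /(_ _ ltr01)[r r0 hr]]; exists (1 + C); first exact: addr_gt0.
exists r => // y z /hr /[apply] h.
rewrite -(subrK (L (y - z)) (f y - f z)) (le_trans (ler_normD _ _))//.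
by rewrite mulrDl lerD.
Qed.

Lemma sdiff_cont V W (f : V -> W) x L : sdiff f x L ->
  forall e : R, 0 < e -> exists2 r : R, 0 < r &
    forall y, `|y - x| < r -> `|f y - f x| < e.
Proof.
move=> /sdiff_lipschitz[C C0 [r r0 hr]] e e0.
exists (Num.min r (e / C)) => [|y]; first by rewrite lt_min r0 divr_gt0.
rewrite lt_min => /andP[yr ye]; have := hr y x yr; rewrite subrr normr0.
by move=> /(_ r0) /le_lt_trans; apply; rewrite mulrC -ltr_pdivlMr.
Qed.

Lemma sdiff_continuous V W (f : V -> W) x L : sdiff f x L -> {for x, continuous f}.
Proof.
move=> h; apply/cvgrPdist_lt => e /(sdiff_cont h)[r r0 hr].
by apply/near_normP; exists r => // y /hr; rewrite distrC.
Qed.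

Lemma sdiff_lin V W (L : V -> W) x : blin L -> sdiff L x L.
Proof.
move=> bL; split=> // e e0; exists 1 => // y z _ _.
by rewrite (blinB bL) subrr normr0 mulr_ge0// ltW.
Qed.

Lemma sdiff_cst V W (c : W) (x : V) : sdiff (fun=> c) x (fun=> 0).
Proof.
split=> [|e e0]; first exact: blin_cst0.
by exists 1 => // y z _ _; rewrite !subrr normr0 mulr_ge0// ltW.
Qed.

Lemma sdiff_id V (x : V) : sdiff id x id.
Proof. by apply: sdiff_lin; exact: blin_id. Qed.

Lemma sdiffD V W (f g : V -> W) x L K : sdiff f x L -> sdiff g x K ->
  sdiff (fun y => f y + g y) x (fun h => L h + K h).
Proof.
move=> [bL hf] [bK hg]; split=> [|e e0]; first exact: blin_add.
have e20 : 0 < e / 2 by rewrite divr_gt0.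
have [r r0 hr] := hf _ e20; have [s s0 hs] := hg _ e20.
exists (Num.min r s) => [|y z]; first by rewrite lt_min r0.
rewrite !lt_min => /andP[yr ys] /andP[zr zs].
have -> : f y + g y - (f z + g z) - (L (y - z) + K (y - z)) =
    (f y - f z - L (y - z)) + (g y - g z - K (y - z)) by lmod_eq R.
rewrite (le_trans (ler_normD _ _))// [e]splitr mulrDl lerD ?hr ?hs//.
Qed.

Lemma sdiff_comp V W X (f : V -> W) (g : W -> X) x L K :
  sdiff f x L -> sdiff g (f x) K ->
  sdiff (fun y => g (f y)) x (fun h => K (L h)).
Proof.
move=> df [bK hg]; split=> [|e e0]; first exact: blin_comp df.1 bK.
have [C C0 [r r0 hr]] := sdiff_lipschitz df.
have [lK [D D0 hD]] := bK.
have e1 : 0 < e / 2 / C by rewrite !divr_gt0.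
have e2 : 0 < e / 2 / D by rewrite !divr_gt0.
have [s s0 hs] := hg _ e1; have [q q0 hq] := sdiff_cont df s0.
have [p p0 hp] := df.2 _ e2.
exists (Num.min (Num.min r q) p) => [|y z]; first by rewrite !lt_min r0 q0.
rewrite !lt_min => /andP[/andP[yr yq] yp] /andP[/andP[zr zq] zp].
rewrite -(subrKA (K (f y - f z))) -(blinB bK) (le_trans (ler_normD _ _))//.
rewrite [e]splitr mulrDl lerD//.
  rewrite (le_trans (hs _ _ (hq _ yq) (hq _ zq)))//.
  apply: (le_trans (y := e / 2 / C * (C * `|y - z|))).
    by rewrite ler_wpM2l ?hr// ltW.
  by rewrite mulrA mulfVK// lt0r_neq0.
rewrite (le_trans (hD _))//.
apply: (le_trans (y := D * (e / 2 / D * `|y - z|))).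
  by rewrite ler_wpM2l ?hp// ltW.
by rewrite mulrA (mulrC D) mulfVK// lt0r_neq0.
Qed.

Lemma sdiff_pair V W X (f : V -> W) (g : V -> X) x L K :
  sdiff f x L -> sdiff g x K ->
  sdiff (fun y => (f y, g y)) x (fun h => (L h, K h)).
Proof.
move=> [bL hf] [bK hg]; split=> [|e e0]; first exact: blin_pair.
have [r r0 hr] := hf _ e0; have [s s0 hs] := hg _ e0.
exists (Num.min r s) => [|y z]; first by rewrite lt_min r0.
rewrite !lt_min => /andP[yr ys] /andP[zr zs].
by rewrite prod_normE /= ge_max hr ?hs.
Qed.

Lemma sdiff_fst V W (z : V * W) : sdiff (fun z => z.1) z (fun h => h.1).
Proof. by apply: sdiff_lin; exact: blin_fst. Qed.

Lemma sdiff_snd V W (z : V * W) : sdiff (fun z => z.2) z (fun h => h.2).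
Proof. by apply: sdiff_lin; exact: blin_snd. Qed.

Lemma scale_diff V (a b c : R) (x y z : V) :
  a *: x - b *: y - (c *: (x - y) + (a - b) *: z) =
  (a - c) *: (x - y) + (a - b) *: (y - z).
Proof. by lmod_eq R. Qed.

Lemma sdiff_scale_pair V (z : R * V) :
  sdiff (fun z : R * V => z.1 *: z.2) z (fun h => z.1 *: h.2 + h.1 *: z.2).
Proof.
split=> [|e e0].
  apply: blin_add.
    exact: (blin_comp (@blin_snd _ R V) (@blin_scale _ V z.1)).
  exact: (blin_comp (@blin_fst _ R V) (@blin_scalel _ V z.2)).
exists (e / 2); first by rewrite divr_gt0.
move=> u v ur vr.
have nP (w : R * V) : `|w.1| <= `|w| /\ `|w.2| <= `|w|.
  by rewrite [`|w|]prod_normE !le_max !lexx orbT.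
have -> : u.1 *: u.2 - v.1 *: v.2 - (z.1 *: (u - v).2 + (u - v).1 *: z.2) =
    (u - z).1 *: (u - v).2 + (u - v).1 *: (v - z).2.
  exact: scale_diff.
rewrite (le_trans (ler_normD _ _))// [e]splitr mulrDl lerD// normrZ.
  by rewrite ler_pM// ?(nP (u - v)).2// (le_trans (nP _).1)// ltW.
by rewrite mulrC ler_pM// ?(nP (u - v)).1// (le_trans (nP _).2)// ltW.
Qed.

Lemma sdiff_scale V W (a : V -> R) (f : V -> W) x A L :
  sdiff a x A -> sdiff f x L ->
  sdiff (fun y => a y *: f y) x (fun h => a x *: L h + A h *: f x).
Proof.
move=> da df; exact: (sdiff_comp (sdiff_pair da df) (sdiff_scale_pair (a x, f x))).
Qed.

Lemma sdiffM V (f g : V -> R) x L K : sdiff f x L -> sdiff g x K ->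
  sdiff (fun y => f y * g y) x (fun h => f x * K h + L h * g x).
Proof. exact: sdiff_scale. Qed.

Lemma sdiffN V W (f : V -> W) x L : sdiff f x L ->
  sdiff (fun y => - f y) x (fun h => - L h).
Proof. by move=> df; exact: (sdiff_comp df (sdiff_lin _ (blin_opp W))). Qed.

Lemma sdiffB V W (f g : V -> W) x L K : sdiff f x L -> sdiff g x K ->
  sdiff (fun y => f y - g y) x (fun h => L h - K h).
Proof. by move=> df /sdiffN dg; exact: sdiffD. Qed.

Lemma sdiff_sum V W (I : Type) (r : seq I) (f L : I -> V -> W) x :
  (forall i, sdiff (f i) x (L i)) ->
  sdiff (fun y => \sum_(i <- r) f i y) x (fun h => \sum_(i <- r) L i h).
Proof.
move=> df; elim: r => [|i r ih].
  by under eq_fun do rewrite big_nil;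
     under [X in sdiff _ _ X]eq_fun do rewrite big_nil; exact: sdiff_cst.
by under eq_fun do rewrite big_cons;
   under [X in sdiff _ _ X]eq_fun do rewrite big_cons; exact: sdiffD.
Qed.

Lemma sdiff_mx V m n (f L : 'I_m -> 'I_n -> V -> R) x :
  (forall i j, sdiff (f i j) x (L i j)) ->
  sdiff (fun y => \matrix_(i, j) f i j y : 'M[R]_(m, n)) x
    (fun h => \matrix_(i, j) L i j h).
Proof.
move=> df; split=> [|e e0]; first by apply: blin_mx => i j; exact: (df i j).1.
have : \forall r \near 0^'+, forall (ij : 'I_m * 'I_n) y z,
    `|y - x| < r -> `|z - x| < r ->
    `|f ij.1 ij.2 y - f ij.1 ij.2 z - L ij.1 ij.2 (y - z)| <= e * `|y - z|.
  apply: filter_forall => -[i j]; have [r r0 hr] := (df i j).2 _ e0.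
  near=> s => y z ys zs.
  have sr : s < r by near: s; exact: nbhs_right_lt.
  by apply: hr; exact: lt_trans sr.
move=> H; have [r [r0 hr]] := filter_ex (filterI (nbhs_right_gt 0) H).
exists r => // y z yr zr.
apply/mx_normP => [|i j]; first by rewrite mulr_ge0// ltW.
rewrite !mxE; exact: (hr (i, j)).
Unshelve. all: by end_near. Qed.

Lemma sdiff_inv (a : R) : a != 0 ->
  sdiff (fun z : R => z^-1) a (fun h => - (a ^- 2) * h).
Proof.
move=> a0; split=> [|e e0]; first exact: (@blin_scale _ R (- a ^- 2)).
have na : 0 < `|a| by rewrite normr_gt0.
have a3 : 0 < `|a| ^+ 3 by rewrite exprn_gt0.
(* The first bound gives |y|, |z| >= |a| / 2 and |y| <= 2 |a|. With the second, the factor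
   [a * (y - a) + y * (z - a)] of the remainder is at most 3 |a| e |a|^3 / 12 = e |a|^4 / 4, and
   |a|^4 / 4 bounds the denominator from below. *)
exists (Num.min (`|a| / 2) (e * `|a| ^+ 3 / 12)).
  by rewrite lt_min !divr_gt0// mulr_gt0.
move=> y z; rewrite !lt_min => /andP[ya ye] /andP[za ze].
have big u : `|u - a| < `|a| / 2 -> `|a| / 2 <= `|u|.
  move=> ua; have := ler_distD 0 a u; rewrite subr0 sub0r normrN distrC.
  have := ler_normB (u - a) u; rewrite addrAC subrr sub0r normrN.
  by lra.
have yb := big _ ya; have zb := big _ za.
have y0 : y != 0 by rewrite -normr_gt0 (lt_le_trans _ yb)// divr_gt0.
have z0 : z != 0 by rewrite -normr_gt0 (lt_le_trans _ zb)// divr_gt0.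
have -> : y^-1 - z^-1 - - a ^- 2 * (y - z) =
    (y - z) * (a * (y - a) + y * (z - a)) / (y * z * a ^+ 2).
  by field; rewrite a0 y0 z0.
rewrite normrM normrM -mulrA mulrC ler_wpM2r// normfV.
have P0 : 0 < `|y * z * a ^+ 2|.
  by rewrite normr_gt0 !mulf_neq0// expf_neq0.
rewrite ler_pdivrMr// (le_trans (ler_normD _ _))//.
rewrite (normrM a) (normrM y (z - a)) (normrM (y * z)) (normrM y z) normrX.
have yle : `|y| <= 2 * `|a|.
  have := ler_normD (y - a) a; rewrite subrK; lra.
apply: (@le_trans _ _ (3 * `|a| * (e * `|a| ^+ 3 / 12))).
  apply: (@le_trans _ _ (`|a| * (e * `|a| ^+ 3 / 12) +
      2 * `|a| * (e * `|a| ^+ 3 / 12))); last by lra.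
  by rewrite lerD// ler_pM// ltW.
apply: (@le_trans _ _ (e * (`|a| / 2 * (`|a| / 2) * `|a| ^+ 2))).
  by rewrite le_eqVlt; apply/orP; left; apply/eqP; field.
by rewrite ler_wpM2l ?(ltW e0)// ler_wpM2r// ler_pM// divr_ge0.
Qed.

Lemma sdiffV V (f : V -> R) x L : sdiff f x L -> f x != 0 ->
  exists K, sdiff (fun y => (f y)^-1) x K.
Proof.
move=> df fx0; exists (fun h => - (f x ^- 2) * L h).
exact: (sdiff_comp df (sdiff_inv fx0)).
Qed.

(** Strict differentiability at [x] lets both points of an increment vary, so [K] and [L]
    approximate the same increment [f (y + t *: h) - f y] for small [t]. A strict derivative is
    therefore continuous where neighbouring ones exist. *)
Lemma sdiff_deriv_cont V W (f : V -> W) x (L : V -> W) : sdiff f x L ->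
  forall e : R, 0 < e -> exists2 r : R, 0 < r &
    forall y K, `|y - x| < r -> sdiff f y K ->
      forall h, `|K h - L h| <= e * `|h|.
Proof.
move=> [bL df] e e0; have e20 : 0 < e / 2 by rewrite divr_gt0.
have [r r0 hr] := df _ e20; exists r => // y K yr [bK dK] h.
have [->|h0] := eqVneq h 0.
  by rewrite (blin0 bL) (blin0 bK) subrr !normr0 mulr0.
have nh : 0 < `|h| by rewrite normr_gt0.
have [s s0 hs] := dK _ e20.
pose t := Num.min ((r - `|y - x|) / 2) (s / 2) / `|h|.
have t0 : 0 < t by rewrite divr_gt0// lt_min !divr_gt0// subr_gt0.
have th : `|t *: h| = Num.min ((r - `|y - x|) / 2) (s / 2).
  rewrite normrZ gtr0_norm// mulfVK// gt_eqF//.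
have th1 : `|t *: h| < r - `|y - x|.
  by rewrite th gt_min gtr_pMr ?subr_gt0// invf_lt1// ltr1n.
have th2 : `|t *: h| < s.
  by rewrite th gt_min orbC gtr_pMr// invf_lt1// ltr1n.
have E : y + t *: h - y = t *: h by rewrite addrAC subrr add0r.
have h1 : `|f (y + t *: h) - f y - L (t *: h)| <= e / 2 * `|t *: h|.
  have := hr (y + t *: h) y; rewrite E; apply => //.
  by rewrite addrAC (le_lt_trans (ler_normD _ _))// -ltrBrDl.
have h2 : `|f (y + t *: h) - f y - K (t *: h)| <= e / 2 * `|t *: h|.
  by have := hs (y + t *: h) y; rewrite E; apply => //; rewrite subrr normr0.
have : `|t *: (K h - L h)| <= e * `|t *: h|.
  rewrite scalerBr -(blinZ bK) -(blinZ bL).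
  have -> : K (t *: h) - L (t *: h) = (f (y + t *: h) - f y - L (t *: h)) -
      (f (y + t *: h) - f y - K (t *: h)) by lmod_eq R.
  by rewrite (le_trans (ler_normB _ _))// [e]splitr mulrDl lerD.
by rewrite (normrZ t (_ - _)) (normrZ t h) mulrCA ler_pM2l// gtr0_norm.
Qed.

End StrictDifferentiability.

HB.instance Definition _ (R : realType) n :=
  Uniform_isComplete.Build 'rV[R]_n cauchy_cvg.

Section StrictDerivatives.
Context {R : realType}.
Implicit Types V W : normedModType R.

Lemma ord_radius n (P : 'I_n -> R -> Prop) :
  (forall k, exists2 r : R, 0 < r & P k r) ->
  (forall k (r s : R), 0 < s <= r -> P k r -> P k s) ->
  exists2 r : R, 0 < r & forall k, P k r.
Proof.
move=> exP mono; have : \forall r \near (0 : R)^'+, forall k, P k r.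
  apply: filter_forall => k; have [s s0 Ps] := exP k.
  near=> r; apply: mono Ps; apply/andP; split=> //.
  by near: r; exact: nbhs_right_le.
by move=> H; have [r [r0 hr]] := filter_ex (filterI (nbhs_right_gt 0) H); exists r.
Unshelve. all: by end_near. Qed.

Lemma closed_norm_le V (x : V) (r : R) : 0 < r -> closed [set z | `|z - x| <= r].
Proof.
move=> r0; rewrite (_ : mkset _ = closed_ball x r); first exact: closed_ball_closed.
by rewrite closed_ballE//; apply/seteqP; split=> z; rewrite /closed_ball_/= distrC.
Qed.

Lemma sdiff_is_derive V W (f : V -> W) x L h : sdiff f x L -> is_derive x h f (L h).
Proof.
move=> [bL df].
have c : (k^-1 *: (f (k *: h + x) - f x)) @[k --> 0^'] --> L h.
  apply/cvgrPdist_le => e e0.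
  have d0 : 0 < e / (`|h| + 1) by rewrite divr_gt0// ltr_wpDl.
  have [r r0 hr] := df _ d0.
  exists (r / (`|h| + 1)); first by rewrite /= divr_gt0// ltr_wpDl.
  move=> k; rewrite /= sub0r normrN => kr k0.
  have nk : 0 < `|k| by rewrite normr_gt0.
  have kh : `|k *: h| < r.
    rewrite normrZ (le_lt_trans (y := `|k| * (`|h| + 1)))//.
      by rewrite ler_pM2l// lerDl.
    by rewrite -ltr_pdivlMr// ltr_wpDl.
  have := hr (k *: h + x) x; rewrite addrK subrr normr0 => /(_ kh r0) H.
  rewrite -(ler_pM2l nk) -normrZ scalerBr scalerA mulfV// scale1r distrC.
  rewrite -(blinZ bL) (le_trans H)// normrZ mulrCA ler_pM2l//.
  by rewrite mulrAC ler_pdivrMr ?ltr_wpDl// ler_pM2l// lerDl.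
by apply: DeriveDef; [apply/cvg_ex; exists (L h)|exact/cvg_lim].
Qed.

Lemma sdiff_unique V W (f : V -> W) x L K : sdiff f x L -> sdiff f x K -> L =1 K.
Proof.
by move=> h1 h2 h; have [_ <-] := sdiff_is_derive h h1; have [_ <-] := sdiff_is_derive h h2.
Qed.

Lemma sdiff_differentiable V W (f : V -> W) x L : sdiff f x L -> differentiable f x.
Proof.
move=> [bL df].
pose L' : {linear V -> W} :=
  HB.pack L (GRing.isLinear.Build R V W *:%R L bL.1).
have cL : continuous L'.
  by move=> y; exact: (sdiff_continuous (sdiff_lin y bL)).
have H : f \o shift x = cst (f x) + L' +o_ 0 id.
  apply/eqaddoP => e e0; have [r r0 hr] := df _ e0.
  apply/near_normP; exists r => // y; rewrite subr0 => yr.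
  have := hr (y + x) x; rewrite addrK subrr normr0 => /(_ yr r0).
  by rewrite -[in leLHS]addrA -opprD.
by apply/diff_locallyP; rewrite (diff_unique cL H).
Qed.

Lemma sdiff_jacobian m n (f : 'rV[R]_m -> 'rV[R]_n) x L : sdiff f x L ->
  forall h, L h = h *m 'J f x.
Proof.
move=> df h; rewrite -deriveEjacobian; last exact: sdiff_differentiable df.
by have [_ <-] := sdiff_is_derive h df.
Qed.

Lemma mean_value_inequality_sym W (f f' : R -> W) (a b K : R) :
  (forall t : R, a <= t <= b \/ b <= t <= a -> is_derive t 1 f (f' t)) ->
  (forall t : R, a <= t <= b \/ b <= t <= a -> `|f' t| <= K) ->
  `|f b - f a| <= K * `|b - a|.
Proof.
move=> df bf; have [ab|ba] := leP a b.
  rewrite (ger0_norm (x := b - a)) ?subr_ge0//.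
  by apply: mean_value_inequality ab _ _ => t tab; [apply: df|apply: bf]; left.
rewrite distrC (distrC b) (ger0_norm (x := a - b)) ?subr_ge0 ?(ltW ba)//.
by apply: mean_value_inequality (ltW ba) _ _ => t tab; [apply: df|apply: bf]; right.
Qed.

Lemma is_derive_line V W (f : V -> W) p v (s : R) : derivable f (p + s *: v) v ->
  is_derive s 1 (fun t : R => f (p + t *: v)) ('D_v f (p + s *: v)).
Proof.
move=> df; have E : (fun h : R => h^-1 *: (f (p + (h *: 1 + s) *: v) - f (p + s *: v)))
    = (fun h => h^-1 *: (f (h *: v + (p + s *: v)) - f (p + s *: v))).
  apply/funext => h; congr (_ *: (f _ - _)).
  by rewrite [h *: 1]mulr1 scalerDl addrCA.
by apply: DeriveDef; rewrite /derivable ?/derive E.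
Qed.

(** The coordinates of [z] are replaced by those of [y] one at a time; each replacement is a
    one-variable mean value estimate for [f] minus a linear function of slope [partial j f x]. *)
Lemma class_C1_sdiff n (U : set 'rV[R]_n) (f : 'rV[R]_n -> R) x :
  open U -> U x -> class_C 1 U f ->
  sdiff f x (fun h => \sum_k h 0 k * partial k f x).
Proof.
move=> oU Ux [dU cU]; split=> [|e e0].
  apply: blin_sum => k.
  exact: (blin_comp (blin_coord k) (blin_mulr (partial k f x))).
(* The successor of [n] keeps the constant meaningful in dimension 0. *)
have e1 : 0 < e / n.+1%:R by rewrite divr_gt0.
have H (k : 'I_n) : \forall y \near x, `|partial k f y - partial k f x| <= e / n.+1%:R.
  have := cU k x Ux; move/cvgrPdist_le => /(_ _ e1).
  by apply: filterS => y; rewrite distrC.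
have [d d0 hd] := @ord_radius _ (fun k d => forall y, `|y - x| < d ->
  `|partial k f y - partial k f x| <= e / n.+1%:R)
  (fun k => (near_normP _ _).1 (H k))
  (fun k d d' dd hd y yd => hd y (lt_le_trans yd (andP dd).2)).
have nU : \forall y \near x, U y by exact: open_nbhs_nbhs.
have [d' d'0 hd'] := (near_normP _ _).1 nU.
pose r := Num.min d d'.
have hr y : `|y - x| < r ->
    U y /\ forall k, `|partial k f y - partial k f x| <= e / n.+1%:R.
  by rewrite lt_min => /andP[yd yd']; split=> [|k]; [exact: hd'|exact: hd].
exists r => [|y z yr zr]; first by rewrite lt_min d0.
pose p (j : nat) : 'rV[R]_n := \row_i (if (i < j)%N then y 0 i else z 0 i).
have p0 : p 0%N = z by apply/rowP => i; rewrite mxE.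
have pn : p n = y by apply/rowP => i; rewrite mxE ltn_ord.
have pS (j : 'I_n) : p j.+1 = p j + (y 0 j - z 0 j) *: delta_mx 0 j.
  apply/rowP => i; rewrite !mxE eqxx/= ltnS leq_eqVlt; have [->|ij] := eqVneq i j.
    by rewrite eqxx ltnn /= mulr1 subrKC.
  by rewrite (negPf (_ : val i != val j)) /= ?mulr0 ?addr0.
have -> : f y - f z = \sum_(j < n) (f (p j.+1) - f (p j)).
  rewrite -{1}p0 -{1}pn.
  by rewrite -(telescope_sumr (fun j => f (p j)) (leq0n n)) big_mkord.
rewrite -sumrB (le_trans (ler_norm_sum _ _ _))//.
apply: (@le_trans _ _ (\sum_(j < n) (e / n.+1%:R * `|y - z|))); last first.
  rewrite sumr_const card_ord -[_ *+ n]mulr_natr; set c := e / _ in e1 *.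
  have cn : c * n%:R <= e.
    by rewrite mulrAC ler_pdivrMr// ler_wpM2l ?(ltW e0)// ler_nat.
  by rewrite -mulrA (mulrC `|y - z|) mulrA ler_wpM2r.
apply: ler_sum => j _.
pose c := partial j f x.
pose g (s : R) := f (p j + s *: delta_mx 0 j) - s * c.
have -> : f (p j.+1) - f (p j) - (y - z) 0 j * partial j f x =
    g (y 0 j - z 0 j) - g 0.
  by rewrite /g -pS scale0r addr0 mul0r subr0 !mxE /c addrAC.
(* For the maximum norm, a point whose coordinates lie between those of [y] and [z] is no farther
   from [x] than the farther of the two. *)
have inball (s : R) : 0 <= s <= y 0 j - z 0 j \/ y 0 j - z 0 j <= s <= 0 ->
    `|p j + s *: delta_mx 0 j - x| < r.
  move=> hs; apply: (@le_lt_trans _ _ (Num.max `|y - x| `|z - x|)); last first.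
    by rewrite gt_max yr.
  apply/mx_normP => [|i0 i]; first by rewrite le_max normr_ge0.
  rewrite ord1 !mxE eqxx /=.
  have Y k := mx_norm_coord (y - x) 0 k; have Z k := mx_norm_coord (z - x) 0 k.
  have [->|ij] := eqVneq i j.
    rewrite ltnn /= mulr1; have := Y j; have := Z j; rewrite !mxE.
    have : `|z 0 j + s - x 0 j| <= Num.max `|y 0 j - x 0 j| `|z 0 j - x 0 j|.
      rewrite le_max; apply/orP; rewrite !ler_norml.
      have := ler_norm (y 0 j - x 0 j); have := ler_norm (z 0 j - x 0 j).
      have := ler_norm (- (y 0 j - x 0 j)); have := ler_norm (- (z 0 j - x 0 j)).
      rewrite !normrN; case: (leP 0 (z 0 j + s - x 0 j)) => h0.
        by case: hs => /andP[h1 h2]; [left|right]; lra.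
      by case: hs => /andP[h1 h2]; [right|left]; lra.
    rewrite le_max => /orP[] h1 h2 h3; rewrite le_max; apply/orP;
      [left|right]; exact: le_trans h1 _.
  rewrite mulr0 addr0; have := Y i; have := Z i; rewrite !mxE.
  by case: ifP => _ h1 h2; rewrite le_max ?h2 ?h1 ?orbT.
have := @mean_value_inequality_sym R g
  (fun s => partial j f (p j + s *: delta_mx 0 j) - c) 0 (y 0 j - z 0 j)
  (e / n.+1%:R).
rewrite subr0 => MV; apply: le_trans (MV _ _) _.
- move=> s hs; apply: is_deriveB.
    by apply: is_derive_line; apply: dU; exact: (hr _ (inball _ hs)).1.
  exact: (@is_derive_scalel R R c s).
- by move=> s hs; exact: (hr _ (inball _ hs)).2.
- rewrite ler_wpM2l ?(ltW e1)//; have := mx_norm_coord (y - z) 0 j.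
  by rewrite !mxE.
Qed.

(* Surjectivity onto balls comes from the Banach fixed point theorem. *)
Lemma sdiff_inverse n (f : 'rV[R]_n -> 'rV[R]_n) x (D : 'M[R]_n) :
  D \in unitmx -> sdiff f x (fun h => h *m D) ->
  exists2 c : R, 0 < c & exists2 r : R, 0 < r &
    (forall y z, `|y - x| < r -> `|z - x| < r -> c * `|y - z| <= `|f y - f z|) /\
    (forall s, 0 < s < r -> forall w, `|w - f x| < c * s ->
      exists2 z, `|z - x| <= s & f z = w).
Proof.
move=> uD df; pose G := invmx D; pose g z := f z *m G.
have dg : sdiff g x id.
  apply: (sdiff_ext (sdiff_comp df (sdiff_lin _ (blin_mulmx G)))) => h.
  by rewrite mulmxK.
have [lG [C C0 hC]] := blin_mulmx G.
have h12 : 0 < 2^-1 :> R by rewrite invr_gt0.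
have [r r0 hr] := dg.2 _ h12.
have fG y : f y = g y *m D by rewrite mulmxKV.
exists (2^-1 / C); first by rewrite divr_gt0.
exists r => //; split=> [y z yr zr|s /andP[s0 sr] w ws].
  have h1 := hr y z yr zr; have := hC (f y - f z); rewrite mulmxBl => h2.
  rewrite mulrAC ler_pdivrMr// mulrC.
  have := lerB_dist (y - z) (g y - g z); rewrite (distrC (y - z)).
  move=> h3; have : `|g y - g z| <= C * `|f y - f z| by [].
  by rewrite [C * _]mulrC; lra.
pose B := [set z : 'rV[R]_n | `|z - x| <= s].
(* The fixed points of [T] are the solutions of [g z = w *m G]. The strict derivative of [g] at [x]
   is the identity, so [T] contracts by 1/2 near [x]. *)
pose T z := z - g z + w *m G.
have wG : `|w *m G - g x| <= s / 2.
  rewrite -mulmxBl (le_trans (hC _))//.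
  have : C * `|w - f x| < C * (2^-1 / C * s) by rewrite ltr_pM2l.
  have -> : C * (2^-1 / C * s) = s / 2 by field; rewrite gt_eqF.
  exact: ltW.
have BT : {homo T : z / B z >-> B z}.
  move=> z zs; rewrite /B /= /T.
  have -> : z - g z + w *m G - x = - (g z - g x - (z - x)) + (w *m G - g x) by lmod_eq R.
  rewrite (le_trans (ler_normD _ _))// normrN.
  have := hr z x; rewrite subrr normr0 => /(_ (le_lt_trans zs sr) r0) /= h.
  have zs' : `|z - x| <= s := zs.
  by lra.
have ctr : is_contraction (mkfun_fun BT).
  exists 2^-1%:nng; split; first by rewrite /= invf_lt1// ltr1n.
  move=> [y z] [/= By Bz]; rewrite /mkfun /T.
  have -> : y - g y + w *m G - (z - g z + w *m G) = - (g y - g z - (y - z)) by lmod_eq R.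
  by rewrite normrN; apply: hr; [exact: le_lt_trans By sr|exact: le_lt_trans Bz sr].
have cB : closed B by exact: closed_norm_le.
have B0 : B !=set0 by exists x; rewrite /B /= subrr normr0 ltW.
have [z Bz zT] := banach_fixed_point ctr cB B0.
exists z => //; rewrite fG; have -> : g z = w *m G.
  have : z = z - g z + w *m G := zT.
  move=> E; have -> : w *m G = (z - g z + w *m G) - z + g z by lmod_eq R.
  by rewrite -E; lmod_eq R.
by rewrite mulmxKV.
Qed.

End StrictDerivatives.

(** * Dependence of solutions of differential equations on initial values *)

Section UniformSegment.
Context {R : realType}.

(** Compactness of the segment, for a property that survives decreasing [d]: real induction takes
    the minimum of two radii at each extension. *)
Lemma uniform_segment (a b : R) (Q : R -> R -> Prop) :
  (forall d e r, e <= d -> Q d r -> Q e r) ->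
  (forall r, a <= r <= b -> exists2 e : R, 0 < e & exists2 d : R, 0 < d &
     forall u, `|u - r| < e -> Q d u) ->
  exists2 d : R, 0 < d & forall r, a <= r <= b -> Q d r.
Proof.
move=> mono loc.
have [ba|ab] := ltP b a.
  by exists 1 => // r /andP[ar rb]; move: (le_trans ar rb); rewrite leNgt ba.
suff H x : a <= x <= b -> exists2 d : R, 0 < d & forall r, a <= r <= x -> Q d r.
  by apply: H; rewrite ab lexx.
move: x; apply: (@real_induction _ a b
  (fun x => exists2 d : R, 0 < d & forall r, a <= r <= x -> Q d r)).
- have [|e e0 [d d0 hd]] := loc a; first by rewrite lexx.
  exists d => // r /andP[ar ra]; apply: hd.
  by rewrite (@le_anti _ _ r a) ?ar ?ra// subrr normr0.
- move=> x /andP[ax xb] /(_ x)[|d d0 hd]; first by rewrite ax lexx.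
  have [|e e0 [d' d'0 hd']] := loc x; first by rewrite ax ltW.
  exists e => // y /andP[xy ye] yb; exists (Num.min d d').
    by rewrite lt_min d0.
  move=> r /andP[ar ry]; have [rx|xr] := leP r x.
    by apply: mono (hd r _); rewrite ?ge_min ?lexx// ar.
  apply: mono (hd' r _); first by rewrite ge_min lexx orbT.
  by rewrite ger0_norm ?subr_ge0 ?ltW// ltrBlDl (le_lt_trans ry).
- move=> x /andP[ax xb] H.
  have [|e e0 [d' d'0 hd']] := loc x; first by rewrite ltW.
  pose y := Num.max a (x - e / 2).
  have ay : a <= y by rewrite le_max lexx.
  have yx : y < x by rewrite gt_max ax ltrBlDr ltrDl divr_gt0.
  have [|d d0 hd] := H y; first by rewrite ay.
  exists (Num.min d d'); first by rewrite lt_min d0.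
  move=> r /andP[ar rx]; have [ry|yr] := leP r y.
    by apply: mono (hd r _); rewrite ?ge_min ?lexx// ar.
  apply: mono (hd' r _); first by rewrite ge_min lexx orbT.
  rewrite distrC ger0_norm ?subr_ge0// ltrBlDr -ltrBlDl.
  by apply: le_lt_trans yr; rewrite le_max; apply/orP; right; lra.
Qed.

End UniformSegment.

(* The difference quotients of a family of solutions are uniformly Cauchy, and
   their limits solve the linearized equation. *)
Section Variational.
Context {R : realType} {V W : normedModType R}.
Hypothesis completeW :
  forall F : set_system W, ProperFilter F -> cauchy F -> exists l : W, F --> l.
Variables (F : W -> W) (y : V -> R -> W) (v0 : V) (A : R -> W -> W) (Ls : V -> W)
  (s rho K delta : R).
Hypotheses (K0 : 0 <= K) (Krho : K * rho <= 2^-1) (delta0 : 0 < delta)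
  (rho0 : 0 < rho).
Hypothesis dF : forall r, `|r - s| < rho -> sdiff F (y v0 r) (A r).
Hypothesis AK : forall r h, `|r - s| < rho -> `|A r h| <= K * `|h|.
Hypothesis dy : forall v r, `|v - v0| < delta -> `|r - s| < rho ->
  is_derive r 1 (y v) (F (y v r)).
Hypothesis y_lip : forall v v' r, `|v - v0| < delta -> `|v' - v0| < delta ->
  `|r - s| < rho -> `|y v r - y v' r| <= 2 * `|y v s - y v' s|.
Hypothesis ds : sdiff (y ^~ s) v0 Ls.

Let bA r : `|r - s| < rho -> blin (A r).
Proof. by move=> /dF []. Qed.

Let v00 : `|v0 - v0| < delta. Proof. by rewrite subrr normr0. Qed.

(** Strict differentiability at the single point [y v0 r], together with continuity of the
    derivative, covers all times near [r]; compactness of the time interval then makes [d]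
    uniform. *)
Lemma variational_unif (sig e : R) : sig < rho -> 0 < e ->
  exists2 d : R, 0 < d <= delta & forall r, `|r - s| <= sig ->
    forall v v', `|v - v0| < d -> `|v' - v0| < d ->
    `|F (y v r) - F (y v' r) - A r (y v r - y v' r)| <= e * `|y v r - y v' r|.
Proof.
move=> sr e0; have e2 : 0 < e / 2 by rewrite divr_gt0.
pose Q (d r : R) := forall v v', `|v - v0| < d -> `|v' - v0| < d ->
   `|v - v0| < delta -> `|v' - v0| < delta ->
    `|F (y v r) - F (y v' r) - A r (y v r - y v' r)| <= e * `|y v r - y v' r|.
have [d d0 hd] : exists2 d : R, 0 < d & forall r, s - sig <= r <= s + sig -> Q d r.
  apply: uniform_segment.
    move=> d d' r dd h v v' hv hv'; apply: h; exact: lt_le_trans dd.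
  move=> r; rewrite -ler_distl => rs; have rs' := le_lt_trans rs sr.
  have [q q0 hq] := (dF rs').2 _ e2.
  have [p p0 hp] := sdiff_deriv_cont (dF rs') e2.
  have m0 : 0 < Num.min q p / 2 by rewrite divr_gt0// lt_min q0.
  have [a a0 ha] := is_derive_cont (dy v00 rs') m0.
  have m1 : 0 < Num.min q p / 4 by rewrite divr_gt0// lt_min q0.
  have [d d0 hd] := sdiff_cont ds m1.
  have qr : 0 < rho - `|r - s| by rewrite subr_gt0.
  exists (Num.min a (rho - `|r - s|)); first by rewrite lt_min a0.
  exists d => // u; rewrite lt_min => /andP[ua ur] v v' vd v'd vD v'D.
  have us : `|u - s| < rho.
    by rewrite -(subrKA r) (le_lt_trans (ler_normD _ _))// -ltrBrDr.
  have near_ w : `|w - v0| < d -> `|w - v0| < delta ->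
      `|y w u - y v0 r| < Num.min q p.
    move=> wd wD; rewrite -(subrKA (y v0 u)) (le_lt_trans (ler_normD _ _))//.
    have h1 := y_lip wD v00 us; have h2 := hd _ wd; have h3 := ha _ ua.
    by move: h1 h2 h3; move: (Num.min q p) => m; lra.
  have := near_ v vd vD; have := near_ v' v'd v'D; have := near_ v0.
  rewrite subrr normr0 !lt_min => /(_ d0 delta0)/andP[_ hp0] /andP[hq' _] /andP[hq1 _].
  have h1 := hq _ _ hq1 hq'.
  have h2 := hp _ _ hp0 (dF us) (y v u - y v' u).
  rewrite -(subrKA (A r (y v u - y v' u))) (le_trans (ler_normD _ _))//.
  by rewrite [e]splitr mulrDl lerD// distrC.
exists (Num.min d delta); first by rewrite lt_min d0 delta0 ge_min lexx orbT.
move=> r; rewrite ler_distl => /hd h v v'.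
by rewrite !lt_min => /andP[v1 v2] /andP[v3 v4]; exact: h.
Qed.

Let D h k r := k^-1 *: (y (v0 + k *: h) r - y v0 r).

Let D' h k r := k^-1 *: (F (y (v0 + k *: h) r) - F (y v0 r)).

Let small_dir h (d : R) : 0 < d -> exists2 q : R, 0 < q &
  forall k : R, `|k| < q -> `|v0 + k *: h - v0| < d.
Proof.
move=> d0; have h1 : 0 < `|h| + 1 by rewrite ltr_wpDl.
exists (d / (`|h| + 1)) => [|k]; first by rewrite divr_gt0.
rewrite addrAC subrr add0r normrZ ltr_pdivlMr// => kd.
by rewrite (le_lt_trans _ kd)// ler_wpM2l// lerDl.
Qed.

Let D_deriv h k r : `|v0 + k *: h - v0| < delta -> `|r - s| < rho ->
  is_derive r 1 (D h k) (D' h k r).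
Proof.
by move=> kd rs; apply: is_deriveZ; apply: is_deriveB; apply: dy.
Qed.

Let D_le h k r : `|v0 + k *: h - v0| < delta -> `|r - s| < rho ->
  `|D h k r| <= 2 * `|D h k s|.
Proof.
move=> kd rs; rewrite !normrZ mulrCA ler_wpM2l//; exact: y_lip.
Qed.

Let Ds_cvg h (e : R) : 0 < e -> exists2 q : R, 0 < q &
  forall k, k != 0 -> `|k| < q -> `|D h k s - Ls h| <= e.
Proof.
move=> e0; have h1 : 0 < `|h| + 1 by rewrite ltr_wpDl.
have [|d d0 hd] := ds.2 (e / (`|h| + 1)); first by rewrite divr_gt0.
have [q q0 hq] := small_dir h d0; exists q => // k k0 /hq kd.
have E : v0 + k *: h - v0 = k *: h by rewrite addrAC subrr add0r.
have := hd _ v0 kd; rewrite subrr normr0 => /(_ d0).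
rewrite E (blinZ ds.1) (normrZ k h) => H.
have nk : 0 < `|k| by rewrite normr_gt0.
rewrite -(ler_pM2l nk) -normrZ scalerBr scalerA mulfV// scale1r (le_trans H)//.
rewrite mulrCA ler_pM2l// mulrAC ler_pdivrMr// ler_pM2l//.
by rewrite lerDl.
Qed.

Let D_bounds h (sig e : R) : sig < rho -> 0 < e -> exists2 q : R, 0 < q &
  forall k, k != 0 -> `|k| < q -> `|v0 + k *: h - v0| < delta /\
    forall r, `|r - s| <= sig -> `|D h k r| <= 2 * (`|Ls h| + 1) /\
      `|D' h k r - A r (D h k r)| <= e * (2 * (`|Ls h| + 1)).
Proof.
move=> sr e0; have [d /andP[d0 dd] hd] := variational_unif sr e0.
have [q1 q10 h1] := small_dir h d0; have [q2 q20 h2] := Ds_cvg h ltr01.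
exists (Num.min q1 q2) => [|k k0]; first by rewrite lt_min q10.
rewrite lt_min => /andP[/h1 kd kq2]; have kdelta := lt_le_trans kd dd.
split=> // r rs.
have Db : `|D h k r| <= 2 * (`|Ls h| + 1).
  rewrite (le_trans (D_le kdelta (le_lt_trans rs sr)))// ler_wpM2l//.
  have := h2 _ k0 kq2; have := lerB_dist (D h k s) (Ls h); lra.
split=> //; apply: (@le_trans _ _ (e * `|D h k r|)); last by rewrite ler_wpM2l// ltW.
rewrite /D' /D (blinZ (bA (le_lt_trans rs sr))) -scalerBr !normrZ mulrCA ler_wpM2l//.
by apply: hd => //; rewrite subrr normr0.
Qed.

Let gronwall (f f' : R -> W) (t e : R) : 0 <= e -> `|t - s| < rho ->
  (forall r : R, `|r - s| <= `|t - s| -> is_derive r 1 f (f' r)) ->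
  (forall r : R, `|r - s| <= `|t - s| -> `|f' r| <= K * `|f r| + e) ->
  `|f t| <= 2 * `|f s| + 2 * e * `|t - s|.
Proof.
move=> e0 ts; apply: gronwall_half => //.
by rewrite (le_trans _ Krho)// ler_wpM2l// ltW.
Qed.

Let D_cauchy h (sig e : R) : 0 < sig < rho -> 0 < e -> exists2 q : R, 0 < q &
  forall k k', k != 0 -> `|k| < q -> k' != 0 -> `|k'| < q ->
    forall r, `|r - s| <= sig -> `|D h k r - D h k' r| <= e.
Proof.
move=> /andP[sig0 sr] e0; set C := 2 * (`|Ls h| + 1).
have C0 : 0 < C by rewrite mulr_gt0// ltr_wpDl.
(* [C] bounds the difference quotients. The error term of Gronwall contributes 2 * 2 * (e / (8 *
   sig)) * sig = e / 2, and twice the initial difference, itself at most e / 4, contributes the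
   other half. *)
have eC : 0 < e / (8 * C * sig) by rewrite divr_gt0// !mulr_gt0.
have [q1 q10 h1] := D_bounds h sr eC.
have e8 : 0 < e / 8 by rewrite divr_gt0.
have [q2 q20 h2] := Ds_cvg h e8.
exists (Num.min q1 q2) => [|k k' k0]; first by rewrite lt_min q10.
rewrite !lt_min => /andP[kq1 kq2] k'0 /andP[k'q1 k'q2] r rs.
have [kd B] := h1 _ k0 kq1; have [k'd B'] := h1 _ k'0 k'q1.
have rr := le_lt_trans rs sr.
have H := @gronwall (fun r => D h k r - D h k' r) (fun r => D' h k r - D' h k' r)
  r (2 * (e / (8 * C * sig) * C)) _ rr _ _.
apply: (le_trans (H _ _ _)).
- by rewrite mulr_ge0// mulr_ge0// ltW.
- by move=> u us; apply: is_deriveB; apply: D_deriv => //; exact: le_lt_trans rr.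
- move=> u us; have us' := le_trans us rs; have ur := le_lt_trans us' sr.
  have -> : D' h k u - D' h k' u = A u (D h k u - D h k' u) +
      ((D' h k u - A u (D h k u)) - (D' h k' u - A u (D h k' u))).
    by rewrite (blinB (bA ur)); lmod_eq R.
  rewrite (le_trans (ler_normD _ _))// lerD ?AK// (le_trans (ler_normB _ _))//.
  by rewrite mulrDl mul1r lerD ?(B _ us').2 ?(B' _ us').2.
- have e2 : `|D h k s - D h k' s| <= e / 4.
    have := h2 _ k0 kq2; have := h2 _ k'0 k'q2.
    have -> : D h k s - D h k' s = (D h k s - Ls h) - (D h k' s - Ls h) by lmod_eq R.
    by have := ler_normB (D h k s - Ls h) (D h k' s - Ls h); lra.
  have : 2 * (2 * (e / (8 * C * sig) * C)) * `|r - s| <= e / 2.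
    apply: (@le_trans _ _ (2 * (2 * (e / (8 * C * sig) * C)) * sig)).
      by rewrite ler_wpM2l//; pos.
    by rewrite le_eqVlt; apply/orP; left; apply/eqP; field; rewrite !gt_eqF.
  by lra.
Qed.

Let L t h := lim (D h k t @[k --> 0^']).

Let L_cvg h (sig e : R) : 0 < sig < rho -> 0 < e -> exists2 q : R, 0 < q &
  forall k, k != 0 -> `|k| < q ->
    forall r, `|r - s| <= sig -> `|D h k r - L r h| <= e.
Proof.
move=> hs e0; have [q q0 hq] := D_cauchy h hs e0.
exists q => // k k0 kq r rs.
have cv : cvg (D h u r @[u --> 0^']).
  suff [l cl] : exists l : W, D h u r @[u --> 0^'] --> l by exact: cvgP cl.
  apply: completeW; apply/cauchy_ballP => d d0.
  have [q' q'0 hq'] := D_cauchy h hs (divr_gt0 d0 (ltr0Sn R 1)).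
  have N : \forall u \near (0 : R)^', u != 0 /\ `|u| < q'.
    by exists q' => //= u; rewrite /= sub0r normrN => uq u0.
  exists ([set D h u r | u in [set u | u != 0 /\ `|u| < q']],
          [set D h u r | u in [set u | u != 0 /\ `|u| < q']]).
    by split; rewrite /= nbhs_simpl /=; apply: filterS N => u hu; exists u.
  move=> [_ _] [/= [u [u0 uq] <-] [v [v0' vq] <-]].
  rewrite -ball_normE /=; apply: le_lt_trans (hq' _ _ u0 uq v0' vq r rs) _.
  by rewrite ltr_pdivrMr// ltr_pMr// ltr1n.
apply: (dnbhs0_norm_le q0 cv) => u u0 uq; exact: hq.
Qed.

Let L_s h : L s h = Ls h.
Proof.
apply/eqP; rewrite -subr_eq0 -normr_eq0; apply/eqP/le_anti.
rewrite normr_ge0 andbT; apply/ler_addgt0Pr => e e0; rewrite add0r.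
have e2 : 0 < e / 2 by rewrite divr_gt0.
have [|q1 q10 h1] := @L_cvg h (rho / 2) (e / 2) _ e2.
  by rewrite divr_gt0//= ltr_pdivrMr// ltr_pMr// ltr1n.
have [q2 q20 h2] := Ds_cvg h e2.
pose k := Num.min q1 q2 / 2.
have k0 : 0 < k by rewrite divr_gt0// lt_min q10.
have nk : `|k| < Num.min q1 q2.
  by rewrite gtr0_norm// ltr_pdivrMr// ltr_pMr ?ltr1n// lt_min q10.
move: nk; rewrite lt_min => /andP[kq1 kq2].
have a1 := h1 k (lt0r_neq0 k0) kq1 s; have a2 := h2 k (lt0r_neq0 k0) kq2.
move: a1; rewrite subrr normr0 => /(_ (ltW (divr_gt0 rho0 (ltr0Sn R 1)))) a1.
have -> : L s h - Ls h = (D h k s - Ls h) - (D h k s - L s h) by lmod_eq R.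
by have := ler_normB (D h k s - Ls h) (D h k s - L s h); lra.
Qed.

Let pick_sig t : `|t - s| < rho -> exists2 sig, `|t - s| < sig & 0 < sig < rho.
Proof.
move=> ts; exists ((`|t - s| + rho) / 2); first by lra.
by have := normr_ge0 (t - s); lra.
Qed.

Let exists_k (q : R) : 0 < q -> exists k : R, k != 0 /\ `|k| < q.
Proof.
move=> q0; exists (q / 2); split; first by rewrite gt_eqF// divr_gt0.
by rewrite gtr0_norm ?divr_gt0// ltr_pdivrMr// ltr_pMr ?ltr1n.
Qed.

Let L_deriv h t : `|t - s| < rho -> is_derive t 1 (L ^~ h) (A t (L t h)).
Proof.
move=> ts; have [sig tsig /andP[sig0 sr]] := pick_sig ts.
set C := 2 * (`|Ls h| + 1); have C0 : 0 < C by rewrite mulr_gt0// ltr_wpDl.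
have [lA [B B0 hB]] := bA ts.
apply/is_deriveP => e e0.
have eC : 0 < e / (8 * C) by rewrite divr_gt0// mulr_gt0.
have [q1 q10 h1] := D_bounds h sr eC.
have [d1 d10 hd1] := sdiff_deriv_cont (dF ts) eC.
have [a a0 ha] := is_derive_cont (dy v00 ts) d10.
have M0 : 0 < K * C + e * C / (8 * C) + 1.
  by pos.
pose rad := Num.min (Num.min a (sig - `|t - s|))
  (e / (8 * B * (K * C + e * C / (8 * C) + 1))).
have rad0 : 0 < rad.
  by rewrite !lt_min a0 subr_gt0 tsig divr_gt0// !mulr_gt0.
exists rad => // r rr.
have usig u : `|u - t| <= `|r - t| -> `|u - s| <= sig.
  move=> ur; rewrite -(subrKA t) (le_trans (ler_normD _ _))//.
  by rewrite -lerBrDr (le_trans ur)// ltW// (lt_le_trans rr)// !ge_min lexx orbT.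
(* The radius [rad] does not depend on [k]. For a given [r] the quotient [D h k] is differentiated
   instead of its limit, with [k] chosen after [r] and [m]; the error [m] of passing to the limit is
   arbitrary. *)
have main (m : R) : 0 < m ->
    `|L r h - L t h - (r - t) *: A t (L t h)| <= e * `|r - t| + m.
  move=> m0; have m3 : 0 < m / 4 by rewrite divr_gt0.
  have e8 : 0 < e / (8 * B) by rewrite divr_gt0// mulr_gt0.
  have sigr : 0 < sig < rho by rewrite sig0.
  have [q2 q20 h2] := L_cvg h sigr m3; have [q3 q30 h3] := L_cvg h sigr e8.
  have [|k [k0 kq]] := @exists_k (Num.min (Num.min q1 q2) q3).
    by rewrite !lt_min q10 q20.
  move: kq; rewrite !lt_min => /andP[/andP[kq1 kq2] kq3].
  have [kd Bk] := h1 k k0 kq1.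
  have tt : `|t - s| <= sig by exact: ltW.
  have Dlip u : `|u - t| <= `|r - t| ->
      `|D h k u - D h k t| <= (K * C + e * C / (8 * C)) * `|u - t|.
    move=> ur; apply: (@mean_value_inequality_sym _ _ (D h k) (D' h k)).
      move=> w hw; apply: D_deriv => //; apply: le_lt_trans sr.
      by apply: usig; apply: le_trans ur; case: hw => /andP[w1 w2];
        [rewrite !ger0_norm ?subr_ge0 ?(le_trans w1)// lerD2r|
         rewrite !ler0_norm ?subr_le0 ?(le_trans w1)// lerN2 lerD2r].
    move=> w hw; have ws : `|w - s| <= sig.
      by apply: usig; apply: le_trans ur; case: hw => /andP[w1 w2];
        [rewrite !ger0_norm ?subr_ge0 ?(le_trans w1)// lerD2r|
         rewrite !ler0_norm ?subr_le0 ?(le_trans w1)// lerN2 lerD2r].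
    rewrite -(subrK (A w (D h k w)) (D' h k w)) (le_trans (ler_normD _ _))// addrC.
    rewrite lerD//.
      rewrite (le_trans (AK _ (le_lt_trans ws sr)))// ler_wpM2l//.
      exact: (Bk _ ws).1.
    by rewrite (le_trans (Bk _ ws).2)// -/C mulrAC.
  have H1 : `|D h k r - D h k t - (r - t) *: A t (L t h)| <= e / 2 * `|r - t|.
    pose g u := D h k u - u *: A t (L t h).
    have -> : D h k r - D h k t - (r - t) *: A t (L t h) = g r - g t.
      by rewrite /g; lmod_eq R.
    have btw w : t <= w <= r \/ r <= w <= t -> `|w - t| <= `|r - t|.
      by case=> /andP[w1 w2];
        [rewrite !ger0_norm ?subr_ge0 ?(le_trans w1)// lerD2r|
         rewrite !ler0_norm ?subr_le0 ?(le_trans w1)// lerN2 lerD2r].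
    apply: (@mean_value_inequality_sym _ _ g (fun u => D' h k u - A t (L t h))).
      move=> w /btw wr; apply: is_deriveB.
        by apply: D_deriv => //; apply: le_lt_trans sr; exact: usig.
      exact: is_derive_scalel.
    move=> w /btw wr; have ws := usig _ wr; have ws' := le_lt_trans ws sr.
    have wa : `|w - t| < rad by exact: le_lt_trans rr.
    have T1 := (Bk _ ws).2; have Dw := (Bk _ ws).1.
    have T2 : `|A w (D h k w) - A t (D h k w)| <= e / (8 * C) * C.
      apply: (@le_trans _ _ (e / (8 * C) * `|D h k w|)); last by rewrite ler_wpM2l// ltW.
      apply: hd1 (dF ws') _; apply: ha; rewrite (lt_le_trans wa)//.
      by rewrite !ge_min lexx.
    have T3 : `|A t (D h k w) - A t (D h k t)| <= e / 8.
      rewrite -(blinB (bA ts)) (le_trans (hB _))//.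
      have h5 := Dlip _ wr.
      apply: (@le_trans _ _ (B * ((K * C + e * C / (8 * C) + 1) * rad))).
        rewrite ler_wpM2l ?(ltW B0)// (le_trans h5)// ler_pM ?lerDl ?(ltW wa)//.
        by pos.
      apply: (@le_trans _ _ (B * ((K * C + e * C / (8 * C) + 1) *
          (e / (8 * B * (K * C + e * C / (8 * C) + 1)))))).
        by rewrite ler_wpM2l ?(ltW B0)// ler_wpM2l ?(ltW M0)// ge_min lexx orbT.
      rewrite le_eqVlt; apply/orP; left; apply/eqP.
      by move: M0; set M := K * C + _ + 1 => M0; field; rewrite !gt_eqF.
    have T4 : `|A t (D h k t) - A t (L t h)| <= e / 8.
      rewrite -(blinB (bA ts)) (le_trans (hB _))//.
      apply: (@le_trans _ _ (B * (e / (8 * B)))); first by rewrite ler_wpM2l ?h3// ltW.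
      by rewrite le_eqVlt; apply/orP; left; apply/eqP; field; rewrite gt_eqF.
    have E8 : e / (8 * C) * C = e / 8 by field; rewrite gt_eqF.
    have -> : D' h k w - A t (L t h) = (D' h k w - A w (D h k w)) +
       ((A w (D h k w) - A t (D h k w)) + ((A t (D h k w) - A t (D h k t)) +
        (A t (D h k t) - A t (L t h)))) by lmod_eq R.
    rewrite -/C E8 in T1; rewrite E8 in T2; rewrite (le_trans (ler_normD _ _))//.
    rewrite (_ : e / 2 = e / 8 + (e / 8 + (e / 8 + e / 8))); last by lra.
    rewrite lerD// (le_trans (ler_normD _ _))// lerD//.
    by rewrite (le_trans (ler_normD _ _))// lerD.
  have a1 := h2 k k0 kq2 r (usig _ (lexx _)); have a2 := h2 k k0 kq2 t tt.
  have -> : L r h - L t h - (r - t) *: A t (L t h) =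
      (D h k r - D h k t - (r - t) *: A t (L t h)) -
      ((D h k r - L r h) - (D h k t - L t h)) by lmod_eq R.
  rewrite (le_trans (ler_normB _ _))// lerD//.
    by rewrite (le_trans H1)// ler_wpM2r// ler_pdivrMr// ler_peMr ?ler1n// ltW.
  by rewrite (le_trans (ler_normB _ _))//; lra.
by apply/ler_addgt0Pr => m m0; exact: main.
Qed.

(** Linearity in [h] is a uniqueness statement: the defect of linearity solves the linearized
    equation with initial value 0. Boundedness is the same Gronwall estimate. *)
Let L_blin t : `|t - s| < rho -> blin (L t).
Proof.
move=> ts; split=> [a u v|].
  apply/eqP; rewrite -subr_eq0 -normr_eq0; apply/eqP/le_anti.
  rewrite normr_ge0 andbT.
  pose f r := L r (a *: u + v) - (a *: L r u + L r v).
  have := @gronwall f (fun r => A r (f r)) t 0 (lexx _) ts.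
  have -> : f s = 0 by rewrite /f !L_s ds.1.1 subrr.
  rewrite normr0 !mulr0 mul0r addr0; apply=> r rt; have rs := le_lt_trans rt ts.
    have -> : A r (f r) = A r (L r (a *: u + v)) - (a *: A r (L r u) + A r (L r v)).
      by rewrite /f (blinB (bA rs)) (bA rs).1.
    apply: is_deriveB; first exact: L_deriv.
    by apply: is_deriveD; [apply: is_deriveZ|]; exact: L_deriv.
  by rewrite addr0 AK.
have [lL [C C0 hC]] := ds.1; exists (2 * C) => [|h]; first exact: mulr_gt0.
have := @gronwall (L ^~ h) (fun r => A r (L r h)) t 0 (lexx _) ts.
rewrite mulr0 mul0r addr0 L_s => H.
apply: le_trans (H _ _) _.
- by move=> r rt; apply: L_deriv; exact: le_lt_trans ts.
- by move=> r rt; rewrite addr0 AK//; exact: le_lt_trans ts.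
- by rewrite -mulrA ler_wpM2l.
Qed.

Lemma variational : exists L' : R -> V -> W, [/\ L' s =1 Ls,
  (forall t, `|t - s| < rho -> sdiff (y ^~ t) v0 (L' t)) &
  (forall t h, `|t - s| < rho -> is_derive t 1 (L' ^~ h) (A t (L' t h)))].
Proof.
exists L; split=> [//|t ts|t h ts]; last exact: L_deriv.
split=> [|e e0]; first exact: L_blin.
have [sig tsig /andP[sig0 sr]] := pick_sig ts.
have [C C0 [d1 d10 hd1]] := sdiff_lipschitz ds.
have e1 : 0 < e / (16 * C * rho) by rewrite divr_gt0// !mulr_gt0.
have [d2 /andP[d20 d2d] hd2] := variational_unif sr e1.
have e4 : 0 < e / 4 by rewrite divr_gt0.
have [d3 d30 hd3] := ds.2 _ e4.
exists (Num.min (Num.min d1 d2) d3) => [|v v']; first by rewrite !lt_min d10 d20.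
rewrite !lt_min => /andP[/andP[v1 v2] v3] /andP[/andP[v'1 v'2] v'3].
have vD := lt_le_trans v2 d2d; have v'D := lt_le_trans v'2 d2d.
(* The error of the linear approximation solves the linearized equation up to [m], and at time [s]
   it is at most e / 4 times |v - v'|. *)
pose f r := y v r - y v' r - L r (v - v').
pose m := e / (16 * C * rho) * (2 * (C * `|v - v'|)).
have m0 : 0 <= m by rewrite /m; pos.
apply: le_trans (@gronwall f (fun r => F (y v r) - F (y v' r) - A r (L r (v - v')))
  t m m0 ts _ _) _.
- move=> r rt; have rs := le_lt_trans rt ts.
  by apply: is_deriveB; [apply: is_deriveB; exact: dy|exact: L_deriv].
- move=> r rt; have rs := le_lt_trans rt ts.
  have -> : F (y v r) - F (y v' r) - A r (L r (v - v')) = A r (f r) +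
      (F (y v r) - F (y v' r) - A r (y v r - y v' r)).
    by rewrite /f (blinB (bA rs)); lmod_eq R.
  rewrite (le_trans (ler_normD _ _))// lerD// ?AK//.
  apply: le_trans (hd2 _ _ _ _ v2 v'2) _; first by rewrite (le_trans rt)// ltW.
  rewrite ler_wpM2l ?(ltW e1)// (le_trans (y_lip vD v'D rs))// ler_wpM2l//.
  exact: hd1.
- have fs : `|f s| <= e / 4 * `|v - v'| by rewrite /f L_s; exact: hd3.
  have ms : 2 * m * `|t - s| <= e / 4 * `|v - v'|.
    apply: (@le_trans _ _ (2 * m * rho)); first by rewrite ler_wpM2l ?(ltW ts)//; pos.
    by rewrite le_eqVlt; apply/orP; left; apply/eqP; rewrite /m; field; rewrite !gt_eqF.
  have := mulr_ge0 (ltW e0) (normr_ge0 (v - v')).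
  by lra.
Qed.

End Variational.

Section CurveRules.
Context {R : realType}.
Implicit Types V W : normedModType R.

Lemma is_derive_near V (f g : R -> V) (t : R) d :
  (\forall s \near t, f s = g s) -> is_derive t 1 f d -> is_derive t 1 g d.
Proof.
move=> /near_normP[q q0 hq] /is_deriveP H; apply/is_deriveP => e /H[r r0 hr].
exists (Num.min r q) => [|s]; first by rewrite lt_min r0.
rewrite lt_min => /andP[sr sq]; rewrite -!hq ?hr// subrr normr0//.
Qed.

Lemma is_derive_sdiff V W (u : R -> V) (f : V -> W) (t : R) d L :
  is_derive t 1 u d -> sdiff f (u t) L -> is_derive t 1 (fun s => f (u s)) (L d).
Proof.
move=> du [bL df]; have [lL [C C0 hC]] := bL; apply/is_deriveP => e e0.
have k0 : 0 < `|d| + 1 by rewrite ltr_wpDl.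
have e1 : 0 < e / 2 / (`|d| + 1) by pos.
have e2 : 0 < Num.min 1 (e / 2 / C) by rewrite lt_min ltr01; pos.
have [r r0 hr] := df _ e1; have [q q0 hq] := is_derive_cont du r0.
have [p p0 hp] := (is_deriveP _ _ _).1 du _ e2.
exists (Num.min q p) => [|s]; first by rewrite lt_min q0.
rewrite lt_min => /andP[/hq sq /hp sp].
have usd : `|u s - u t| <= (`|d| + 1) * `|s - t|.
  rewrite -(subrK ((s - t) *: d) (u s - u t)) (le_trans (ler_normD _ _))//.
  rewrite addrC mulrDl lerD// ?normrZ 1?(mulrC `|d|)// (le_trans sp)//.
  by rewrite ler_wpM2r// ge_min lexx.
have := hr (u s) (u t) sq; rewrite subrr normr0 => /(_ r0) h.
have -> : f (u s) - f (u t) - (s - t) *: L d =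
    (f (u s) - f (u t) - L (u s - u t)) + L (u s - u t - (s - t) *: d).
  by rewrite (blinB bL _ (_ *: _)) (blinZ bL); lmod_eq R.
rewrite (le_trans (ler_normD _ _))// [e]splitr mulrDl lerD//.
  apply: (le_trans h); apply: (@le_trans _ _ (e / 2 / (`|d| + 1) * ((`|d| + 1) * `|s - t|))).
    by rewrite ler_wpM2l// ltW.
  by rewrite mulrA mulfVK// gt_eqF.
rewrite (le_trans (hC _))//.
apply: (@le_trans _ _ (C * (e / 2 / C * `|s - t|))).
  rewrite ler_wpM2l ?(ltW C0)// (le_trans sp)// ler_wpM2r//.
  by rewrite ge_min lexx orbT.
by rewrite mulrA (mulrC C) mulfVK// gt_eqF.
Qed.

Lemma is_derive_pair V W (f : R -> V) (g : R -> W) (t : R) d e :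
  is_derive t 1 f d -> is_derive t 1 g e -> is_derive t 1 (fun s => (f s, g s)) (d, e).
Proof.
move=> /is_deriveP df /is_deriveP dg; apply/is_deriveP => k k0.
have [r r0 hr] := df _ k0; have [q q0 hq] := dg _ k0.
exists (Num.min r q) => [|s]; first by rewrite lt_min r0.
rewrite lt_min => /andP[/hr h1 /hq h2].
by rewrite prod_normE /= ge_max h1.
Qed.

Lemma is_derive_fst V W (f : R -> V * W) (t : R) d :
  is_derive t 1 f d -> is_derive t 1 (fun s => (f s).1) d.1.
Proof. by move=> df; exact: (is_derive_sdiff df (sdiff_fst _)). Qed.

Lemma is_derive_snd V W (f : R -> V * W) (t : R) d :
  is_derive t 1 f d -> is_derive t 1 (fun s => (f s).2) d.2.
Proof. by move=> df; exact: (is_derive_sdiff df (sdiff_snd _)). Qed.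

Lemma is_derive_affine V (f : R -> V) (a b t : R) d :
  is_derive (a * t + b) 1 f d -> is_derive t 1 (fun s => f (a * s + b)) (a *: d).
Proof.
move=> /is_deriveP df; apply/is_deriveP => e e0.
have a1 : 0 < `|a| + 1 by rewrite ltr_wpDl.
have [r r0 hr] := df _ (divr_gt0 e0 a1); exists (r / (`|a| + 1)); first by pos.
move=> s; rewrite ltr_pdivlMr// => sr.
have E : a * s + b - (a * t + b) = a * (s - t) by ring.
have := hr (a * s + b); rewrite E scalerA (mulrC _ a) => H.
apply: le_trans (H _) _.
  rewrite normrM mulrC (le_lt_trans _ sr)// ler_wpM2l// lerDl//.
rewrite normrM mulrA ler_wpM2r// mulrAC ler_pdivrMr// ler_wpM2l ?(ltW e0)//.
by rewrite lerDl.
Qed.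

Lemma derive1_is_derive V (f : R -> V) (t : R) d : is_derive t 1 f d -> derive1 f t = d.
Proof. by move=> [_ <-]; rewrite derive1E. Qed.

Lemma derivable_derive1 V (f : R -> V) (t : R) : derivable f t 1 -> is_derive t 1 f (derive1 f t).
Proof. by rewrite derive1E => /derivableP. Qed.

Lemma sdiff_partial n (f : 'rV[R]_n -> R) x L : sdiff f x L ->
  forall h, L h = \sum_k h 0 k * partial k f x.
Proof.
move=> df h; rewrite {1}[h]row_sum_delta.
have E (r : seq 'I_n) : L (\sum_(j <- r) h 0 j *: delta_mx 0 j) =
    \sum_(j <- r) h 0 j *: L (delta_mx 0 j).
  elim: r => [|j r ih]; first by rewrite !big_nil (blin0 df.1).
  by rewrite !big_cons df.1.1 ih.
rewrite E; apply: eq_bigr => j _; congr (_ * _).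
by have [_ <-] := sdiff_is_derive (delta_mx 0 j) df.
Qed.

Lemma complete_prod V W :
  (forall F : set_system V, ProperFilter F -> cauchy F -> exists l : V, F --> l) ->
  (forall F : set_system W, ProperFilter F -> cauchy F -> exists l : W, F --> l) ->
  forall F : set_system (V * W), ProperFilter F -> cauchy F ->
    exists l : V * W, F --> l.
Proof.
move=> cV cW F PF cF.
have [l1 c1] : exists l : V, fst @ F --> l.
  apply: cV; apply/cauchy_ballP => e e0.
  have [[P Q] /= [FP FQ] h] := (cauchy_ballP _).2 cF e e0.
  exists (fst @` P, fst @` Q).
    by split; rewrite /= nbhs_simpl /=; [apply: filterS FP|apply: filterS FQ] => z; exists z.
  move=> [_ _] [/= [p Pp <-] [q Qq <-]].
  by have [] := h (p, q) (conj Pp Qq).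
have [l2 c2] : exists l : W, snd @ F --> l.
  apply: cW; apply/cauchy_ballP => e e0.
  have [[P Q] /= [FP FQ] h] := (cauchy_ballP _).2 cF e e0.
  exists (snd @` P, snd @` Q).
    by split; rewrite /= nbhs_simpl /=; [apply: filterS FP|apply: filterS FQ] => z; exists z.
  move=> [_ _] [/= [p Pp <-] [q Qq <-]].
  by have [] := h (p, q) (conj Pp Qq).
exists (l1, l2) => A [[P Q] /= [nP nQ] PQA].
have FP : F (fst @^-1` P) := c1 _ nP; have FQ : F (snd @^-1` Q) := c2 _ nQ.
apply: (@filterS _ F _ _ _ _ (filterI FP FQ)) => -[a b] [/= ? ?].
exact: (PQA (a, b)).
Qed.

Lemma complete_state n : forall F : set_system ('rV[R]_n * 'rV[R]_n),
  ProperFilter F -> cauchy F -> exists l : 'rV[R]_n * 'rV[R]_n, F --> l.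
Proof.
apply: complete_prod => F PF cF; exists (lim F); exact: cauchy_cvg.
Qed.

End CurveRules.

(** * Charts and geodesics *)

Section Charts.
Context {R : realType} {n : nat} (M : riemannianManifold R n).
Local Notation V := 'rV[R]_n.
Implicit Types (i j : chart_idx M) (x : M) (c : R -> M) (v w : V) (t : R).

Lemma nbhs_dom i x : chart_dom i x -> nbhs x (chart_dom i).
Proof. by move=> ix; apply: open_nbhs_nbhs; split=> //; exact: chart_dom_open. Qed.

Lemma near_chart_img i x (A : set M) : chart_dom i x -> nbhs x A ->
  \forall y \near chart i x, chart_dom i (chart_inv i y) /\
    A (chart_inv i y) /\ chart i (chart_inv i y) = y.
Proof.
move=> ix nA.
have imU : nbhs (chart i x) (chart i @` chart_dom i).
  by apply: open_nbhs_nbhs; split; [exact: chart_img_open|exists x].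
have iA : \forall y \near chart i x, A (chart_inv i y).
  apply: (chart_inv_continuous ix); rewrite chart_invK//.
near=> y; have [z iz zy] : (chart i @` chart_dom i) y by near: y.
have Ay : A (chart_inv i y) by near: y.
by rewrite -zy in Ay *; rewrite chart_invK// in Ay *.
Unshelve. all: by end_near. Qed.

Lemma near_chart i x (P : set V) : chart_dom i x -> nbhs (chart i x) P ->
  \forall z \near x, chart_dom i z /\ P (chart i z).
Proof.
move=> ix nP; apply: filterI; first exact: nbhs_dom.
exact: (chart_continuous ix).
Qed.

Definition trans i j : V -> V := chart j \o chart_inv i.

Lemma trans_chart i j x : chart_dom i x -> trans i j (chart i x) = chart j x.
Proof. by move=> ix; rewrite /trans /= chart_invK. Qed.

Lemma open_chart_inter i j : open (chart i @` (chart_dom i `&` chart_dom j)).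
Proof.
rewrite openE => _ [x [ix jx] <-]; rewrite /interior.
have := near_chart_img ix (nbhs_dom jx); apply: filterS => y [iy [jy yE]].
by exists (chart_inv i y).
Qed.

Lemma trans_sdiff i j x : chart_dom i x -> chart_dom j x ->
  sdiff (trans i j) (chart i x) (fun h => h *m 'J (trans i j) (chart i x)).
Proof.
move=> ix jx.
have dk (a : 'I_1) (k : 'I_n) := class_C1_sdiff (@open_chart_inter i j)
  (ex_intro2 _ _ x (conj ix jx) erefl) (@chart_smooth R n M i j k 1).
have E : (fun y => \matrix_(a, k) chart j (chart_inv i y) 0 k) = trans i j.
  by apply/funext => y; apply/rowP => k; rewrite mxE.
have := sdiff_mx dk; rewrite E => H.
exact: (sdiff_ext H (sdiff_jacobian H)).
Qed.

Lemma trans_jac i j x k l : chart_dom i x -> chart_dom j x ->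
  'J (trans i j) (chart i x) k l = partial k (fun y => chart j (chart_inv i y) 0 l) (chart i x).
Proof.
move=> ix jx; have d := trans_sdiff ix jx.
have dl := sdiff_comp d (sdiff_lin _ (blin_coord l)).
have [_ ] := sdiff_is_derive (delta_mx 0 k) dl.
by rewrite -rowE mxE.
Qed.

(** Velocities change charts by the Jacobian of the transition map, so comparing states in two
    charts takes the transition map to second order. *)
Lemma trans_jac_sdiff i j x w : chart_dom i x -> chart_dom j x ->
  exists L, sdiff (fun z : V * V => z.2 *m 'J (trans i j) z.1) (chart i x, w) L.
Proof.
move=> ix jx.
have dk k l := class_C1_sdiff (@open_chart_inter i j)
  (ex_intro2 _ _ x (conj ix jx) erefl) ((@chart_smooth R n M i j l 2).2 k).
have dz (a : 'I_1) (l : 'I_n) := sdiff_sum (index_enum 'I_n) (fun k => sdiffM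
  (sdiff_comp (sdiff_snd (chart i x, w)) (sdiff_lin _ (blin_coord k)))
  (sdiff_comp (sdiff_fst (chart i x, w)) (dk k l))).
eexists; apply: sdiff_near (sdiff_mx dz) _.
have : \forall y \near chart i x, (chart i @` (chart_dom i `&` chart_dom j)) y.
  by apply: open_nbhs_nbhs; split; [exact: open_chart_inter|exists x].
move=> /near_normP[r r0 hr]; apply/near_normP; exists r => // -[y v].
rewrite prod_normE /= gt_max => /andP[/hr[x' [ix' jx'] <-] _].
apply/rowP => l; rewrite !mxE; apply: eq_bigr => k _.
by rewrite trans_jac.
Qed.

(** The inner product read in an arbitrary chart around [x], whereas [inner] is tied to the
    preferred chart, which jumps along a curve. *)
Definition ginner i x v w : R := (v *m metric i (chart i x) *m w^T) 0 0.

Lemma ginner_trans i j x v w : chart_dom i x -> chart_dom j x ->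
  ginner i x v w = ginner j x (v *m 'J (trans i j) (chart i x)) (w *m 'J (trans i j) (chart i x)).
Proof.
move=> ix jx; rewrite /ginner (metric_compat ix jx) -/(trans i j).
by rewrite trmx_mul !mulmxA.
Qed.

Lemma ginner_inner x : ginner (chart_at x) x = inner x.
Proof. by []. Qed.

Lemma ginner_linl i x w (a : R) u v : ginner i x (a *: u + v) w = a * ginner i x u w + ginner i x v w.
Proof. by rewrite /ginner !mulmxDl -!scalemxAl !mxE. Qed.

Lemma ginnerC i x v w : chart_dom i x -> ginner i x v w = ginner i x w v.
Proof.
move=> ix; rewrite /ginner -[in RHS](trmxK (w *m _ *m _)) [in RHS]mxE.
by rewrite trmx_mul trmx_mul trmxK Defs.metric_sym// mulmxA.
Qed.

Lemma ginner_gt0 i x v : chart_dom i x -> v != 0 -> 0 < ginner i x v v.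
Proof. exact: metric_pos. Qed.

Lemma ginner0l i x w : ginner i x 0 w = 0.
Proof. by rewrite /ginner !mul0mx mxE. Qed.

Lemma ginner_ge0 i x v : chart_dom i x -> 0 <= ginner i x v v.
Proof.
move=> ix; have [->|/(ginner_gt0 ix)/ltW//] := eqVneq v 0.
by rewrite ginner0l.
Qed.

Lemma ginner_eq0 i x v : chart_dom i x -> ginner i x v v = 0 -> v = 0.
Proof.
by move=> ix v0; apply/eqP/negPn/negP => /(ginner_gt0 ix); rewrite v0 ltxx.
Qed.

Lemma trans_jac_inj i j x v : chart_dom i x -> chart_dom j x ->
  v *m 'J (trans i j) (chart i x) = 0 -> v = 0.
Proof.
move=> ix jx v0; apply: (ginner_eq0 ix).
by rewrite (ginner_trans v v ix jx) v0 ginner0l.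
Qed.

Lemma curve_trans c i j t d : {for t, continuous c} -> chart_dom i (c t) -> chart_dom j (c t) ->
  is_derive t 1 (chart i \o c) d ->
  is_derive t 1 (chart j \o c) (d *m 'J (trans i j) (chart i (c t))).
Proof.
move=> cc ix jx dc.
have H := is_derive_sdiff dc (trans_sdiff ix jx).
apply: is_derive_near H.
have : \forall s \near t, chart_dom i (c s) by apply: cc; exact: nbhs_dom.
by apply: filterS => s /= /trans_chart ->.
Qed.

End Charts.

Section SomeStrictDerivative.
Context {R : realType} {V : normedModType R}.
Implicit Types (f g : V -> R) (x : V).

Definition sdf f x : Prop := exists L, sdiff f x L.

Lemma sdf_cst x (c : R) : sdf (fun=> c) x.
Proof. by exists (fun=> 0); exact: sdiff_cst. Qed.

Lemma sdfD f g x : sdf f x -> sdf g x -> sdf (fun y => f y + g y) x.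
Proof. by move=> [L df] [K dg]; eexists; exact: sdiffD df dg. Qed.

Lemma sdfB f g x : sdf f x -> sdf g x -> sdf (fun y => f y - g y) x.
Proof. by move=> [L df] [K dg]; eexists; exact: sdiffB df dg. Qed.

Lemma sdfM f g x : sdf f x -> sdf g x -> sdf (fun y => f y * g y) x.
Proof. by move=> [L df] [K dg]; eexists; exact: sdiffM df dg. Qed.

Lemma sdfV f x : sdf f x -> f x != 0 -> sdf (fun y => (f y)^-1) x.
Proof. by move=> [L df] fx; exact: sdiffV df fx. Qed.

Lemma sdf_sum (I : Type) (r : seq I) (f : I -> V -> R) x :
  (forall i, sdf (f i) x) -> sdf (fun y => \sum_(i <- r) f i y) x.
Proof.
move=> df; elim: r => [|i r ih].
  by under eq_fun do rewrite big_nil; exact: sdf_cst.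
by under eq_fun do rewrite big_cons; exact: sdfD.
Qed.

Lemma sdf_prod (I : Type) (r : seq I) (f : I -> V -> R) x :
  (forall i, sdf (f i) x) -> sdf (fun y => \prod_(i <- r) f i y) x.
Proof.
move=> df; elim: r => [|i r ih].
  by under eq_fun do rewrite big_nil; exact: sdf_cst.
by under eq_fun do rewrite big_cons; exact: sdfM.
Qed.

Lemma sdf_det m (A : V -> 'M[R]_m) x : (forall a b, sdf (fun y => A y a b) x) ->
  sdf (fun y => \det (A y)) x.
Proof.
move=> dA; rewrite /determinant; apply: sdf_sum => s.
by apply: sdfM; [exact: sdf_cst|apply: sdf_prod].
Qed.

Lemma sdf_near f g x : sdf f x -> (\forall y \near x, f y = g y) -> sdf g x.
Proof. by move=> [L df] fg; exists L; exact: sdiff_near df fg. Qed.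

End SomeStrictDerivative.

(** * The geodesic equation as a first-order system *)

Section GeodesicField.
Context {R : realType} {n : nat} (M : riemannianManifold R n).
Local Notation V := 'rV[R]_n.
Implicit Types (i j : chart_idx M) (x : M) (v w : V) (t : R).

Lemma near_chart_domain i x : chart_dom i x ->
  \forall y \near chart i x, exists2 x', chart_dom i x' & chart i x' = y.
Proof.
by move=> ix; apply: open_nbhs_nbhs; split; [exact: chart_img_open|exists x].
Qed.

Lemma metric_unit i x : chart_dom i x -> metric i (chart i x) \in unitmx.
Proof.
move=> ix; rewrite -row_free_unit -kermx_eq0; apply/rowV0P => v /sub_kermxP v0.
by apply: (ginner_eq0 ix); rewrite /ginner v0 mul0mx mxE.
Qed.

Lemma metric_sdf i x a b : chart_dom i x ->
  sdf (fun y => metric i y a b) (chart i x).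
Proof.
move=> ix; eexists; apply: class_C1_sdiff (@chart_img_open R n M i) _ _.
  by exists x.
exact: (@metric_smooth R n M i a b 1).
Qed.

Lemma partial_metric_sdf i x a b k : chart_dom i x ->
  sdf (partial k (fun y => metric i y a b)) (chart i x).
Proof.
move=> ix; eexists; apply: class_C1_sdiff (@chart_img_open R n M i) _ _.
  by exists x.
exact: (@metric_smooth R n M i a b 2).2.
Qed.

Lemma invmx_metric_sdf i x a b : chart_dom i x ->
  sdf (fun y => invmx (metric i y) a b) (chart i x).
Proof.
move=> ix.
(* Cramer's rule. The formula agrees with [invmx] where the metric is invertible, which covers a
   neighbourhood of [chart i x]. *)
have H : sdf (fun y => (\det (metric i y))^-1 * cofactor (metric i y) b a) (chart i x).
  apply: sdfM.
    apply: sdfV; first by apply: sdf_det => *; exact: metric_sdf.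
    by rewrite -unitfE -unitmxE metric_unit.
  rewrite /cofactor; apply: sdfM; first exact: sdf_cst.
  apply: sdf_det => k l; under eq_fun do rewrite !mxE; exact: metric_sdf.
apply: sdf_near H _; have := near_chart_domain ix.
apply: filterS => _ [x' ix' <-].
by rewrite /invmx metric_unit// !mxE.
Qed.

Lemma christoffel_sdf i x k a b : chart_dom i x ->
  sdf (fun y => christoffel (metric i) y k a b) (chart i x).
Proof.
move=> ix; rewrite /christoffel; apply: sdfM; first exact: sdf_cst.
apply: sdf_sum => l; apply: sdfM; first exact: invmx_metric_sdf.
by apply: sdfB; [apply: sdfD|]; exact: partial_metric_sdf.
Qed.

Lemma christoffel_sym i x k a b : chart_dom i x ->
  christoffel (metric i) (chart i x) k a b = christoffel (metric i) (chart i x) k b a.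
Proof.
move=> ix; rewrite /christoffel; congr (_ * _); apply: eq_bigr => l _.
congr (_ * (_ - _)); first by rewrite addrC.
apply: near_eq_derive => //.
have := near_chart_domain ix; apply: filterS => _ [x' ix' <-].
by rewrite -[in LHS]Defs.metric_sym// mxE.
Qed.

(** The geodesic spray, acting on pairs of a position and a velocity. *)
Definition gfield i (z : V * V) : V * V :=
  (z.2, - christoffel_form (metric i) z.1 z.2 z.2).

(** The differential of the spray. Along a geodesic it governs the pairs of a Jacobi field in
    coordinates and its time derivative. *)
Definition gfield_diff i (z h : V * V) : V * V :=
  (h.2, - \row_k \sum_a \sum_b
     ((\sum_m h.1 0 m * partial m (fun y => christoffel (metric i) y k a b) z.1)
        * z.2 0 a * z.2 0 b
      + christoffel (metric i) z.1 k a b * (h.2 0 a * z.2 0 b + z.2 0 a * h.2 0 b))).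

Lemma gfield_sdiff i x w : chart_dom i x ->
  sdiff (gfield i) (chart i x, w) (gfield_diff i (chart i x, w)).
Proof.
move=> ix; set z := (chart i x, w); rewrite /gfield /gfield_diff.
apply: sdiff_pair; first exact: sdiff_snd.
apply: sdiffN.
have dc k a b : sdiff (fun y => christoffel (metric i) y k a b) (chart i x)
    (fun h => \sum_m h 0 m * partial m (fun y => christoffel (metric i) y k a b) (chart i x)).
  have [L dL] := christoffel_sdf k a b ix.
  exact: sdiff_ext dL (sdiff_partial dL).
have d1 k a b := sdiff_comp (sdiff_fst z) (dc k a b).
have d2 (a : 'I_n) := sdiff_comp (sdiff_snd z) (sdiff_lin _ (blin_coord a)).
have dd (r : 'I_1) k := sdiff_sum (index_enum 'I_n) (fun a =>
  sdiff_sum (index_enum 'I_n) (fun b => sdiffM (sdiffM (d1 k a b) (d2 a)) (d2 b))).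
have H := sdiff_mx dd.
have E : (fun z : V * V => christoffel_form (metric i) z.1 z.2 z.2) =
    (fun y => \matrix_(r < 1, k < n) \sum_a \sum_b
      christoffel (metric i) y.1 k a b * y.2 0 a * y.2 0 b).
  by apply/funext => y; apply/rowP => k; rewrite !mxE.
rewrite E; apply: sdiff_ext H _ => h; apply/rowP => k; rewrite !mxE.
apply: eq_bigr => a _; apply: eq_bigr => b _ /=.
by ring.
Qed.

Definition state i (c : R -> M) t : V * V :=
  (chart i (c t), derive1 (chart i \o c) t).

(* Geodesics of constant speed, possibly different from 1 and possibly zero. *)
Definition cgeodesic (c : R -> M) : Prop :=
  continuous c /\ forall i t, chart_dom i (c t) ->
    is_derive t 1 (chart i \o c) (derive1 (chart i \o c) t) /\
    is_derive t 1 (derive1 (chart i \o c))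
      (- christoffel_form (metric i) (chart i (c t))
          (derive1 (chart i \o c) t) (derive1 (chart i \o c) t)).

Lemma is_geodesic_cgeodesic c : is_geodesic c -> cgeodesic c.
Proof.
move=> [cc _ hc]; split=> // i t /hc [d1 d2 /eqP].
rewrite addr_eq0 => /eqP E; split; first exact: derivable_derive1.
by rewrite -E; exact: derivable_derive1.
Qed.

Lemma cgeodesic_state c i t : cgeodesic c -> chart_dom i (c t) ->
  is_derive t 1 (state i c) (gfield i (state i c t)).
Proof. by move=> [_ hc] /hc[d1 d2]; exact: is_derive_pair. Qed.

Lemma near_dom (c : R -> M) i t : continuous c -> chart_dom i (c t) ->
  exists2 r : R, 0 < r & forall s, `|s - t| < r -> chart_dom i (c s).
Proof.
move=> cc ic; apply/near_normP; exact: cc (nbhs_dom ic).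
Qed.

Lemma cgeodesic_affine c (a b : R) : cgeodesic c -> cgeodesic (fun t => c (a * t + b)).
Proof.
move=> [cc hc].
have cc' : continuous (fun t => c (a * t + b)).
  move=> t; apply: (@continuous_comp _ _ _ (fun t => a * t + b) c); last exact: cc.
  by apply: cvgD; [apply: cvgM; [exact: cvg_cst|exact: cvg_id]|exact: cvg_cst].
split=> // i t it.
have [r r0 hr] := near_dom cc' it.
have d1 s : chart_dom i (c (a * s + b)) ->
    is_derive s 1 (chart i \o (fun t => c (a * t + b)))
      (a *: derive1 (chart i \o c) (a * s + b)).
  by move=> /hc[d _]; exact: (is_derive_affine d).
have E s : chart_dom i (c (a * s + b)) ->
    derive1 (chart i \o (fun t => c (a * t + b))) s = a *: derive1 (chart i \o c) (a * s + b).
  by move=> /d1/derive1_is_derive.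
rewrite (E _ it); split; first exact: d1.
have [_ d2] := hc _ _ it.
have d3 := is_derive_affine d2.
have d4 : is_derive t 1 (fun s => a *: derive1 (chart i \o c) (a * s + b))
   (- christoffel_form (metric i) (chart i (c (a * t + b)))
     (a *: derive1 (chart i \o c) (a * t + b))
     (a *: derive1 (chart i \o c) (a * t + b))).
  set Y := christoffel_form _ _ _ _ in d3 *; set Z := christoffel_form _ _ _ _.
  suff -> : - Z = a *: (a *: - Y) by exact: is_deriveZ.
  rewrite !scalerN /Y /Z; congr (- _); apply/rowP => k; rewrite !mxE !mulr_sumr.
  apply: eq_bigr => l _; rewrite !mulr_sumr; apply: eq_bigr => m _; rewrite !mxE.
  by ring.
apply: is_derive_near d4; apply/near_normP; exists r => // s /hr.
by move=> /E ->.
Qed.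

Lemma cgeodesic_cst x : cgeodesic (fun=> x).
Proof.
split=> [t|i t ix]; first exact: cvg_cst.
have E : derive1 (chart i \o (fun=> x : M)) = fun=> 0 :> V.
  by apply/funext => s; apply: derive1_is_derive; exact: is_derive_cst.
rewrite E; split; first exact: is_derive_cst.
suff -> : - christoffel_form (metric i) (chart i x) 0 0 = 0 by exact: is_derive_cst.
apply/rowP => k; rewrite !mxE big1 ?oppr0// => a _; rewrite big1// => b _.
by rewrite !mxE mulr0.
Qed.

End GeodesicField.

Section GeodesicFlow.
Context {R : realType} {n : nat} (M : riemannianManifold R n).
Local Notation V := 'rV[R]_n.
Implicit Types (i j : chart_idx M) (x : M) (v w : V) (s t : R) (c : R -> M).

(** A closed coordinate ball is compact, hence closed in the Hausdorff space [M]. This prevents a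
    curve from leaving the chart at a limit time while its coordinates stay bounded. *)
Lemma chart_ball_closed i x : chart_dom i x -> exists2 r : R, 0 < r &
  (forall y, `|y - chart i x| <= r -> chart_dom i (chart_inv i y) /\ chart i (chart_inv i y) = y)
  /\ forall q, 0 < q <= r -> closed [set z | chart_dom i z /\ `|chart i z - chart i x| <= q].
Proof.
move=> ix; have nT : nbhs x [set: M] by exact: filterT.
have [r r0 hr] := (near_normP _ _).1 (near_chart_img ix nT).
exists (r / 2); first by pos.
have r2 : r / 2 < r by rewrite ltr_pdivrMr// ltr_pMr// ltr1n.
split=> [y yr|q /andP[q0 qr]].
  by have [h1 [_ h2]] := hr _ (le_lt_trans yr r2).
pose B := [set y : V | `|y - chart i x| <= q].
have cB : compact B.
  apply: bounded_closed_compact; last exact: closed_norm_le.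
  exists (q + `|chart i x|); split; first exact: num_real.
  move=> m hm y By; rewrite /= -(subrK (chart i x) y) (le_trans (ler_normD _ _))//.
  by rewrite (le_trans _ (ltW hm))// lerD2r.
have -> : [set z | chart_dom i z /\ `|chart i z - chart i x| <= q] = chart_inv i @` B.
  apply/seteqP; split=> [z [iz zq]|_ [y yB <-]] /=.
    by exists (chart i z) => //; rewrite chart_invK.
  have [h1 [_ h2]] := hr y (le_lt_trans (le_trans yB qr) r2).
  by rewrite h2.
apply: compact_closed; first exact: manifold_hausdorff.
apply: continuous_compact cB; apply: continuous_in_subspaceT => y; rewrite inE => yB.
have [h1 [_ h2]] := hr y (le_lt_trans (le_trans yB qr) r2).
by rewrite -h2; exact: chart_inv_continuous.
Qed.

(** Existence of geodesics comes from completeness; what is established here is a duration [eta],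
    common to all states near a given one, during which geodesics stay in the chart and depend on
    their states in a Lipschitz way. *)
Lemma geodesic_flow i x w : chart_dom i x ->
  exists (rho rho1 eta C : R), [/\ 0 < rho, 0 < eta, 0 <= C, C * eta <= 2^-1 &
  [/\ forall z, `|z - (chart i x, w)| < rho1 -> forall K, sdiff (gfield (M := M) i) z K ->
        forall h, `|K h| <= C * `|h|,
      forall c s, cgeodesic c -> chart_dom i (c s) ->
        `|state i c s - (chart i x, w)| < rho -> forall t, `|t - s| <= eta ->
        chart_dom i (c t) /\ `|state i c t - (chart i x, w)| < rho1
    & forall c c' s, cgeodesic c -> cgeodesic c' -> chart_dom i (c s) ->
        chart_dom i (c' s) -> `|state i c s - (chart i x, w)| < rho ->
        `|state i c' s - (chart i x, w)| < rho -> forall t, `|t - s| <= eta ->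
        `|state i c t - state i c' t| <= 2 * `|state i c s - state i c' s| ]].
Proof.
move=> ix; set y0 := (chart i x, w).
have dG := gfield_sdiff w ix; rewrite -/y0 in dG.
have [C1 C10 [r1 r10 hr1]] := sdiff_lipschitz dG.
have [r2 r20 hr2] := sdiff_deriv_cont dG ltr01.
have [lG [C2 C20 hC2]] := dG.1.
have [r3 r30 [_ hr3]] := chart_ball_closed ix.
pose r := Num.min (Num.min r1 r2) r3.
have r0 : 0 < r by rewrite !lt_min r10 r20.
pose C := C1 + C2 + 1; have C0 : 0 < C by pos.
have C1C : C1 <= C by rewrite /C; lra.
have rr1 : r / 2 < r1.
  have : r <= r1 by rewrite !ge_min lexx.
  by move: r0; lra.
(* [K] bounds the spray on the ball of radius [r], so a solution moves at most r / 4 during the time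
   r / (4 K). The bound 1 / (2 C) on [eta] is the duration that [gronwall_half] allows. *)
pose K := `|gfield i y0| + C * r + 1; have K0 : 0 < K by pos.
pose eta := Num.min (r / (4 * K)) ((2 * C)^-1).
have eta0 : 0 < eta by rewrite lt_min invr_gt0; apply/andP; split; pos.
have Gbound z : `|z - y0| < r -> `|gfield i z| <= K.
  move=> zr; have zr1 : `|z - y0| < r1 by rewrite (lt_le_trans zr)// !ge_min lexx.
  have := hr1 z y0 zr1; rewrite subrr normr0 => /(_ r10) h.
  rewrite -(subrK (gfield i y0) (gfield i z)) (le_trans (ler_normD _ _))//.
  have : C1 * `|z - y0| <= C * r.
    by apply: ler_pM; rewrite ?(ltW zr) ?(ltW C10)// /C; lra.
  by rewrite /K; lra.
have stay c s : cgeodesic c -> chart_dom i (c s) -> `|state i c s - y0| < r / 4 ->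
    forall t, `|t - s| <= eta -> chart_dom i (c t) /\ `|state i c t - y0| <= r / 2.
  move=> gc ics sr t ts.
  (* The sign [b] turns both time directions into forward motion from [s]. *)
  pose b := Num.sg (t - s); pose g (u : R) := state i c (b * u + s).
  pose c' u := c (b * u + s).
  have bb : `|b| <= 1.
    by rewrite /b normr_sg; case: (_ != _) => //=; rewrite ler01.
  have dg u : chart_dom i (c' u) -> is_derive u 1 g (b *: gfield i (g u)).
    by move=> iu; apply: is_derive_affine; exact: cgeodesic_state.
  have cc' : continuous c' by exact: (cgeodesic_affine b s gc).1.
  pose P u := chart_dom i (c' u) /\ `|g u - g 0| <= K * u.
  have etaK u : 0 <= u <= eta -> K * u <= r / 4.
    move=> /andP[u0 ue]; apply: (@le_trans _ _ (K * (r / (4 * K)))).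
      rewrite ler_wpM2l ?(ltW K0)// (le_trans ue)// ge_min lexx//.
    by rewrite le_eqVlt; apply/orP; left; apply/eqP; field; rewrite gt_eqF.
  have g0 : g 0 = state i c s by rewrite /g mulr0 add0r.
  have gE : g = fun u => state i c (b * u + s) by [].
  clearbody g.
  have inr u : 0 <= u <= eta -> P u -> `|g u - y0| <= r / 2.
    move=> ue [_ h]; have e := etaK _ ue; have sr' := sr; rewrite -g0 in sr'.
    rewrite -(subrKA (g 0)); apply: le_trans (ler_normD _ _) _.
    have -> : r / 2 = r / 4 + r / 4 by field.
    exact: lerD (le_trans h e) (ltW sr').
  have H u : 0 <= u <= eta -> P u.
    apply: (@real_induction _ 0 eta P).
    - by rewrite /P subrr normr0 mulr0 /c' mulr0 add0r.
    - move=> y /andP[y_0 ye] Py; have yy : 0 <= y <= y by rewrite y_0 lexx.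
      have yE : 0 <= y <= eta by rewrite y_0 ltW.
      have [iy hy] := Py y yy; have gy := inr y yE (Py y yy).
      have [e1 e10 he1] := near_dom cc' iy.
      have r4 : 0 < r / 2 by pos.
      have [e2 e20 he2] := is_derive_cont (dg y iy) r4.
      exists (Num.min e1 e2) => [|z /andP[yz ze] zeta]; first by rewrite lt_min e10.
      have btw u' : y <= u' <= z -> chart_dom i (c' u') /\ `|g u' - y0| < r.
        move=> /andP[yu uz]; have : `|u' - y| < Num.min e1 e2.
          by rewrite ger0_norm ?subr_ge0// ltrBlDl (le_lt_trans uz).
        rewrite lt_min => /andP[/he1 h1 /he2 h2]; split=> //.
        rewrite -(subrKA (g y)) (le_lt_trans (ler_normD _ _))// [ltRHS]splitr.
        exact: ltr_leD.
      split; first by apply: (btw z _).1; rewrite (ltW yz) lexx.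
      have -> : K * z = K * (z - y) + K * y by ring.
      rewrite -(subrKA (g y)) (le_trans (ler_normD _ _))// lerD//.
      apply: (mean_value_inequality (f' := fun u => b *: gfield i (g u)) (ltW yz)).
        by move=> u' /btw[h1 _]; exact: dg.
      move=> u' /btw[_ h2]; rewrite normrZ (le_trans _ (Gbound _ h2))//.
      by rewrite -[leRHS]mul1r ler_wpM2r.
    - move=> y /andP[y_0 ye] Py.
      have q0 : 0 < r / 2 <= r3.
        apply/andP; split; first by pos.
        have : r <= r3 by rewrite !ge_min lexx orbT.
        by move: r0; lra.
      (* Just before [y] the curve lies in a closed coordinate ball, which is closed in [M] and so
         contains its position at [y]. *)
      have iy : chart_dom i (c' y).
        pose Z := [set z | chart_dom i z /\ `|chart i z - chart i x| <= r / 2].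
        suff [] : Z (c' y) by [].
        have cZ : closed Z by exact: hr3.
        apply: contrapT => nZ.
        have nb : nbhs (c' y) (~` Z).
          by apply: open_nbhs_nbhs; split=> //; exact: closed_openC.
        have [d d0 hd] := (near_normP _ _).1 (cc' y _ nb).
        pose z := Num.max 0 (y - d / 2).
        have zy : z < y by rewrite gt_max y_0/= ltrBlDr ltrDl; pos.
        have z_0 : 0 <= z by rewrite le_max lexx.
        have zE : 0 <= z <= eta by rewrite z_0 (le_trans (ltW zy)).
        have Pz : P z by apply: Py; rewrite z_0.
        apply: (hd z).
          rewrite distrC ger0_norm ?subr_ge0 ?(ltW zy)// ltrBlDr -ltrBlDl.
          by rewrite lt_max; apply/orP; right; lra.
        split; first exact: Pz.1.
        have := inr _ zE Pz; apply: le_trans.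
        by rewrite gE [leRHS]prod_normE /= le_max lexx.
      split=> //; apply/ler_addgt0Pr => m m0.
      have [d d0 hd] := is_derive_cont (dg y iy) m0.
      pose z := Num.max 0 (y - d / 2).
      have zy : z < y by rewrite gt_max y_0/= ltrBlDr ltrDl; pos.
      have z_0 : 0 <= z by rewrite le_max lexx.
      have Pz : P z by apply: Py; rewrite z_0.
      have zd : `|z - y| < d.
        rewrite distrC ger0_norm ?subr_ge0 ?(ltW zy)// ltrBlDr -ltrBlDl.
        by rewrite lt_max; apply/orP; right; lra.
      have h1 := hd _ zd; have h2 := Pz.2.
      rewrite -(subrKA (g z)) addrC; apply: le_trans (ler_normD _ _) _; apply: lerD.
        by apply: (le_trans h2); rewrite ler_wpM2l ?ltW.
      by rewrite distrC ltW.
  have tE : b * `|t - s| + s = t by rewrite /b -numEsg subrK.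
  have te : 0 <= `|t - s| <= eta by rewrite normr_ge0.
  have Pt := H _ te; have := inr _ te Pt; move: Pt.
  by rewrite /P /c' gE tE => -[].
exists (r / 4), r, eta, C; split=> //.
- by pos.
- exact: ltW.
- rewrite -ler_pdivlMl// /eta ge_min; apply/orP; right.
  by rewrite invfM mulrC.
split.
- move=> z zr K' dK h; have zr2 : `|z - y0| < r2.
    have : r <= r2 by rewrite !ge_min lexx !orbT.
    by move: r0 zr; lra.
  have := hr2 z K' zr2 dK h; have := hC2 h.
  rewrite -(subrK (gfield_diff i y0 h) (K' h)) => h1 h2.
  rewrite (le_trans (ler_normD _ _))// /C.
  by have := mulr_ge0 (ltW C10) (normr_ge0 h); move: h1 h2; rewrite subrK; lra.
- move=> c s gc ics sr t ts; have [h1 h2] := stay c s gc ics sr t ts.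
  by split=> //; rewrite (le_lt_trans h2)// ltr_pdivrMr// ltr_pMr// ltr1n.
- move=> c c' s gc gc' ics ic's sr s'r t ts.
  pose f u := state i c u - state i c' u.
  suff : `|f t| <= 2 * `|f s| + 2 * 0 * `|t - s|.
    by rewrite -mulrA mul0r (mulr0 2) addr0.
  apply: (gronwall_half (f' := fun u => gfield i (state i c u) - gfield i (state i c' u))
    (ltW C0) (lexx 0)).
  + apply: (@le_trans _ _ (C * eta)); first by rewrite ler_wpM2l ?(ltW C0).
    rewrite -ler_pdivlMl// /eta ge_min; apply/orP; right.
    by rewrite invfM mulrC.
  + move=> u us; have us' := le_trans us ts.
    by apply: is_deriveB; apply: cgeodesic_state => //;
      [exact: (stay c s gc ics sr u us').1|exact: (stay c' s gc' ic's s'r u us').1].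
  + move=> u us; have us' := le_trans us ts; rewrite addr0.
    have h1 := le_lt_trans (stay c s gc ics sr u us').2 rr1.
    have h2 := le_lt_trans (stay c' s gc' ic's s'r u us').2 rr1.
    apply: (le_trans (hr1 _ _ h1 h2)); exact: ler_wpM2r.
Qed.

End GeodesicFlow.

(** * Geodesics with given initial vector and their dependence on it *)

Section Exponential.
Context {R : realType} {n : nat} (M : riemannianManifold R n).
Local Notation V := 'rV[R]_n.
Implicit Types (i j : chart_idx M) (p x : M) (v w : V) (s t : R) (c : R -> M).

Definition cvel i c t : V := derive1 (chart i \o c) t.

Lemma cvel_trans c i j t : cgeodesic c -> chart_dom i (c t) -> chart_dom j (c t) ->
  cvel j c t = cvel i c t *m 'J (trans i j) (chart i (c t)).
Proof.
move=> [cc hc] it jt; have [d _] := hc _ _ it.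
exact: (derive1_is_derive (curve_trans (cc t) it jt d)).
Qed.

Lemma state_cont c i t (e : R) : cgeodesic c -> chart_dom i (c t) -> 0 < e ->
  exists2 r : R, 0 < r & forall s, `|s - t| < r ->
    chart_dom i (c s) /\ `|state i c s - state i c t| < e.
Proof.
move=> gc it e0; have [r r0 hr] := near_dom gc.1 it.
have [q q0 hq] := is_derive_cont (cgeodesic_state gc it) e0.
exists (Num.min r q) => [|s]; first by rewrite lt_min r0.
by rewrite lt_min => /andP[/hr ? /hq ?].
Qed.

Lemma cgeodesic_unique c c' t0 i : cgeodesic c -> cgeodesic c' -> c t0 = c' t0 ->
  chart_dom i (c t0) -> cvel i c t0 = cvel i c' t0 -> c = c'.
Proof.
move=> gc gc' c0 i0 v0.
pose P t := c t = c' t /\ forall j, chart_dom j (c t) -> cvel j c t = cvel j c' t.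
suff H : forall t, P t by apply/funext => t; exact: (H t).1.
apply: (@locally_constant R P t0).
  split; first exact: c0.
  move=> j j0; rewrite (cvel_trans gc i0 j0) v0 c0; apply/esym.
  by apply: (cvel_trans gc'); rewrite -c0.
move=> {i0 v0 i} x; pose i := chart_at (c x); have ix := chart_at_dom (c x).
have [rho [rho1 [eta [C [rho0 eta0 _ _ [_ stay lip]]]]]] := geodesic_flow (cvel i c x) ix.
have [r r0 hr] := state_cont gc ix rho0.
exists (Num.min r (eta / 2)) => [|s t]; first by rewrite lt_min r0; pos.
rewrite !lt_min => /andP[/hr[is_ sr] s2] /andP[_ t2] [cs vs].
have ts : `|t - s| <= eta.
  rewrite -(subrKA x) (le_trans (ler_normD _ _))// (distrC x).
  by rewrite [eta]splitr lerD// ltW.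
have is' : chart_dom i (c' s) by rewrite -cs.
have st : state i c s = state i c' s by rewrite /state cs -/(cvel i c s) vs.
have sr' : `|state i c' s - (chart i (c x), cvel i c x)| < rho by rewrite -st.
have := lip c c' s gc gc' is_ is' sr sr' t ts.
rewrite st subrr normr0 mulr0 normr_le0 subr_eq0 => /eqP[e1 e2].
have [it _] := stay c s gc is_ sr t ts; have [it' _] := stay c' s gc' is' sr' t ts.
have ct : c t = c' t by rewrite -(chart_invK it) e1 chart_invK.
have e2' : cvel i c t = cvel i c' t := e2.
split; first exact: ct.
move=> j jt; rewrite (cvel_trans gc it jt) e2' ct; apply/esym.
by apply: (cvel_trans gc' it'); rewrite -ct.
Qed.

Definition gam_spec p v c : Prop :=
  [/\ cgeodesic c, c 0 = p & cvel (chart_at p) c 0 = v].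

(** The curve t -> exp_p(t v) for every [v], zero included; by uniqueness of geodesics the choice is
    forced as soon as such a curve exists. *)
Definition gam p v : R -> M := xget (cst p) [set c | gam_spec p v c].

Lemma gam_uniq p v c c' : gam_spec p v c -> gam_spec p v c' -> c = c'.
Proof.
move=> [gc c0 v0] [gc' c'0 v'0].
apply: (cgeodesic_unique (t0 := 0) (i := chart_at p) gc gc').
- by rewrite c0 c'0.
- by rewrite c0; exact: chart_at_dom.
- by rewrite v0 v'0.
Qed.

Lemma gam_eq p v c : gam_spec p v c -> gam p v = c.
Proof.
move=> h; refine (gam_uniq (p := p) (v := v) _ h).
exact: (xgetPex (cst p) (ex_intro _ c h)).
Qed.

Lemma tnorm_ge0 p v : 0 <= tnorm p v. Proof. exact: sqrtr_ge0. Qed.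

Lemma inner_ge0 p v : 0 <= inner p v v.
Proof. exact: (ginner_ge0 _ (chart_at_dom p)). Qed.

Lemma tnorm_sqr p v : tnorm p v ^+ 2 = inner p v v.
Proof. by rewrite sqr_sqrtr// inner_ge0. Qed.

Lemma tnorm_gt0 p v : v != 0 -> 0 < tnorm p v.
Proof. by move=> v0; rewrite sqrtr_gt0 (ginner_gt0 (chart_at_dom p)). Qed.

Lemma innerZl p (a : R) v w : inner p (a *: v) w = a * inner p v w.
Proof. by rewrite -!ginner_inner -[a *: v]addr0 ginner_linl ginner0l addr0. Qed.

Lemma innerC p v w : inner p v w = inner p w v.
Proof. exact: (ginnerC _ _ (chart_at_dom p)). Qed.

Lemma innerDl p u v w : inner p (u + v) w = inner p u w + inner p v w.
Proof. by rewrite -!ginner_inner -{1}[u]scale1r ginner_linl mul1r. Qed.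

Lemma tnormZ p (a : R) v : tnorm p (a *: v) = `|a| * tnorm p v.
Proof.
by rewrite /tnorm innerZl innerC innerZl mulrA -expr2 sqrtrM ?sqr_ge0// sqrtr_sqr.
Qed.

Hypothesis complete : complete_manifold M.

Lemma gamP p v : gam_spec p v (gam p v).
Proof.
suff [c hc] : exists c, gam_spec p v c by rewrite (gam_eq hc).
have [->|v0] := eqVneq v 0.
  exists (fun=> p); split=> //; first exact: cgeodesic_cst.
  by apply: derive1_is_derive; exact: is_derive_cst.
have l0 := tnorm_gt0 p v0; set l := tnorm p v in l0.
have u1 : tnorm p (l^-1 *: v) = 1.
  by rewrite tnormZ ger0_norm ?invr_ge0 ?(ltW l0)// mulVf// gt_eqF.
have [c [gc c0 vc]] := complete u1.
have gc' := is_geodesic_cgeodesic gc.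
exists (fun t => c (l * t + 0)); split; first exact: cgeodesic_affine.
  by rewrite mulr0 addr0.
have [d _] := gc'.2 (chart_at p) (l * 0 + 0) (ltac:(rewrite mulr0 addr0 c0; exact: chart_at_dom)).
rewrite /cvel (derive1_is_derive (is_derive_affine d)) mulr0 addr0.
by move: vc; rewrite /velocity c0 => ->; rewrite scalerA mulfV ?gt_eqF// scale1r.
Qed.

Lemma gam_cgeodesic p v : cgeodesic (gam p v). Proof. by have [] := gamP p v. Qed.

Lemma gam0 p v : gam p v 0 = p. Proof. by have [] := gamP p v. Qed.

Lemma gam_cvel p v : cvel (chart_at p) (gam p v) 0 = v. Proof. by have [] := gamP p v. Qed.

Lemma gamZ p (a : R) v t : gam p (a *: v) t = gam p v (a * t).
Proof.
suff -> : gam p (a *: v) = fun t => gam p v (a * t + 0) by rewrite addr0.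
have [gc c0 cv] := gamP p v.
apply: gam_eq; split; first exact: cgeodesic_affine.
  by rewrite mulr0 addr0.
have [d _] := gc.2 (chart_at p) (a * 0 + 0) (ltac:(rewrite mulr0 addr0 c0; exact: chart_at_dom)).
by rewrite /cvel (derive1_is_derive (is_derive_affine d)) mulr0 addr0 -/(cvel _ _ _) cv.
Qed.

Lemma geodesic_gam c : is_geodesic c -> c = gam (c 0) (velocity c 0).
Proof. by move=> gc; apply/esym/gam_eq; split; [exact: is_geodesic_cgeodesic|done|done]. Qed.

Lemma gam_geodesic p v : tnorm p v = 1 -> is_geodesic (gam p v).
Proof.
move=> v1; have [c [gc c0 vc]] := complete v1.
suff -> : gam p v = c by [].
apply: gam_eq; split; [exact: is_geodesic_cgeodesic|exact: c0|].
by rewrite -vc /velocity c0.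
Qed.

Lemma geodesic_speed c i t : is_geodesic c -> chart_dom i (c t) ->
  ginner i (c t) (cvel i c t) (cvel i c t) = 1.
Proof.
move=> gc it; have gc' := is_geodesic_cgeodesic gc.
have it' := chart_at_dom (c t); have [_ /(_ t) h _] := gc.
rewrite (ginner_trans _ _ it it') -(cvel_trans gc' it it').
by rewrite ginner_inner -tnorm_sqr h expr1n.
Qed.

(** Conservation of speed is read off [is_geodesic], which includes unit speed, after rescaling a
    non-zero [v] to a unit vector. *)
Lemma gam_speed p v i t : chart_dom i (gam p v t) ->
  ginner i (gam p v t) (cvel i (gam p v) t) (cvel i (gam p v) t) = inner p v v.
Proof.
have [->|v0] := eqVneq v 0.
  have E : gam p 0 = fun=> p.
    apply: gam_eq; split=> //; first exact: cgeodesic_cst.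
    by apply: derive1_is_derive; exact: is_derive_cst.
  rewrite E => ip; have -> : cvel i (fun=> p) t = 0.
    by apply: derive1_is_derive; exact: is_derive_cst.
  by rewrite -ginner_inner !ginner0l.
have l0 := tnorm_gt0 p v0; set l := tnorm p v in l0.
pose u := l^-1 *: v; have vE : v = l *: u by rewrite scalerA mulfV ?gt_eqF// scale1r.
have u1 : tnorm p u = 1.
  by rewrite tnormZ ger0_norm ?invr_ge0 ?(ltW l0)// mulVf// gt_eqF.
have E : gam p v = fun t => gam p u (l * t + 0).
  by apply/funext => s; rewrite vE gamZ addr0.
rewrite E => it; have [d _] := (gam_cgeodesic p u).2 i _ it.
have -> : cvel i (fun t => gam p u (l * t + 0)) t = l *: cvel i (gam p u) (l * t + 0).
  exact: (derive1_is_derive (is_derive_affine d)).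
rewrite -[X in ginner _ _ X _]addr0 ginner_linl ginner0l addr0.
rewrite ginnerC// -[X in ginner _ _ X _]addr0 ginner_linl ginner0l addr0.
rewrite (geodesic_speed (gam_geodesic u1) it) mulr1 -expr2.
by rewrite -tnorm_sqr.
Qed.

(** The passage through one flow box of duration [eta]. The margin [rho / 2] leaves room for the
    geodesics of vectors near [v0] to be in the box as well. *)
Lemma gam_variation p v0 i s : chart_dom i (gam p v0 s) ->
  forall x w rho rho1 (eta C : R), chart_dom i x -> 
  [/\ 0 < rho, 0 < eta, 0 <= C, C * eta <= 2^-1 &
  [/\ forall z, `|z - (chart i x, w)| < rho1 -> forall K, sdiff (gfield (M := M) i) z K ->
        forall h, `|K h| <= C * `|h|,
      forall c s, cgeodesic c -> chart_dom i (c s) ->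
        `|state i c s - (chart i x, w)| < rho -> forall t, `|t - s| <= eta ->
        chart_dom i (c t) /\ `|state i c t - (chart i x, w)| < rho1
    & forall c c' s, cgeodesic c -> cgeodesic c' -> chart_dom i (c s) ->
        chart_dom i (c' s) -> `|state i c s - (chart i x, w)| < rho ->
        `|state i c' s - (chart i x, w)| < rho -> forall t, `|t - s| <= eta ->
        `|state i c t - state i c' t| <= 2 * `|state i c s - state i c' s| ]] ->
  `|state i (gam p v0) s - (chart i x, w)| < rho / 2 ->
  forall Ls, sdiff (fun v => state i (gam p v) s) v0 Ls ->
  (\forall v \near v0, chart_dom i (gam p v s)) ->
  exists L : R -> V -> V * V,
    L s =1 Ls /\ forall t, `|t - s| < eta ->
      [/\ chart_dom i (gam p v0 t), \forall v \near v0, chart_dom i (gam p v t),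
          sdiff (fun v => state i (gam p v) t) v0 (L t) &
          forall h, is_derive t 1 (L ^~ h) (gfield_diff i (state i (gam p v0) t) (L t h))].
Proof.
move=> is0 x w rho rho1 eta C ix [rho0 eta0 C0 Ceta [AK stay lip]] sr Ls dLs near0.
have r2 : 0 < rho / 2 by pos.
have [d1 d10 hd1] := sdiff_cont dLs r2; have [d2 d20 hd2] := (near_normP _ _).1 near0.
pose delta := Num.min d1 d2; have delta0 : 0 < delta by rewrite lt_min d10.
have good v : `|v - v0| < delta -> chart_dom i (gam p v s) /\
    `|state i (gam p v) s - (chart i x, w)| < rho.
  rewrite lt_min => /andP[/hd1 h1 /hd2 h2]; split=> //.
  rewrite -(subrKA (state i (gam p v0) s)) (le_lt_trans (ler_normD _ _))//.
  by rewrite [rho]splitr ltrD.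
have v00 : `|v0 - v0| < delta by rewrite subrr normr0.
have gs v t : `|v - v0| < delta -> `|t - s| < eta -> chart_dom i (gam p v t) /\
    `|state i (gam p v) t - (chart i x, w)| < rho1.
  move=> vd ts; have [h1 h2] := good v vd.
  exact: (stay _ s (gam_cgeodesic p v) h1 h2 t (ltW ts)).
have [L [Ls0 dL deL]] := @variational R V (V * V)%type (@complete_state R n)
  (gfield i) (fun v => state i (gam p v)) v0
  (fun t => gfield_diff i (state i (gam p v0) t)) Ls s eta C delta C0 Ceta delta0 eta0
  (fun r hr => gfield_sdiff _ (gs v0 r v00 hr).1)
  (fun r h hr => AK _ (gs v0 r v00 hr).2 _ (gfield_sdiff _ (gs v0 r v00 hr).1) h)
  (fun v r hv hr => cgeodesic_state (gam_cgeodesic p v) (gs v r hv hr).1)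
  (fun v v' r hv hv' hr => lip _ _ s (gam_cgeodesic p v) (gam_cgeodesic p v')
     (good v hv).1 (good v' hv').1 (good v hv).2 (good v' hv').2 r (ltW hr)) dLs.
exists L; split=> // t ts; split; [exact: (gs v0 t v00 ts).1| |exact: dL|by move=> h; exact: deL].
apply/near_normP; exists delta => // v vd; exact: (gs v t vd ts).1.
Qed.

Lemma state_trans c i j t : cgeodesic c -> chart_dom i (c t) -> chart_dom j (c t) ->
  state j c t = (trans i j (state i c t).1, (state i c t).2 *m 'J (trans i j) (state i c t).1).
Proof.
by move=> gc it jt; rewrite /state /= trans_chart// -/(cvel j c t) (cvel_trans gc it jt).
Qed.

Lemma gam_sdiff_trans p v0 i j t : chart_dom i (gam p v0 t) -> chart_dom j (gam p v0 t) ->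
  (exists L, sdiff (fun v => state i (gam p v) t) v0 L) ->
  (\forall v \near v0, chart_dom i (gam p v t)) ->
  (exists L, sdiff (fun v => state j (gam p v) t) v0 L) /\
  (\forall v \near v0, chart_dom j (gam p v t)).
Proof.
move=> it jt [L dL] near0.
have nj : \forall v \near v0, chart_dom j (gam p v t).
  have := near_chart_img it (nbhs_dom jt).
  have cf := sdiff_continuous (sdiff_comp dL (sdiff_fst _)).
  move=> /cf; apply: filterS2 near0 => v iv /= [_ [jv _]].
  by rewrite chart_invK in jv.
split=> //.
have [L2 dL2] := trans_jac_sdiff (cvel i (gam p v0) t) it jt.
have dL1 := sdiff_comp (sdiff_fst (state i (gam p v0) t)) (trans_sdiff it jt).
eexists; apply: sdiff_near (sdiff_comp dL (sdiff_pair dL1 dL2)) _.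
by apply: filterS2 near0 nj => v iv jv; rewrite (state_trans (gam_cgeodesic _ _) iv jv).
Qed.

(** At time 0 the state is affine in [v]; the flow boxes carry strict differentiability from there
    along the whole geodesic. *)
Lemma gam_sdiff p v0 t i : chart_dom i (gam p v0 t) ->
  (exists L, sdiff (fun v => state i (gam p v) t) v0 L) /\
  (\forall v \near v0, chart_dom i (gam p v t)).
Proof.
move: t i.
pose P t := forall i, chart_dom i (gam p v0 t) ->
  (exists L, sdiff (fun v => state i (gam p v) t) v0 L) /\
  (\forall v \near v0, chart_dom i (gam p v t)).
apply: (@locally_constant R P 0).
  move=> i; rewrite gam0 => ip; split; last first.
    by apply/near_normP; exists 1 => // v _; rewrite gam0.
  pose K := 'J (trans (chart_at p) i) (chart (chart_at p) p).
  have -> : (fun v => state i (gam p v) 0) = fun v => (chart i p, v *m K).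
    apply/funext => v; rewrite /state gam0; congr pair.
    rewrite -/(cvel i _ 0) (cvel_trans (gam_cgeodesic p v) (i := chart_at p) (j := i)) ?gam0//.
      by rewrite gam_cvel.
    exact: chart_at_dom.
  eexists; apply: sdiff_pair; first exact: sdiff_cst.
  exact: sdiff_lin (blin_mulmx K).
move=> t0; pose i := chart_at (gam p v0 t0); have i0 := chart_at_dom (gam p v0 t0).
have [rho [rho1 [eta [C H]]]] := geodesic_flow (cvel i (gam p v0) t0) i0.
have [rho0 eta0 _ _ _] := H; have r2 : 0 < rho / 2 by pos.
have [r r0 hr] := state_cont (gam_cgeodesic p v0) i0 r2.
exists (Num.min r (eta / 2)) => [|s t]; first by rewrite lt_min r0; pos.
rewrite !lt_min => /andP[/hr[is_ sr] s2] /andP[_ t2] Ps j jt.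
have ts : `|t - s| < eta.
  rewrite -(subrKA t0) (le_lt_trans (ler_normD _ _))// (distrC t0).
  by rewrite [eta]splitr ltrD.
have [[Ls dLs] near0] := Ps i is_.
have [L [_ hL]] := gam_variation is_ i0 H sr dLs near0.
have [it nt dL _] := hL t ts.
by apply: (gam_sdiff_trans it jt) => //; exists (L t).
Qed.

Lemma gam_jacobi_local p v0 t0 i : chart_dom i (gam p v0 t0) ->
  exists2 e : R, 0 < e & exists L : R -> V -> V * V, forall t, `|t - t0| < e ->
    [/\ chart_dom i (gam p v0 t),
        sdiff (fun v => state i (gam p v) t) v0 (L t) &
        forall h, is_derive t 1 (L ^~ h) (gfield_diff i (state i (gam p v0) t) (L t h))].
Proof.
move=> i0; have [rho [rho1 [eta [C H]]]] := geodesic_flow (cvel i (gam p v0) t0) i0.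
have [rho0 eta0 _ _ _] := H.
have sr : `|state i (gam p v0) t0 - (chart i (gam p v0 t0), cvel i (gam p v0) t0)| < rho / 2.
  by rewrite subrr normr0; pos.
have [[Ls dLs] near0] := gam_sdiff i0.
have [L [_ hL]] := gam_variation i0 i0 H sr dLs near0.
by exists eta => //; exists L => t /hL[h1 _ h2 h3].
Qed.

End Exponential.

(** * Jacobi fields and the Gauss lemma *)

Section Forms.
Context {R : realType} {n : nat}.
Local Notation V := 'rV[R]_n.
Implicit Types (c : V -> 'I_n -> 'I_n -> R) (y u v w x : V).

(** A bilinear form with variable coefficients. It covers the metric as well as each component of
    the Christoffel symbols, so that one product rule serves for both. *)
Definition form c y u v : R := \sum_a \sum_b c y a b * u 0 a * v 0 b.

Definition dform c y x u v : R :=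
  \sum_a \sum_b (\sum_m x 0 m * partial m (fun z => c z a b) y) * u 0 a * v 0 b.

Lemma form_sdiff c y u v : (forall a b, sdf (fun z => c z a b) y) ->
  sdiff (fun z : V * (V * V) => form c z.1 z.2.1 z.2.2) (y, (u, v))
    (fun h => dform c y h.1 u v + form c y h.2.1 v + form c y u h.2.2).
Proof.
move=> dc; set z0 := (y, (u, v)).
have dc' a b : sdiff (fun z => c z a b) y
    (fun h => \sum_m h 0 m * partial m (fun z => c z a b) y).
  by have [L dL] := dc a b; exact: sdiff_ext dL (sdiff_partial dL).
have d1 a b := sdiff_comp (sdiff_fst z0) (dc' a b).
have d2 (a : 'I_n) := sdiff_comp (sdiff_comp (sdiff_snd z0) (sdiff_fst z0.2))
  (sdiff_lin _ (blin_coord a)).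
have d3 (a : 'I_n) := sdiff_comp (sdiff_comp (sdiff_snd z0) (sdiff_snd z0.2))
  (sdiff_lin _ (blin_coord a)).
have dd := sdiff_sum (index_enum 'I_n) (fun a =>
  sdiff_sum (index_enum 'I_n) (fun b => sdiffM (sdiffM (d1 a b) (d2 a)) (d3 b))).
apply: sdiff_ext dd _ => h; rewrite /dform /form -!big_split; apply: eq_bigr => a _ /=.
by rewrite -!big_split; apply: eq_bigr => b _ /=; ring.
Qed.

Lemma form_linr c y (a : R) u v v' : form c y u (a *: v + v') = a * form c y u v + form c y u v'.
Proof.
rewrite /form mulr_sumr -big_split; apply: eq_bigr => i _ /=.
by rewrite mulr_sumr -big_split; apply: eq_bigr => j _ /=; rewrite !mxE; ring.
Qed.

Lemma formDr c y u v v' : form c y u (v + v') = form c y u v + form c y u v'.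
Proof. by rewrite -[v]scale1r form_linr mul1r scale1r. Qed.

Lemma formNr c y u v : form c y u (- v) = - form c y u v.
Proof.
have E : form c y u 0 = 0.
  by rewrite /form big1// => a _; rewrite big1// => b _; rewrite mxE mulr0.
by rewrite -scaleN1r -[_ *: _]addr0 form_linr E addr0 mulN1r.
Qed.

Lemma form_sym c y u v : (forall a b, c y a b = c y b a) -> form c y u v = form c y v u.
Proof.
move=> cs; rewrite /form exchange_big; apply: eq_bigr => a _; apply: eq_bigr => b _.
by rewrite cs; ring.
Qed.

Lemma dform_sym c y x u v :
  (forall a b, \forall z \near y, c z a b = c z b a) -> dform c y x u v = dform c y x v u.
Proof.
move=> cs; rewrite /dform exchange_big; apply: eq_bigr => a _; apply: eq_bigr => b _.
rewrite -!mulrA (mulrC (u _ _)); congr (_ * _); apply: eq_bigr => m _; congr (_ * _).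
exact: near_eq_derive.
Qed.

Lemma dform0 c y u v : dform c y 0 u v = 0.
Proof.
rewrite /dform big1// => a _; rewrite big1// => b _.
by rewrite big1 ?mul0r// => m _; rewrite mxE mul0r.
Qed.

End Forms.

Section CurvatureForms.
Context {R : realType} {n : nat} (M : riemannianManifold R n).
Local Notation V := 'rV[R]_n.
Implicit Types (i j : chart_idx M) (x : M) (u v w : V).

Local Notation chr i k := (fun y => christoffel (metric i) y k).

Lemma ginner_form i x u v : ginner i x u v = form (fun y a b => metric i y a b) (chart i x) u v.
Proof.
rewrite /ginner /form mxE exchange_big; apply: eq_bigr => b _.
by rewrite !mxE mulr_suml; apply: eq_bigr => a _; rewrite (mulrC (u _ _)).
Qed.

Lemma metric_sym_near i x a b : chart_dom i x ->
  \forall z \near chart i x, metric i z a b = metric i z b a.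
Proof.
move=> ix; have := near_chart_domain ix; apply: filterS => _ [x' ix' <-].
by rewrite -[in LHS]Defs.metric_sym// mxE.
Qed.

Lemma christoffel_sym_near i x k a b : chart_dom i x ->
  \forall z \near chart i x, chr i k z a b = chr i k z b a.
Proof.
move=> ix; have := near_chart_domain ix; apply: filterS => _ [x' ix' <-].
exact: christoffel_sym.
Qed.

(** In terms of [form] and [dform] the coordinate sums disappear, and the Jacobi equation becomes a
    cancellation between a few symbols. *)
Lemma curvature_form i x X Y Z k : chart_dom i x ->
  curvature (metric i) (chart i x) X Y Z 0 k =
  dform (chr i k) (chart i x) X Y Z - dform (chr i k) (chart i x) Y X Z
  + form (chr i k) (chart i x) X (christoffel_form (metric i) (chart i x) Y Z)
  - form (chr i k) (chart i x) Y (christoffel_form (metric i) (chart i x) X Z).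
Proof.
move=> ix; set y := chart i x; rewrite /curvature mxE.
have T1 : dform (chr i k) y X Y Z = \sum_a \sum_b \sum_c
    partial a (fun z => christoffel (metric i) z k b c) y * X 0 a * Y 0 b * Z 0 c.
  rewrite [RHS]exchange_big; apply: eq_bigr => b _.
  rewrite [RHS]exchange_big; apply: eq_bigr => c _.
  by rewrite !mulr_suml; apply: eq_bigr => a _; ring.
have T2 : dform (chr i k) y Y X Z = \sum_a \sum_b \sum_c
    partial b (fun z => christoffel (metric i) z k a c) y * X 0 a * Y 0 b * Z 0 c.
  apply: eq_bigr => a _; rewrite [RHS]exchange_big; apply: eq_bigr => c _.
  by rewrite !mulr_suml; apply: eq_bigr => b _; ring.
have T3 : form (chr i k) y X (christoffel_form (metric i) y Y Z) =
    \sum_a \sum_b \sum_c (\sum_m christoffel (metric i) y k a m * christoffel (metric i) y m b c)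
      * X 0 a * Y 0 b * Z 0 c.
  apply: eq_bigr => a _; under [LHS]eq_bigr do rewrite mxE mulr_sumr.
  rewrite [LHS]exchange_big; apply: eq_bigr => b _ /=.
  under [LHS]eq_bigr do rewrite mulr_sumr.
  rewrite [LHS]exchange_big; apply: eq_bigr => c _ /=.
  by rewrite !mulr_suml; apply: eq_bigr => m _; ring.
have T4 : form (chr i k) y Y (christoffel_form (metric i) y X Z) =
    \sum_a \sum_b \sum_c (\sum_m christoffel (metric i) y k b m * christoffel (metric i) y m a c)
      * X 0 a * Y 0 b * Z 0 c.
  rewrite [RHS]exchange_big; apply: eq_bigr => b _.
  under [LHS]eq_bigr do rewrite mxE mulr_sumr.
  rewrite [LHS]exchange_big; apply: eq_bigr => a _ /=.
  under [LHS]eq_bigr do rewrite mulr_sumr.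
  rewrite [LHS]exchange_big; apply: eq_bigr => c _ /=.
  by rewrite !mulr_suml; apply: eq_bigr => m _; ring.
rewrite T1 T2 T3 T4 -!sumrB -!big_split -sumrB; apply: eq_bigr => a _ /=.
rewrite -!sumrB -!big_split -sumrB; apply: eq_bigr => b _ /=.
rewrite -!sumrB -!big_split -sumrB; apply: eq_bigr => c _ /=.
have H (p1 p2 s1 s2 x1 x2 x3 : R) : (p1 - p2 + (s1 - s2)) * x1 * x2 * x3 =
    p1 * x1 * x2 * x3 - p2 * x1 * x2 * x3 + s1 * x1 * x2 * x3 - s2 * x1 * x2 * x3 by ring.
by rewrite /riemann_coef sumrB; exact: H.
Qed.

(** Lowering the index cancels the inverse metric in the Christoffel symbols. Of the three remaining
    terms two coincide, because both arguments are [w]. *)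
Lemma koszul i x J w : chart_dom i x ->
  ginner i x J (christoffel_form (metric i) (chart i x) w w) =
  dform (fun y a b => metric i y a b) (chart i x) w w J
  - 2^-1 * dform (fun y a b => metric i y a b) (chart i x) J w w.
Proof.
move=> ix; set y := chart i x; set g := metric i.
have low a c d : \sum_k g y a k * christoffel g y k c d =
   2^-1 * (partial c (fun z => g z d a) y + partial d (fun z => g z c a) y
           - partial a (fun z => g z c d) y).
  have -> : \sum_k g y a k * christoffel g y k c d =
      2^-1 * \sum_l (g y *m invmx (g y)) a l * (partial c (fun z => g z d l) y +
      partial d (fun z => g z c l) y - partial l (fun z => g z c d) y).
    rewrite mulr_sumr /christoffel.
    under [LHS]eq_bigr do rewrite mulrCA mulr_sumr mulr_sumr.
    rewrite [LHS]exchange_big; apply: eq_bigr => l _ /=.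
    rewrite -mulr_sumr; congr (_ * _); rewrite mxE mulr_suml.
    by apply: eq_bigr => k _; rewrite mulrA.
  congr (_ * _); rewrite (mulmxV (metric_unit ix)) (bigD1 a)//= big1 => [|l la].
    by rewrite mxE eqxx mul1r addr0.
  by rewrite mxE eq_sym (negPf la) mul0r.
have -> : ginner i x J (christoffel_form g y w w) =
    \sum_a \sum_c \sum_d J 0 a * w 0 c * w 0 d * \sum_k g y a k * christoffel g y k c d.
  rewrite ginner_form; apply: eq_bigr => a _.
  under [LHS]eq_bigr do rewrite mxE mulr_sumr.
  rewrite [LHS]exchange_big; apply: eq_bigr => c _ /=.
  under [LHS]eq_bigr do rewrite mulr_sumr.
  rewrite [LHS]exchange_big; apply: eq_bigr => d _ /=.
  by rewrite mulr_sumr; apply: eq_bigr => k _; rewrite -/y -/g; ring.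
have E1 : dform (fun y a b => metric i y a b) y w w J =
    \sum_a \sum_c \sum_d J 0 a * w 0 c * w 0 d * partial c (fun z => g z d a) y.
  rewrite /dform exchange_big; apply: eq_bigr => a _.
  rewrite [RHS]exchange_big; apply: eq_bigr => d _ /=.
  by rewrite !mulr_suml; apply: eq_bigr => c _; rewrite -/g; ring.
have E1' : dform (fun y a b => metric i y a b) y w w J =
    \sum_a \sum_c \sum_d J 0 a * w 0 c * w 0 d * partial d (fun z => g z c a) y.
  rewrite /dform exchange_big; apply: eq_bigr => a _; apply: eq_bigr => c _ /=.
  by rewrite !mulr_suml; apply: eq_bigr => d _; rewrite -/g; ring.
have E2 : dform (fun y a b => metric i y a b) y J w w =
    \sum_a \sum_c \sum_d J 0 a * w 0 c * w 0 d * partial a (fun z => g z c d) y.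
  rewrite [RHS]exchange_big; apply: eq_bigr => c _.
  rewrite [RHS]exchange_big; apply: eq_bigr => d _ /=.
  by rewrite !mulr_suml; apply: eq_bigr => a _; rewrite -/g; ring.
have -> : dform (fun y a b => metric i y a b) y w w J -
    2^-1 * dform (fun y a b => metric i y a b) y J w w =
    2^-1 * (dform (fun y a b => metric i y a b) y w w J +
      dform (fun y a b => metric i y a b) y w w J -
      dform (fun y a b => metric i y a b) y J w w) by field.
rewrite {1}E1 E1' E2 -big_split -sumrB mulr_sumr; apply: eq_bigr => a _ /=.
rewrite -big_split -sumrB mulr_sumr; apply: eq_bigr => c _ /=.
rewrite -big_split -sumrB mulr_sumr; apply: eq_bigr => d _ /=.
by rewrite low; ring.
Qed.

Lemma gfield_diffE i x w h k : chart_dom i x ->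
  (gfield_diff i (chart i x, w) h).2 0 k =
  - (dform (chr i k) (chart i x) h.1 w w + form (chr i k) (chart i x) h.2 w
     + form (chr i k) (chart i x) w h.2).
Proof.
move=> ix; rewrite /gfield_diff /dform /form /= !mxE; congr (- _).
rewrite -!big_split; apply: eq_bigr => a _ /=; rewrite -!big_split; apply: eq_bigr => b _ /=.
by ring.
Qed.

Lemma christoffel_formE i y u v k :
  christoffel_form (metric i) y u v 0 k = form (chr i k) y u v.
Proof. by rewrite mxE. Qed.

Lemma is_derive_form (c : V -> 'I_n -> 'I_n -> R) (y u v : R -> V) (t : R) dy du dv :
  (forall a b, sdf (fun z => c z a b) (y t)) ->
  is_derive t 1 y dy -> is_derive t 1 u du -> is_derive t 1 v dv ->
  is_derive t 1 (fun s => form c (y s) (u s) (v s))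
    (dform c (y t) dy (u t) (v t) + form c (y t) du (v t) + form c (y t) (u t) dv).
Proof.
move=> dc hy hu hv.
exact: (is_derive_sdiff (is_derive_pair hy (is_derive_pair hu hv)) (form_sdiff (u t) (v t) dc)).
Qed.

End CurvatureForms.

Lemma half_sum (R : realType) (x a b c : R) :
  x + x = a + b + b -> x = c + b - (c - 2^-1 * a).
Proof. by move=> h; lra. Qed.

Lemma jacobi_cancel (R : realType) (a b c d e : R) :
  - (a + c + c) + (b - d + c) + (c + e) + (a - b + d - e) = 0.
Proof. by ring. Qed.

Section JacobiFields.
Context {R : realType} {n : nat} (M : riemannianManifold R n).
Local Notation V := 'rV[R]_n.
Implicit Types (i j : chart_idx M) (p x : M) (u v w h : V) (s t : R) (c : R -> M).
Hypothesis complete : complete_manifold M.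

(** The variation field of the geodesics with initial vectors v0 + s h, read in the chart [i]: the
    Jacobi field that vanishes at 0 with derivative [h]. *)
Definition jfield p v0 h i t : V := 'D_h (fun v => chart i (gam (M := M) p v t)) v0.

Lemma gam_chart_sdiff p v0 i t : chart_dom i (gam p v0 t) ->
  sdiff (fun v => chart i (gam p v t)) v0 (fun h => jfield p v0 h i t).
Proof.
move=> it; have [[L dL] _] := gam_sdiff complete it.
have d1 := sdiff_comp dL (sdiff_fst _).
refine (sdiff_ext d1 _) => h; by have [_ <-] := sdiff_is_derive h d1.
Qed.

Lemma jfield_local p v0 i t0 : chart_dom i (gam p v0 t0) ->
  exists2 e : R, 0 < e & forall t, `|t - t0| < e -> chart_dom i (gam p v0 t) /\
    sdiff (fun v => state i (gam p v) t) v0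
      (fun h => (jfield p v0 h i t, derive1 (jfield p v0 h i) t)) /\ forall h,
    [/\ is_derive t 1 (jfield p v0 h i) (derive1 (jfield p v0 h i) t) &
       is_derive t 1 (derive1 (jfield p v0 h i))
         (gfield_diff i (state i (gam p v0) t) (jfield p v0 h i t, derive1 (jfield p v0 h i) t)).2].
Proof.
move=> i0; have [e e0 [L hL]] := gam_jacobi_local complete i0.
exists e; first exact: e0.
move=> t te; have [it dL deL] := hL t te.
have jE s h : `|s - t0| < e -> (L s h).1 = jfield p v0 h i s.
  move=> se; have [is_ dLs _] := hL s se.
  by have [_ <-] := sdiff_is_derive h (sdiff_comp dLs (sdiff_fst _)).
have near_ s : `|s - t0| < e -> \forall r \near s, `|r - t0| < e.
  move=> se; apply/near_normP; exists (e - `|s - t0|); first by rewrite subr_gt0.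
  move=> r rs; rewrite -(subrKA s) (le_lt_trans (ler_normD _ _))//.
  by rewrite -ltrBrDr.
have dJ s h : `|s - t0| < e -> is_derive s 1 (jfield p v0 h i) (L s h).2.
  move=> se; have [_ _ /(_ h) d] := hL s se.
  have := is_derive_fst d; rewrite /gfield_diff /=; apply: is_derive_near.
  by have := near_ s se; apply: filterS => r /jE.
have kE s h : `|s - t0| < e -> (L s h).2 = derive1 (jfield p v0 h i) s.
  by move=> se; rewrite (derive1_is_derive (dJ s h se)).
have LE s h : `|s - t0| < e -> L s h = (jfield p v0 h i s, derive1 (jfield p v0 h i) s).
  by move=> se; rewrite -kE// -jE//; case: (L s h).
split; first exact: it.
split; first by refine (sdiff_ext dL _) => h; exact: LE.
move=> h; split; first by rewrite -kE//; exact: dJ.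
rewrite -(LE t h te); have d := is_derive_snd (deL h); refine (is_derive_near _ d).
by apply: filterS (near_ t te) => r; exact: kE.
Qed.

Lemma jfield_trans p v0 h i j t : chart_dom i (gam p v0 t) -> chart_dom j (gam p v0 t) ->
  jfield p v0 h j t = jfield p v0 h i t *m 'J (trans i j) (chart i (gam p v0 t)).
Proof.
move=> it jt; have [_ ni] := gam_sdiff complete it.
have d1 := sdiff_comp (gam_chart_sdiff it) (trans_sdiff it jt).
have d2 : sdiff (fun v => chart j (gam p v t)) v0
    (fun h => jfield p v0 h i t *m 'J (trans i j) (chart i (gam p v0 t))).
  by apply: sdiff_near d1 _; apply: filterS ni => v /trans_chart ->.
exact: (sdiff_unique (gam_chart_sdiff jt) d2 h).
Qed.

Lemma jfield0 p v0 h i : jfield p v0 h i 0 = 0.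
Proof.
rewrite /jfield; have -> : (fun v => chart i (gam p v 0)) = fun=> chart i p.
  by apply/funext => v; rewrite gam0.
exact: derive_cst.
Qed.

Lemma derive1_jfield0 p v0 h : derive1 (jfield p v0 h (chart_at p)) 0 = h.
Proof.
have ip : chart_dom (chart_at p) (gam p v0 0) by rewrite gam0//; exact: chart_at_dom.
have [e e0 /(_ 0)] := jfield_local ip; rewrite subrr normr0 => /(_ e0)[_ [dS _]].
have dS2 := sdiff_comp dS (sdiff_snd _).
have E : (fun v => (state (chart_at p) (gam p v) 0).2) = id.
  by apply/funext => v; exact: gam_cvel.
by rewrite E in dS2; exact: (sdiff_unique dS2 (sdiff_id v0) h).
Qed.

Local Notation chr i k := (fun y => christoffel (metric i) y k).

(** The Jacobi equation term by term, with [K] for J': J'' from the linearized spray, the time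
    derivative of the Christoffel term of DJ, the Christoffel term of D(DJ), and the curvature. The
    symmetry of the Christoffel symbols makes them cancel. *)
Lemma jacobi_identity i x (w J K : V) k : chart_dom i x ->
  let y := chart i x in
  (gfield_diff i (y, w) (J, K)).2 0 k +
  (dform (chr i k) y w w J +
   form (chr i k) y (- christoffel_form (metric i) y w w) J + form (chr i k) y w K) +
  form (chr i k) y w (K + christoffel_form (metric i) y w J) +
  curvature (metric i) y J w w 0 k = 0.
Proof.
move=> ix y; rewrite gfield_diffE// curvature_form// -/y.
set c := (fun y => christoffel (metric i) y k).
have T1 : dform c y w J w = dform c y w w J.
  by apply: dform_sym => a b; exact: christoffel_sym_near.
have T2 a b : form c y a b = form c y b a.
  by apply: form_sym => l m; exact: christoffel_sym.
have T4 : christoffel_form (metric i) y J w = christoffel_form (metric i) y w J.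
  apply/rowP => l; rewrite !christoffel_formE; apply: form_sym => a b.
  exact: christoffel_sym.
rewrite T1 T4 formDr (T2 K w) (T2 _ J) formNr /=.
move: (form c y w K) (form c y w _) (form c y J _) (dform c y w w J) (dform c y J w w).
by move=> c' e d b a; exact: jacobi_cancel.
Qed.

Lemma jfield_is_jacobi p v0 h : is_jacobi (gam (M := M) p v0) (jfield p v0 h).
Proof.
split=> [i j t it jt|i t0 i0]; first exact: jfield_trans.
set J := jfield p v0 h i; set u := chart i \o gam p v0.
have gc := gam_cgeodesic complete p v0.
have [e e0 He] := jfield_local i0.
have near_ : \forall r \near t0, `|r - t0| < e by apply/near_normP; exists e.
have t00 : `|t0 - t0| < e by rewrite subrr normr0.
have [_ [_ /(_ h)[dJ dK]]] := He t0 t00; rewrite -/J in dJ dK.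
have [du dw] := gc.2 _ _ i0; rewrite -/u in du dw.
set y := chart i (gam p v0 t0) in dw dK; set w := derive1 u t0 in du dw dK.
set K := derive1 J t0 in dJ dK.
pose B := christoffel_form (metric i) y.
pose D := \row_k (dform (chr i k) y w w (J t0) + form (chr i k) y (- B w w) (J t0)
   + form (chr i k) y w K).
have dB : is_derive t0 1 (fun s => christoffel_form (metric i) (u s) (derive1 u s) (J s)) D.
  have H k : is_derive t0 1 (fun s => form (chr i k) (u s) (derive1 u s) (J s)) (D 0 k).
    rewrite mxE; apply: (is_derive_form _ du dw dJ).
    by move=> a b; exact: christoffel_sdf.
  have dF : derivable (fun s => christoffel_form (metric i) (u s) (derive1 u s) (J s)) t0 1.
    apply/derivable_mxP => r k; rewrite ord1.
    under eq_fun do rewrite christoffel_formE.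
    by have [] := H k.
  suff E : 'D_1 (fun s => christoffel_form (metric i) (u s) (derive1 u s) (J s)) t0 = D.
    exact: DeriveDef dF E.
  rewrite (derive_mx dF); apply/rowP => k; rewrite mxE.
  under eq_fun do rewrite christoffel_formE.
  by have [_ ->] := H k.
have dDJ : is_derive t0 1 (cov_deriv (metric i) u J)
    ((gfield_diff i (state i (gam p v0) t0) (J t0, K)).2 + D).
  exact: (is_deriveD dK dB).
split; first by have [] := dJ.
  by have [] := dDJ.
apply/rowP => k; rewrite /cov_deriv (derive1_is_derive dDJ).
have F1 : ((gfield_diff i (state i (gam p v0) t0) (J t0, K)).2 + D) 0 k =
    (gfield_diff i (y, w) (J t0, K)).2 0 k + D 0 k by exact: mxE.
have F2 : D 0 k = dform (chr i k) y w w (J t0) + form (chr i k) y (- B w w) (J t0) +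
    form (chr i k) y w K by exact: mxE.
have F3 (a b c : V) : (a + b + c) 0 k = a 0 k + b 0 k + c 0 k.
  by rewrite mxE; congr (_ + _); exact: mxE.
apply: (etrans (F3 _ _ _)); rewrite F1 F2 [RHS]mxE christoffel_formE.
exact: (jacobi_identity w (J t0) K k i0).
Qed.

Hypothesis nocp : no_conjugate_points M.

(** The field vanishes at 0 and at [T], hence everywhere; so does its derivative at 0, which is
    [h]. *)
Lemma jfield_inj p v0 h i T : tnorm p v0 = 1 -> T != 0 -> chart_dom i (gam p v0 T) ->
  jfield p v0 h i T = 0 -> h = 0.
Proof.
move=> v1 T0 iT JT.
have z0 : field_zero (gam p v0) (jfield p v0 h) 0 by move=> j _; exact: jfield0.
have zT : field_zero (gam p v0) (jfield p v0 h) T.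
  by move=> j jT; rewrite (jfield_trans h iT jT) JT mul0mx.
have gg := gam_geodesic complete v1.
rewrite eq_sym in T0.
have z := nocp gg (jfield_is_jacobi p v0 h) T0 z0 zT.
have ip : chart_dom (chart_at p) (gam p v0 0) by rewrite gam0//; exact: chart_at_dom.
rewrite -(derive1_jfield0 p v0 h).
have c0 := is_derive_cst (0 : V) (0 : R) 1.
apply: derive1_is_derive; apply: (is_derive_near _ c0).
have [e e0 he] := near_dom (gam_cgeodesic complete p v0).1 ip.
by apply/near_normP; exists e => // s /he is_; rewrite (z s _ is_).
Qed.

(** The product [phi] of the field with the velocity has constant derivative: differentiating the
    conservation of speed with respect to the initial vector gives 2 <v0, h>, and [koszul]
    identifies half of it with the time derivative of [phi]. *)
Lemma gauss_jfield p v0 h i t : chart_dom i (gam p v0 t) ->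
  ginner i (gam p v0 t) (jfield p v0 h i t) (cvel i (gam p v0) t) = t * inner p v0 h.
Proof.
move: i.
pose phi s := let i := chart_at (gam p v0 s) in
  ginner i (gam p v0 s) (jfield p v0 h i s) (cvel i (gam p v0) s).
have phiE i s : chart_dom i (gam p v0 s) ->
    phi s = ginner i (gam p v0 s) (jfield p v0 h i s) (cvel i (gam p v0) s).
  move=> is_; have is' := chart_at_dom (gam p v0 s).
  rewrite (ginner_trans _ _ is_ is') -(jfield_trans h is_ is').
  by rewrite -(cvel_trans (gam_cgeodesic complete p v0) is_ is').
have dphi s : is_derive s 1 phi (inner p v0 h).
  set i := chart_at (gam p v0 s); have is_ : chart_dom i (gam p v0 s) := chart_at_dom _.
  have [e e0 He] := jfield_local is_.
  have s0 : `|s - s| < e by rewrite subrr normr0.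
  have [_ [dS /(_ h)[dJ dK]]] := He s s0.
  have gc := gam_cgeodesic complete p v0; have [du dw] := gc.2 _ _ is_.
  set y := chart i (gam p v0 s) in dw; set w := derive1 _ s in du dw.
  set J := jfield p v0 h i s; set K := derive1 _ s in dJ.
  pose g := fun y a b => metric i y a b.
  have gs a b : sdf (fun z => g z a b) y by exact: metric_sdf.
  have d1 : is_derive s 1 (fun r => form g (chart i (gam p v0 r)) (jfield p v0 h i r)
      (derive1 (chart i \o gam p v0) r))
      (dform g y w J w + form g y K w + form g y J (- christoffel_form (metric i) y w w)).
    exact: (is_derive_form gs du dJ dw).
  have [_ near_] := gam_sdiff complete is_.
  have d2 := sdiff_comp (sdiff_pair (sdiff_comp dS (sdiff_fst _))
    (sdiff_pair (sdiff_comp dS (sdiff_snd _)) (sdiff_comp dS (sdiff_snd _)))) (form_sdiff w w gs).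
  have d3 : sdiff (fun v => inner p v v) v0
      (fun k => inner p k v0 + inner p v0 k).
    pose gp := fun y a b => metric (chart_at p) y a b.
    have gps a b : sdf (fun z => gp z a b) (chart (chart_at p) p).
      by apply: metric_sdf; exact: chart_at_dom.
    have := sdiff_comp (sdiff_pair (sdiff_cst (chart (chart_at p) p) v0)
       (sdiff_pair (sdiff_id v0) (sdiff_id v0))) (form_sdiff v0 v0 gps).
    have -> : (fun v => form gp (chart (chart_at p) p) v v) = fun v => inner p v v.
      by apply/funext => v; rewrite -ginner_inner ginner_form.
    by move=> H; apply: sdiff_ext H _ => k /=; rewrite dform0 add0r -!ginner_inner !ginner_form.
  have d4 : sdiff (fun v => inner p v v) v0
      (fun k => dform g y (jfield p v0 k i s) w w + form g y (derive1 (jfield p v0 k i) s) w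
        + form g y w (derive1 (jfield p v0 k i) s)).
    apply: sdiff_near d2 _; apply: filterS near_ => v iv.
    by rewrite -(gam_speed complete iv) ginner_form.
  have A := sdiff_unique d3 d4 h; rewrite -/J -/K in A.
  have gsym a b : g y a b = g y b a.
    by rewrite /g /y -[in LHS]Defs.metric_sym// mxE.
  have Dsym : dform g y w J w = dform g y w w J.
    by apply: dform_sym => a b; exact: metric_sym_near.
  have kz := koszul J w is_; rewrite ginner_form -/y -/g in kz.
  have E : inner p v0 h = dform g y w J w + form g y K w +
      form g y J (- christoffel_form (metric i) y w w).
    rewrite formNr kz Dsym; move: A; rewrite innerC (form_sym K w gsym).
    exact: half_sum.
  rewrite E; apply: is_derive_near d1.
  have [r r0 hr] := near_dom gc.1 is_; apply/near_normP; exists r; first exact: r0.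
  by move=> q /hr iq; rewrite (phiE i q iq) ginner_form.
move=> i it; rewrite -phiE//.
have H := @mean_value_inequality_sym R R (fun s => phi s - s *: inner p v0 h)
  (fun=> inner p v0 h - inner p v0 h) 0 t 0.
have : `|phi t - t *: inner p v0 h - (phi 0 - 0 *: inner p v0 h)| <= 0 * `|t - 0|.
  apply: H => [s _|s _]; last by rewrite subrr normr0.
  by apply: is_deriveB; exact: is_derive_scalel.
have -> : phi 0 = 0 by rewrite /phi jfield0 ginner0l.
by rewrite mul0r normr_le0 scale0r !subr0 subr_eq0 => /eqP ->.
Qed.

End JacobiFields.

Lemma near_continuous (T U : topologicalType) (f g : T -> U) (x : T) :
  (\forall y \near x, f y = g y) -> {for x, continuous f} -> {for x, continuous g}.
Proof.
move=> fg cf A /=; rewrite -(nbhs_singleton fg) => /cf nA.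
by apply: filterS2 fg nA => y /= ->.
Qed.

Lemma near_normI (R : realType) (x : R) (A B : set R) : nbhs x A -> nbhs x B ->
  exists2 r : R, 0 < r & forall y, `|y - x| < r -> A y /\ B y.
Proof. by move=> nA nB; apply/near_normP; exact: filterI. Qed.

(** * The exponential map and path lifting *)

Section ExponentialLocal.
Context {R : realType} {n : nat} (M : riemannianManifold R n).
Local Notation V := 'rV[R]_n.
Implicit Types (i j : chart_idx M) (p x : M) (u v w h : V) (s t : R) (c : R -> M).
Hypothesis complete : complete_manifold M.
Hypothesis nocp : no_conjugate_points M.

Lemma gam_continuous p t : continuous (fun v => gam (M := M) p v t).
Proof.
move=> v0; set x := gam p v0 t; set i := chart_at x.
have ix : chart_dom i x := chart_at_dom x.
have [_ ni] := gam_sdiff complete ix.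
have cv : (chart i (gam p v t)) @[v --> v0] --> chart i x.
  exact: (sdiff_continuous (gam_chart_sdiff complete ix)).
have cc : {for v0, continuous (fun v => chart_inv i (chart i (gam p v t)))}.
  apply: (@continuous_comp _ _ _ (fun v => chart i (gam p v t)) (chart_inv i)); first exact: cv.
  exact: chart_inv_continuous ix.
apply: near_continuous cc; apply: filterS ni => v iv.
exact: chart_invK.
Qed.

Definition expm p v : M := gam p v 1.

Lemma expm0 p : expm p 0 = p.
Proof.
have -> : expm p 0 = gam p (0 *: (0 : V)) 1 by rewrite scale0r.
by rewrite gamZ// mul0r gam0.
Qed.

Lemma gam_expm p v t : gam p v t = expm p (t *: v).
Proof. by rewrite /expm gamZ// mulr1. Qed.

(** [no_conjugate_points] speaks of unit speed geodesics, so a non-zero [v0] is rescaled and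
    observed at time |v0|. At [v0 = 0] the differential is found along the ray s -> s h, where it is
    the initial velocity. *)
Lemma expm_diff_inj p v0 h i : chart_dom i (expm p v0) ->
  jfield p v0 h i 1 = 0 -> h = 0.
Proof.
move=> ie; have dE := gam_chart_sdiff complete ie.
have [v00|v0n] := eqVneq v0 0.
  rewrite v00 in dE ie *; move=> J0.
  have ip : chart_dom i (gam p h 0) by rewrite gam0// -(expm0 p).
  have d1 : is_derive (0 : R) 1 (fun s => chart i (gam p (s *: h) 1)) (jfield p 0 h i 1).
    have dl : is_derive (0 : R) 1 (fun s => s *: h) h by exact: is_derive_scalel.
    have dE0 : sdiff (fun v => chart i (gam p v 1)) ((0 : R) *: h) (fun h => jfield p 0 h i 1).
      by rewrite scale0r.
    exact: (is_derive_sdiff dl dE0).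
  have E : (fun s => chart i (gam p (s *: h) 1)) = chart i \o gam p h.
    by apply/funext => s; rewrite /= gamZ// mulr1.
  rewrite E J0 in d1.
  have cv0 : cvel i (gam p h) 0 = 0 by exact: derive1_is_derive d1.
  have ip' : chart_dom (chart_at p) (gam p h 0) by rewrite gam0//; exact: chart_at_dom.
  have := cvel_trans (gam_cgeodesic complete p h) ip' ip; rewrite cv0 gam_cvel//.
  by move=> /esym; exact: trans_jac_inj.
set T := tnorm p v0; have T0 : 0 < T by exact: tnorm_gt0.
pose u0 := T^-1 *: v0.
have u1 : tnorm p u0 = 1.
  by rewrite tnormZ ger0_norm ?invr_ge0 ?(ltW T0)// mulVf// gt_eqF.
have eT v : gam p v 1 = gam p (T^-1 *: v) T by rewrite gamZ// mulVf ?gt_eqF.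
have iT : chart_dom i (gam p u0 T) by rewrite -eT.
have d1 := sdiff_comp (sdiff_lin v0 (blin_scale _ T^-1)) (gam_chart_sdiff complete iT).
have d2 : sdiff (fun v => chart i (gam p v 1)) v0 (fun h => jfield p u0 (T^-1 *: h) i T).
  by apply: sdiff_near d1 _; apply/near_normP; exists 1 => // v _; rewrite -eT.
rewrite (sdiff_unique dE d2 h) => /(jfield_inj complete nocp u1 (lt0r_neq0 T0) iT).
by move/eqP; rewrite scaler_eq0 invr_eq0 gt_eqF//= => /eqP.
Qed.

Lemma expm_chart p v0 i : chart_dom i (expm p v0) -> exists2 D : 'M[R]_n, D \in unitmx &
  (forall h, jfield p v0 h i 1 = h *m D) /\
  sdiff (fun v => chart i (expm p v)) v0 (fun h => h *m D).
Proof.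
move=> ie; have dE := gam_chart_sdiff complete ie.
have [D hD] := blin_rV dE.1; exists D; last by split=> //; exact: sdiff_ext dE hD.
rewrite -row_free_unit -kermx_eq0; apply/rowV0P => v /sub_kermxP kv.
by apply: (expm_diff_inj ie); rewrite hD.
Qed.

Lemma expm_local_inj p v0 : exists2 r : R, 0 < r &
  forall v w, `|v - v0| < r -> `|w - v0| < r -> expm p v = expm p w -> v = w.
Proof.
have i0 := chart_at_dom (expm p v0); set i := chart_at _ in i0.
have [D uD [_ dE]] := expm_chart i0.
have [c c0 [r r0 [inj _]]] := sdiff_inverse uD dE.
exists r => // v w vr wr E; have := inj v w vr wr; rewrite E subrr normr0.
by rewrite pmulr_rle0// normr_le0 subr_eq0 => /eqP.
Qed.

Lemma expm_open p v0 (U : set V) : nbhs v0 U -> nbhs (expm p v0) (expm p @` U).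
Proof.
move=> nU; have i0 := chart_at_dom (expm p v0); set i := chart_at _ in i0.
have [D uD [_ dE]] := expm_chart i0.
have [c c0 [r r0 [_ surj]]] := sdiff_inverse uD dE.
have [_ ni] := gam_sdiff complete i0.
have [q q0 hq] := (near_normP _ _).1 (filterI nU ni).
pose s := Num.min r q / 2.
have s0 : 0 < s by rewrite divr_gt0// lt_min r0.
have [sr sq] : s < r /\ s < q.
  have : s < Num.min r q by rewrite ltr_pdivrMr// ltr_pMr ?ltr1n// lt_min r0.
  by rewrite lt_min => /andP.
have nW : \forall y \near chart i (expm p v0), `|y - chart i (expm p v0)| < c * s.
  by apply/near_normP; exists (c * s) => //; exact: mulr_gt0.
have := near_chart i0 nW; apply: filterS => x [ix xs].
have sr' : 0 < s < r by rewrite s0.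
have [z zs zE] := surj s sr' (chart i x) xs.
have [Uz iz] := hq z (le_lt_trans zs sq).
by exists z => //; rewrite -(chart_invK (iz : chart_dom i (expm p z))) zE chart_invK.
Qed.

Lemma expm_continuous p : continuous (expm p).
Proof. exact: gam_continuous. Qed.

End ExponentialLocal.

Section Clamp.
Context {R : realType}.

(** For a <= b, composing with it extends a curve from [[a, b]] to the line by constants, so that
    continuity can be stated on all of [R]. *)
Definition clamp (a b t : R) : R := Num.max a (Num.min b t).

Lemma clamp_continuous (a b : R) : continuous (clamp a b).
Proof.
move=> t; rewrite /clamp; apply: continuous_max; first exact: cvg_cst.
by apply: continuous_min; [exact: cvg_cst|exact: cvg_id].
Qed.

Lemma clamp_id (a b t : R) : a <= t <= b -> clamp a b t = t.
Proof. by move=> /andP[at_ tb]; rewrite /clamp min_r// max_r. Qed.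

Lemma clamp_itv (a b t : R) : a <= b -> a <= clamp a b t <= b.
Proof. by move=> ab; rewrite /clamp le_max lexx ge_max ab ge_min lexx. Qed.

Lemma glue_continuous (T : topologicalType) (f g : R -> T) (x : R) :
  continuous f -> continuous g -> f x = g x ->
  continuous (fun t => if t <= x then f t else g t).
Proof.
move=> cf cg fg t.
have [tx|xt|tx] := ltgtP t x.
- apply: near_continuous (cf t).
  have : \forall s \near t, s < x by apply/near_normP; exists (x - t) => [|s]; [rewrite subr_gt0|rewrite ltr_distl => /andP[_]; lra].
  by apply: filterS => s /ltW ->.
- apply: near_continuous (cg t).
  have : \forall s \near t, x < s by apply/near_normP; exists (t - x) => [|s]; [rewrite subr_gt0|rewrite ltr_distl => /andP[+ _]; lra].
  by apply: filterS => s; rewrite ltNge => /negPf ->.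
- move=> A /= nA; rewrite tx; rewrite tx lexx in nA; have gA := cg x A; rewrite -fg in gA.
  have [r r0 hr] := near_normI (cf x A nA) (gA nA).
  suff : \forall s \near x, A (if s <= x then f s else g s) by [].
  apply/near_normP; by exists r => // s /hr[fs gs]; case: ifP.
Qed.

End Clamp.

(** * Lifting through a local homeomorphism *)

Section Lifting.
Context {R : realType} {X M : topologicalType} (E : X -> M).
Hypothesis hX : hausdorff_space X.
Hypothesis cE : continuous E.
Hypothesis injE : forall v : X, exists2 U : set X, nbhs v U &
  forall a b, U a -> U b -> E a = E b -> a = b.
Hypothesis openE_ : forall (v : X) (U : set X), nbhs v U -> nbhs (E v) (E @` U).

Lemma local_section v : exists (U : set X) (sg : M -> X),
  [/\ open U, U v, (forall a, U a -> sg (E a) = a) &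
   forall a, U a -> {for E a, continuous sg}].
Proof.
have [U nU iU] := injE v.
pose U' := U°; have oU' : open U' by exact: open_interior.
pose sg y := xget v [set a | U' a /\ E a = y].
have sgK a : U' a -> sg (E a) = a.
  move=> Ua; have [Us Es] := xgetPex v (ex_intro [set b | U' b /\ E b = E a] a (conj Ua erefl)).
  by apply: iU => //; exact: interior_subset.
exists U', sg; split=> // a Ua A /=; rewrite sgK// => nA.
have := openE_ (@filterI _ _ (@nbhs_filter _ a) _ _ (open_nbhs_nbhs (conj oU' Ua)) nA).
by apply: filterS => _ [b [Ub Ab] <-] /=; rewrite sgK.
Qed.

Lemma lift_unique (g1 g2 : R -> X) (t0 : R) : continuous g1 -> continuous g2 ->
  (forall t, E (g1 t) = E (g2 t)) -> g1 t0 = g2 t0 -> g1 = g2.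
Proof.
move=> c1 c2 e12 e0; apply/funext.
apply: (@locally_constant R (fun t => g1 t = g2 t) t0) => // x.
have [gx|gx] := pselect (g1 x = g2 x).
  have [U nU iU] := injE (g1 x).
  have n2 : nbhs (g2 x) U by rewrite -gx.
  have [r r0 hr] := near_normI (c1 x U nU) (c2 x U n2).
  exists r => // s t sr tr _; have [U1 U2] := hr t tr.
  exact: iU.
have hX' := hX; rewrite open_hausdorff in hX'.
have [|[A B] [/= Ax Bx] [oA oB AB]] := hX' (g1 x) (g2 x).
  by apply/eqP.
rewrite inE in Ax; rewrite inE in Bx.
have nA : nbhs (g1 x) A by apply: open_nbhs_nbhs.
have nB : nbhs (g2 x) B by apply: open_nbhs_nbhs.
have [r r0 hr] := near_normI (c1 x A nA) (c2 x B nB).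
exists r => // s t sr tr st; have [A1 B2] := hr s sr.
have : (A `&` B) (g1 s) by split=> //; rewrite st.
by rewrite (eqP AB).
Qed.

Lemma lift_unique_itv (g1 g2 : R -> X) (a b t0 : R) : a <= t0 <= b ->
  (forall t, a <= t <= b -> {for t, continuous g1}) ->
  (forall t, a <= t <= b -> {for t, continuous g2}) ->
  (forall t, a <= t <= b -> E (g1 t) = E (g2 t)) -> g1 t0 = g2 t0 ->
  forall t, a <= t <= b -> g1 t = g2 t.
Proof.
move=> t0ab c1 c2 e12 e0 t tab.
have ab : a <= b by case/andP: t0ab => /le_trans h /h.
have H := @lift_unique (g1 \o clamp a b) (g2 \o clamp a b) t0.
have : (g1 \o clamp a b) t = (g2 \o clamp a b) t.
  rewrite H//=.
  - by move=> s; apply: continuous_comp; [exact: clamp_continuous|apply: c1; exact: clamp_itv].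
  - by move=> s; apply: continuous_comp; [exact: clamp_continuous|apply: c2; exact: clamp_itv].
  - by move=> s; apply: e12; exact: clamp_itv.
  - by rewrite clamp_id.
by rewrite /= clamp_id.
Qed.

(** Continuity in the parameter spreads from time 0 to all times: near [(s0, x)] all lifts follow
    one local section, by uniqueness of lifts on the short interval between [t] and [t']. *)
Lemma lift_param (T : topologicalType) (F : T -> R -> M) (Fl : T -> R -> X) (s0 : T) :
  (forall t, {for (s0, t), continuous (fun z : T * R => F z.1 z.2)}) ->
  (forall t, {for s0, continuous (F ^~ t)}) ->
  (\forall s \near s0, continuous (F s)) ->
  (\forall s \near s0, continuous (Fl s) /\ forall t, E (Fl s t) = F s t) ->
  {for s0, continuous (Fl ^~ 0)} ->
  forall t, {for s0, continuous (Fl ^~ t)}.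
Proof.
move=> cF cF1 cF2 lF c0; apply: (@locally_constant R (fun t => {for s0, continuous (Fl ^~ t)}) 0) => // x.
have [cl0 El0] := nbhs_singleton lF.
have [U [sg [oU Ux sgK sgc]]] := local_section (Fl s0 x).
have nU a : U a -> nbhs a U by move=> Ua; exact: open_nbhs_nbhs.
have nV : nbhs (F s0 x) (E @` U) by rewrite -El0; apply: openE_; exact: nU.
have [[N B] /= [nN nB] hNB] := cF x _ nV.
have [e1 e10 he1] := (near_normP _ _).1 nB.
have [e2 e20 he2] := (near_normP _ _).1 (cl0 x U (nU _ Ux)).
exists (Num.min e1 e2) => [|t t']; first by rewrite lt_min e10.
rewrite !lt_min => /andP[te1 te2] /andP[t'e1 t'e2] ct.
have Ut : U (Fl s0 t) := he2 t te2.
have nUt : \forall s \near s0, U (Fl s t) by apply: ct; exact: nU.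
have key : \forall s \near s0, Fl s t' = sg (F s t').
  near=> s.
  have Us : U (Fl s t) by near: s.
  have Ns : N s by near: s.
  have [cs Es] : continuous (Fl s) /\ forall t, E (Fl s t) = F s t by near: s.
  have cFs : continuous (F s) by near: s.
  pose a := Num.min t t'; pose b := Num.max t t'.
  have btw r : a <= r <= b -> (E @` U) (F s r).
    move=> /andP[ar rb]; apply: (hNB (s, r)); split=> //=; apply: he1.
    move: ar rb; rewrite /a /b ge_min le_max => h1 h2.
    move: te1 t'e1; rewrite !ltr_distl => /andP[? ?] /andP[? ?].
    by case/orP: h1 => h1; case/orP: h2 => h2; apply/andP; split; lra.
  apply: (@lift_unique_itv (Fl s) (fun r => sg (F s r)) a b t).
  - by rewrite /a /b ge_min le_max lexx.
  - by move=> r _; exact: cs.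
  - move=> r /btw [v Uv vE]; apply: continuous_comp; first exact: cFs.
    by rewrite -vE; exact: sgc.
  - by move=> r /btw [v Uv vE]; rewrite -vE sgK// Es.
  - by rewrite -Es sgK.
  - by rewrite /a /b ge_min le_max !lexx !orbT.
have [v Uv vE] : (E @` U) (F s0 t').
  by apply: (hNB (s0, t')); split=> /=; [exact: nbhs_singleton|exact: he1].
have cs : {for s0, continuous (fun s => sg (F s t'))}.
  apply: (@continuous_comp _ _ _ (F ^~ t') sg); first exact: cF1.
  by rewrite -vE; exact: sgc.
by apply: near_continuous cs; apply: filterS key => s ->.
Unshelve. all: by end_near. Qed.

End Lifting.

Section LiftDerivative.
Context {R : realType} {n : nat}.
Local Notation V := 'rV[R]_n.

(** The lift [g] is only known to be continuous. The lower bound in [sdiff_inverse] makes it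
    Lipschitz at [t], and then the first-order expansion of [f] can be inverted. *)
Lemma is_derive_lift (f : V -> V) (g : R -> V) (t : R) (D : 'M[R]_n) (d : V) :
  D \in unitmx -> sdiff f (g t) (fun h => h *m D) -> {for t, continuous g} ->
  is_derive t 1 (fun s => f (g s)) d -> is_derive t 1 g (d *m invmx D).
Proof.
move=> uD df cg dfg; apply/is_deriveP => e e0.
have [c c0 [r r0 [inj _]]] := sdiff_inverse uD df.
have [_ [B B0 hB]] := blin_mulmx (invmx D).
pose K := (`|d| + 1) / c; have K0 : 0 < K by rewrite divr_gt0// ltr_wpDl.
pose e' := e / (B * (K + 1)).
have e'0 : 0 < e' by rewrite divr_gt0// mulr_gt0// addr_gt0.
have [r1 r10 h1] := df.2 _ e'0.
have [r2 r20 h2] := (is_deriveP _ _ _).1 dfg _ e'0.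
have [r3 r30 h3] := (is_deriveP _ _ _).1 dfg _ ltr01.
have r4 : 0 < Num.min r r1 by rewrite lt_min r0.
have [r5 r50 h5] := (near_normP _ _).1 (cg _ (nbhsx_ballx (g t) _ r4)).
exists (Num.min r5 (Num.min r2 r3)) => [|s]; first by rewrite !lt_min r50 r20.
rewrite !lt_min => /and3P[s5 s2 s3].
have /= := h5 s s5; rewrite -ball_normE /= distrC lt_min => /andP[gr gr1].
have gt0 : `|g t - g t| < r by rewrite subrr normr0.
have gt1 : `|g t - g t| < r1 by rewrite subrr normr0.
have gK : `|g s - g t| <= K * `|s - t|.
  rewrite /K mulrAC ler_pdivlMr// mulrC (le_trans (inj _ _ gr gt0))//.
  have -> : f (g s) - f (g t) = (f (g s) - f (g t) - (s - t) *: d) + (s - t) *: d by rewrite subrK.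
  rewrite (le_trans (ler_normD _ _))// normrZ.
  by rewrite [leRHS]mulrDl [leRHS]addrC mul1r [`|d| * _]mulrC lerD// -[leRHS]mul1r; exact: h3.
have -> : g s - g t - (s - t) *: (d *m invmx D) =
  (f (g s) - f (g t) - (s - t) *: d - (f (g s) - f (g t) - (g s - g t) *m D)) *m invmx D.
  have E0 (A X Y : V) : A - Y - (A - X) = X - Y.
    by rewrite opprB addrC addrA subrK.
  by rewrite E0 mulmxBl mulmxK// -scalemxAl.
rewrite (le_trans (hB _))//.
have hs := h2 s s2; have hg := h1 _ _ gr1 gt1.
have N : `|f (g s) - f (g t) - (s - t) *: d - (f (g s) - f (g t) - (g s - g t) *m D)| <=
    e' * (K + 1) * `|s - t|.
  rewrite (le_trans (ler_normB _ _))//.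
  have : e' * `|g s - g t| <= e' * (K * `|s - t|) by rewrite ler_pM2l.
  rewrite mulrDr mulr1 mulrDl [e' * K * _ + _]addrC -[e' * K * _]mulrA => h4.
  by apply: lerD => //; exact: (le_trans hg h4).
rewrite (le_trans (ler_wpM2l (ltW B0) N))// /e'.
rewrite le_eqVlt; apply/orP; left; apply/eqP.
have := lt0r_neq0 B0; have : K + 1 != 0 by rewrite gt_eqF// addr_gt0.
by move=> K1 B1; field; rewrite K1 B1.
Qed.

End LiftDerivative.

(** * Radial growth of lifted curves *)

Section GaussBound.
Context {R : realType} {n : nat} (M : riemannianManifold R n).
Local Notation V := 'rV[R]_n.
Implicit Types (i j : chart_idx M) (p x : M) (u v w h : V) (s t : R) (c : R -> M).

Definition gnorm i x v : R := Num.sqrt (ginner i x v v).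

Lemma gnorm_ge0 i x v : 0 <= gnorm i x v. Proof. exact: sqrtr_ge0. Qed.

Lemma gnorm_sqr i x v : chart_dom i x -> gnorm i x v ^+ 2 = ginner i x v v.
Proof. by move=> ix; rewrite sqr_sqrtr// ginner_ge0. Qed.

Lemma gnorm_trans i j x v : chart_dom i x -> chart_dom j x ->
  gnorm j x (v *m 'J (trans i j) (chart i x)) = gnorm i x v.
Proof. by move=> ix jx; rewrite /gnorm -ginner_trans. Qed.

Lemma ginner_sub i x (a : R) v w : chart_dom i x ->
  ginner i x (v - a *: w) (v - a *: w) =
  ginner i x v v - 2 * a * ginner i x v w + a ^+ 2 * ginner i x w w.
Proof.
move=> ix; have L u u' z : ginner i x (u - a *: u') z = ginner i x u z - a * ginner i x u' z.
  by rewrite addrC -scaleNr ginner_linl addrC mulNr.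
rewrite L (ginnerC v)// (ginnerC w (v - _))// !L (ginnerC w v)//.
by ring.
Qed.

Lemma cauchy_schwarz i x v w : chart_dom i x ->
  ginner i x v w <= gnorm i x v * gnorm i x w.
Proof.
move=> ix; have [->|w0] := eqVneq w 0.
  by rewrite ginnerC// ginner0l mulr_ge0 ?gnorm_ge0.
have W := ginner_gt0 ix w0.
set B := ginner i x v w; pose a := B / ginner i x w w.
have := ginner_ge0 (v - a *: w) ix; rewrite ginner_sub// -/B.
have -> : ginner i x v v - 2 * a * B + a ^+ 2 * ginner i x w w =
   ginner i x v v - B ^+ 2 / ginner i x w w.
  by rewrite /a; field; rewrite gt_eqF.
rewrite subr_ge0 ler_pdivrMr// -!gnorm_sqr// -exprMn => h.
rewrite (le_trans (ler_norm _))// -(ger0_norm (mulr_ge0 (gnorm_ge0 i x v) (gnorm_ge0 i x w))).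
by rewrite -ler_sqr ?nnegrE// -normrX -[leRHS]normrX ger0_norm ?sqr_ge0// ger0_norm ?sqr_ge0.
Qed.

Lemma cauchy_schwarz_eq i x v w : chart_dom i x -> w != 0 ->
  ginner i x v w = gnorm i x v * gnorm i x w -> v = (gnorm i x v / gnorm i x w) *: w.
Proof.
move=> ix w0 E; have W := ginner_gt0 ix w0.
have Wn : gnorm i x w != 0 by rewrite gt_eqF// sqrtr_gt0.
apply/eqP; rewrite -subr_eq0; apply/eqP; apply: (ginner_eq0 ix).
rewrite ginner_sub// E -!gnorm_sqr//; field; exact: Wn.
Qed.

Lemma inner_form p v : inner p v v = form (fun=> metric (chart_at p) (chart (chart_at p) p)) (0 : V) v v.
Proof. by rewrite -ginner_inner ginner_form. Qed.

Lemma is_derive_inner p (g : R -> V) t h : is_derive t 1 g h ->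
  is_derive t 1 (fun s => inner p (g s) (g s)) (2 * inner p (g t) h).
Proof.
move=> dg; pose c : V -> 'I_n -> 'I_n -> R := fun=> metric (chart_at p) (chart (chart_at p) p).
have -> : (fun s => inner p (g s) (g s)) = (fun s => form c (0 : V) (g s) (g s)).
  by apply/funext => s; rewrite inner_form.
suff -> : 2 * inner p (g t) h = dform c (0 : V) 0 (g t) (g t) + form c (0 : V) h (g t) + form c (0 : V) (g t) h.
  apply: (is_derive_form (y := fun=> 0)) => //; first by move=> a b; exact: sdf_cst.
rewrite dform0 add0r.
have -> : form c (0 : V) h (g t) = inner p h (g t) by rewrite -ginner_inner ginner_form.
have -> : form c (0 : V) (g t) h = inner p (g t) h by rewrite -ginner_inner ginner_form.
by rewrite innerC mulr_natl mulr2n.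
Qed.

Lemma inner_continuous p : continuous (fun v => inner p v v).
Proof.
suff H (v : V) : {for v, continuous (fun v => inner p v v)} by move=> v; exact: H.
pose c : V -> 'I_n -> 'I_n -> R := fun=> metric (chart_at p) (chart (chart_at p) p).
have -> : (fun v => inner p v v) = (fun v => form c (0 : V) v v).
  by apply/funext => s; rewrite inner_form.
have d := @form_sdiff R n c 0 v v (fun a b => sdf_cst _ _).
have dv := sdiff_pair (sdiff_cst (0 : V) v) (sdiff_pair (sdiff_id v) (sdiff_id v)).
exact: (sdiff_continuous (sdiff_comp dv d)).
Qed.

Lemma tnorm_continuous p : continuous (tnorm p).
Proof.
move=> v; apply: (@continuous_comp _ _ _ (fun v => inner p v v) Num.sqrt); first exact: inner_continuous.
exact: sqrt_continuous.
Qed.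

Lemma tnorm_norm p : exists2 C : R, 0 < C & forall v, `|v| <= C * tnorm p v.
Proof.
pose S := [set v : V | `|v| = 1].
have cS : compact S.
  apply: bounded_closed_compact.
    exists 1; split=> // x x1 v /= ->; exact: ltW.
  have -> : S = (fun v : V => `|v|) @^-1` [set 1] by [].
  apply: closed_comp; last exact: closed_eq.
  by move=> v _; exact: norm_continuous.
(* The sphere is empty in dimension 0, where every vector is zero. *)
have [[v0 v01]|S0] := pselect (S !=set0); last first.
  exists 1 => // v; have [->|v0] := eqVneq v 0; first by rewrite normr0 mul1r tnorm_ge0.
  exfalso; apply: S0; exists (`|v|^-1 *: v); rewrite /S /= normrZ normfV normr_id.
  by rewrite mulVf// normr_eq0.
have [|w wS hw] := compact_EVT_min (ex_intro _ v0 v01) cS (f := tnorm p).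
  by apply: continuous_subspaceT; exact: tnorm_continuous.
have w0 : w != 0 by move: wS; rewrite inE /S /= -normr_eq0 => ->; exact: oner_neq0.
have W := tnorm_gt0 p w0.
exists (tnorm p w)^-1 => [|v]; first by rewrite invr_gt0.
have [->|v0'] := eqVneq v 0; first by rewrite normr0 mulr_ge0 ?invr_ge0 ?tnorm_ge0.
have nv : 0 < `|v| by rewrite normr_gt0.
have := hw (`|v|^-1 *: v); rewrite inE /S /= normrZ normfV normr_id mulVf ?normr_eq0// => /(_ erefl).
rewrite tnormZ normfV normr_id => h.
by rewrite ler_pdivlMl// mulrC -ler_pdivlMl.
Qed.

Hypothesis complete : complete_manifold M.
Hypothesis nocp : no_conjugate_points M.

Lemma expm_lift_derive p g t i d c : {for t, continuous g} -> chart_dom i (expm p (g t)) ->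
  is_derive t 1 (chart i \o c) d -> (\forall s \near t, expm p (g s) = c s) ->
  exists2 h, is_derive t 1 g h & jfield p (g t) h i 1 = d.
Proof.
move=> cg ie dc ec; have [D uD [hD dE]] := expm_chart complete nocp ie.
exists (d *m invmx D); last by rewrite hD mulmxKV.
apply: (is_derive_lift uD dE cg); apply: is_derive_near dc.
by apply: filterS ec => s /= ->.
Qed.

(** One chart and one derivative suffice, so the notion applies alike to segments in a chart, to
    piecewise C^1 curves and to images of geodesics under isometries. *)
Definition speed_le c t (s : R) : Prop :=
  exists i d, [/\ chart_dom i (c t), is_derive t 1 (chart i \o c) d & gnorm i (c t) d <= s].

Lemma gauss_le p v h i : chart_dom i (expm p v) ->
  inner p v h <= gnorm i (expm p v) (jfield p v h i 1) * tnorm p v.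
Proof.
move=> ie; rewrite -[leLHS]mul1r -(@gauss_jfield R n M complete p v h i 1 ie).
rewrite (le_trans (cauchy_schwarz _ _ ie))// ler_wpM2l ?gnorm_ge0//.
by rewrite /gnorm /expm gam_speed.
Qed.

Lemma le_addeps (a b : R) : (forall e : R, 0 < e -> a <= b + e) -> a <= b.
Proof. by move=> h; apply/ler_addgt0Pr. Qed.

(* By the Gauss lemma the lift moves radially no faster than its image moves. *)
Lemma lift_growth p g c (S s : R -> R) (a b : R) : a <= b -> continuous g ->
  (forall t, a <= t <= b -> expm p (g t) = c t) ->
  {within `[a, b], continuous S} ->
  (forall t, a < t < b -> is_derive t 1 S (s t)) ->
  (forall t, a < t < b -> speed_le c t (s t)) ->
  tnorm p (g b) <= tnorm p (g a) + (S b - S a).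
Proof.
move=> ab cg lg cS dS sp.
(* The norm is not differentiable at 0, where the lift may pass; sqrt(|g|^2 + e^2) is, and [e] tends
   to 0 at the end. *)
have main (e : R) : 0 < e -> Num.sqrt (inner p (g b) (g b) + e ^+ 2) - S b <=
    Num.sqrt (inner p (g a) (g a) + e ^+ 2) - S a.
  move=> e0.
  pose N t := inner p (g t) (g t).
  pose F t := Num.sqrt (N t + e ^+ 2) - S t.
  have N0 t : 0 < N t + e ^+ 2 by rewrite ltr_wpDl ?inner_ge0// exprn_gt0.
  have dF t : a < t < b -> exists2 f, is_derive t 1 F f & f <= 0.
    move=> tab; have [i [d [ic dc ds]]] := sp t tab.
    have atb : a <= t <= b by case/andP: tab => /ltW -> /ltW ->.
    have ie : chart_dom i (expm p (g t)) by rewrite lg.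
    have ec : \forall s \near t, expm p (g s) = c s.
      case/andP: tab => at_ tb.
      apply/near_normP; exists (Num.min (t - a) (b - t)) => [|y].
        by rewrite lt_min !subr_gt0 at_.
      rewrite lt_min !ltr_distl => /andP[/andP[? ?] /andP[? ?]].
      by apply: lg; apply/andP; split; lra.
    have [h dh jh] := expm_lift_derive (cg t) ie dc ec.
    have dN : is_derive t 1 (fun s => N s + e ^+ 2) (2 * inner p (g t) h + 0).
      exact: (is_deriveD (is_derive_inner p dh) (is_derive_cst (e ^+ 2) t 1)).
    have dsq := @is_derive1_comp R Num.sqrt (fun s => N s + e ^+ 2) t _ _ (is_derive1_sqrt (N0 t)) dN.
    have := is_deriveB dsq (dS t tab).
    set f := (X in is_derive _ _ _ X) => dFt; exists f; first exact: dFt.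
    have sq0 : 0 < Num.sqrt (N t + e ^+ 2) by rewrite sqrtr_gt0.
    rewrite /f subr_le0 addr0 mulrC.
    rewrite ler_pdivrMr ?mulr_gt0// mulrCA ler_pM2l//.
    have := gauss_le h ie; rewrite jh lg// => hg; rewrite (le_trans hg)//.
    apply: ler_pM; [exact: gnorm_ge0|exact: tnorm_ge0|exact: ds|].
    rewrite /tnorm ler_sqrt ?(ltW (N0 t))//.
    by rewrite lerDl sqr_ge0.
  have cF : {within `[a, b], continuous F}.
    move=> t; apply: cvgB; last exact: cS.
    have cN : {within `[a, b], continuous (fun t => Num.sqrt (N t + e ^+ 2))}.
      apply: continuous_subspaceT => u.
      apply: (@continuous_comp _ _ _ (fun t => N t + e ^+ 2) Num.sqrt); last exact: sqrt_continuous.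
      apply: cvgD; last exact: cvg_cst.
      by apply: (@continuous_comp _ _ _ g (fun v => inner p v v)); [exact: cg|exact: inner_continuous].
    exact: cN.
  have := @ler0_derive1_le_cc R F a b _ _ cF b a; apply.
  - by move=> t; rewrite in_itv /= => /dF[f [df _] _].
  - by move=> t; rewrite in_itv /= => /dF[f df f0]; rewrite (derive1_is_derive df).
  - by rewrite in_itv /= ab lexx.
  - by rewrite in_itv /= ab lexx.
  - exact: ab.
apply: le_addeps => e e0; have := main e e0.
have h1 : tnorm p (g b) <= Num.sqrt (inner p (g b) (g b) + e ^+ 2).
  by rewrite /tnorm ler_sqrt ?lerDl ?sqr_ge0// addr_ge0 ?inner_ge0 ?sqr_ge0.
have h2 : Num.sqrt (inner p (g a) (g a) + e ^+ 2) <= tnorm p (g a) + e.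
  have h0 : 0 <= tnorm p (g a) + e by rewrite addr_ge0 ?tnorm_ge0 ?(ltW e0).
  rewrite -[leRHS](ger0_norm h0) -sqrtr_sqr ler_sqrt ?sqr_ge0// sqrrD tnorm_sqr.
  by rewrite lerD2r lerDl mulrn_wge0// mulr_ge0 ?tnorm_ge0// ltW.
lra.
Qed.

End GaussBound.

Lemma convex_lt (R : realFieldType) (t x y r : R) : 0 <= t <= 1 -> x < r -> y < r ->
  (1 - t) * x + t * y < r.
Proof.
move=> /andP[t0 t1] xr yr; have [t1'|t1'] := ltP t 1; last by (have -> : t = 1 by lra); lra.
have h1 : (1 - t) * x < (1 - t) * r by rewrite ltr_pM2l ?subr_gt0.
have h2 : t * y <= t * r by rewrite ler_wpM2l// ltW.
lra.
Qed.

Lemma continuous_pair (T U W : topologicalType) (f : T -> U) (g : T -> W) (x : T) :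
  {for x, continuous f} -> {for x, continuous g} -> {for x, continuous (fun z => (f z, g z))}.
Proof. by move=> cf cg; exact: cvg_pair. Qed.

Lemma continuous_const (T U : topologicalType) (u : U) (x : T) : {for x, continuous (fun=> u)}.
Proof. exact: cvg_cst. Qed.

Lemma continuous_pairl (T U : topologicalType) (u : U) (x : T) :
  {for x, continuous (fun z : T => (z, u))}.
Proof. by apply: continuous_pair; [exact: cvg_id|exact: cvg_cst]. Qed.

Section PathLifting.
Context {R : realType} {X M : topologicalType} (E : X -> M).

(** The lift is continuous on the whole line but lies over [c] only on [[0, x]], so that extending
    it amounts to gluing two continuous functions. *)
Definition lifts_to (c : R -> M) (v0 : X) (x : R) (g : R -> X) : Prop :=
  [/\ continuous g, g 0 = v0 & forall t, 0 <= t <= x -> E (g t) = c t].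

Lemma lift_extend c v0 (x y : R) g (sg : M -> X) : continuous c -> lifts_to c v0 x g ->
  0 <= x <= y -> sg (c x) = g x ->
  (forall t, x <= t <= y -> E (sg (c t)) = c t /\ {for c t, continuous sg}) ->
  exists g', lifts_to c v0 y g'.
Proof.
move=> cc [cg g0 lg] /andP[x0 xy] sgx hs.
pose g' t := if t <= x then g t else sg (c (clamp x y t)).
have kx : clamp x y x = x by rewrite clamp_id// lexx.
exists g'; split.
- apply: glue_continuous => //; last by rewrite kx.
  move=> t; apply: (@continuous_comp _ _ _ (fun t => c (clamp x y t)) sg).
    by apply: (@continuous_comp _ _ _ (clamp x y) c); [exact: clamp_continuous|exact: cc].
  by apply: (hs _ _).2; exact: clamp_itv.
- by rewrite /g' x0.
- move=> t /andP[t0 ty]; rewrite /g'; case: (leP t x) => tx.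
    by apply: lg; rewrite t0.
  by rewrite clamp_id ?(ltW tx)//; apply: (hs _ _).1; rewrite (ltW tx).
Qed.

Lemma lift_cst c v0 : E v0 = c 0 -> lifts_to c v0 0 (fun=> v0).
Proof.
move=> e0; split=> [t||t /andP[t0 t1]]; [exact: cvg_cst|by []|].
by rewrite e0; congr c; apply/eqP; rewrite eq_le t0.
Qed.

Hypothesis even : forall y : M, exists2 W : set M, nbhs y W & forall v, W (E v) ->
  exists2 sg : M -> X, sg (E v) = v & forall x, W x -> E (sg x) = x /\ {for x, continuous sg}.

(** Over [W] there is a section through the end of any partial lift. Hence the length of a step
    depends only on the point of [M], and limit times are passed without any control of the lift. *)
Lemma path_lift c v0 : continuous c -> E v0 = c 0 -> exists g, lifts_to c v0 1 g.
Proof.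
move=> cc e0; have H : forall x : R, 0 <= x <= 1 -> exists g, lifts_to c v0 x g; last first.
  by apply: H; rewrite ler01 lexx.
have step (x : R) : exists2 e : R, 0 < e & forall s t, `|s - x| < e -> `|t - x| < e ->
    0 <= s <= t -> (exists g, lifts_to c v0 s g) -> exists g, lifts_to c v0 t g.
  have [W nW hW] := even (c x).
  have [e e_gt0 he] := (near_normP _ _).1 (cc x W nW).
  exists e => // s t sx tx /andP[s0 st] [g lg].
  have es : E (g s) = c s by case: lg => _ _; apply; rewrite s0 lexx.
  have [|sg sgE hsg] := hW (g s); first by rewrite es; exact: he.
  apply: (lift_extend cc lg (sg := sg)); first by rewrite s0.
    by rewrite -es.
  move=> r /andP[sr rt]; apply: hsg; apply: he.
  by move: sx tx; rewrite !ltr_distl => /andP[? ?] /andP[? ?]; apply/andP; split; lra.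
apply: real_induction.
- by exists (fun=> v0); exact: lift_cst.
- move=> x /andP[x0 x1] ih; have [e e_gt0 he] := step x.
  exists e => // y /andP[xy ye] y1; apply: (he x y).
  + by rewrite subrr normr0.
  + by rewrite gtr0_norm ?subr_gt0// ltrBlDl.
  + by rewrite x0 ltW.
  + by apply: ih; rewrite x0 lexx.
- move=> x /andP[x0 x1] ih; have [e e_gt0 he] := step x.
  pose s := Num.max 0 (x - e / 2).
  have e2 : 0 < e / 2 by rewrite divr_gt0.
  have sx : s < x by rewrite gt_max x0 ltrBlDr ltrDl.
  have s0 : 0 <= s by rewrite le_max lexx.
  apply: (he s x).
  + rewrite distrC gtr0_norm ?subr_gt0//.
    have : x - e / 2 <= s by rewrite le_max lexx orbT.
    move=> h; lra.
  + by rewrite subrr normr0.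
  + by rewrite s0 ltW.
  + by apply: ih; rewrite s0.
Qed.

End PathLifting.

(** * The exponential map is bijective *)

Section LiftingCurves.
Context {R : realType} {n : nat} (M : riemannianManifold R n).
Local Notation V := 'rV[R]_n.
Implicit Types (i j : chart_idx M) (p x : M) (u v w h : V) (s t : R) (c : R -> M).
Hypothesis complete : complete_manifold M.
Hypothesis nocp : no_conjugate_points M.

Lemma rV_hausdorff : hausdorff_space V. Proof. exact: norm_hausdorff. Qed.

Lemma expm_injE p v : exists2 U : set V, nbhs v U &
  forall a b, U a -> U b -> expm p a = expm p b -> a = b.
Proof.
have [r r0 hr] := expm_local_inj complete nocp p v.
exists [set w | `|w - v| < r] => [|a b]; last exact: hr.
suff : \forall w \near v, `|w - v| < r by [].
by apply/near_normP; exists r.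
Qed.

Let openE p v U : nbhs v U -> nbhs (expm p v) (expm p @` U).
Proof. exact: (expm_open complete nocp). Qed.

Lemma norm_ball_compact (r : R) : compact [set v : V | `|v| <= r].
Proof.
apply: bounded_closed_compact.
  exists r; split; first exact: num_real.
  by move=> x rx v /= vr; rewrite (le_trans vr)// ltW.
have -> : [set v : V | `|v| <= r] = (fun v : V => `|v|) @^-1` [set x | x <= r] by [].
apply: closed_comp; last exact: closed_le.
by move=> v _; exact: norm_continuous.
Qed.

(** At a limit time [x] the lifts [gg y] for y < x are chosen independently. By [lift_growth] their
    ends stay in a compact ball; a cluster point [w] lies over [c x], and the local section at [w]
    extends a lift that ends close enough to it. *)
Lemma lift_bounded_speed p c v0 (B : R) : continuous c -> expm p v0 = c 0 ->
  (forall t, 0 < t < 1 -> speed_le c t B) -> exists g, lifts_to (expm p) c v0 1 g.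
Proof.
move=> cc e0 sp; have H : forall x : R, 0 <= x <= 1 -> exists g, lifts_to (expm p) c v0 x g; last first.
  by apply: H; rewrite ler01 lexx.
have step (x : R) w : expm p w = c x -> exists2 e : R, 0 < e & exists2 U : set V, nbhs w U &
    forall s t, `|s - x| < e -> `|t - x| < e -> 0 <= s <= t ->
    (exists2 g, lifts_to (expm p) c v0 s g & U (g s)) -> exists g, lifts_to (expm p) c v0 t g.
  move=> ew; have [U [sg [oU Uw sgK sgc]]] := local_section (expm_injE p) (@openE p) w.
  have nU : nbhs w U by exact: open_nbhs_nbhs.
  have nc : nbhs (c x) (expm p @` U) by rewrite -ew; exact: openE.
  have [e e_gt0 he] := (near_normP _ _).1 (cc x _ nc).
  exists e => //; exists U => // s t sx tx /andP[s0 st] [g lg Ug].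
  have es : expm p (g s) = c s by case: lg => _ _; apply; rewrite s0 lexx.
  apply: (lift_extend cc lg (sg := sg)); first by rewrite s0.
    by rewrite -es sgK.
  move=> r /andP[sr rt]; have [|z Uz <-] := he r.
    by move: sx tx; rewrite !ltr_distl => /andP[? ?] /andP[? ?]; apply/andP; split; lra.
  by rewrite sgK//; split=> //; exact: sgc.
apply: real_induction.
- by exists (fun=> v0); exact: lift_cst.
- move=> x /andP[x0 x1] ih.
  have [|g lg] := ih x; first by rewrite x0 lexx.
  have ex : expm p (g x) = c x by case: lg => _ _; apply; rewrite x0 lexx.
  have [e e_gt0 [U nU he]] := step x _ ex.
  exists e => // y /andP[xy ye] y1; apply: (he x y).
  + by rewrite subrr normr0.
  + by rewrite gtr0_norm ?subr_gt0// ltrBlDl.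
  + by rewrite x0 ltW.
  + by exists g => //; exact: nbhs_singleton.
move=> x /andP[x0 x1] ih.
have [gg hg] : {gg : R -> R -> V & forall y : R, 0 <= y < x -> lifts_to (expm p) c v0 y (gg y)}.
  apply: (@choice R (R -> V) (fun (y : R) (g : R -> V) => 0 <= y < x -> lifts_to (expm p) c v0 y g)) => y.
  case: (boolP (0 <= y < x)) => [/ih[g hg]|_]; first by exists g.
  by exists (fun=> 0).
have [C C0 hC] := tnorm_norm p.
pose r := C * (tnorm p v0 + `|B|).
have bnd y : 0 <= y < x -> `|gg y y| <= r.
  move=> y0x; have [cg g0 lg] := hg y y0x.
  case/andP: y0x => y0 yx.
  rewrite (le_trans (hC _))// ler_wpM2l ?(ltW C0)//.
  have := @lift_growth R n M complete nocp p (gg y) c (fun t => `|B| * t) (fun=> `|B|) 0 y y0 cg lg.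
  rewrite g0 mulr0 subr0 => h; rewrite (le_trans (h _ _ _))//.
  + by apply: continuous_subspaceT => t; apply: cvgM; [exact: cvg_cst|exact: cvg_id].
  + by move=> t _; have := is_derive_scalel `|B| t; under eq_fun do rewrite [_ *: _]mulrC.
  + move=> t /andP[t0 ty]; have [|i [d [ic dc ds]]] := sp t.
      by rewrite t0 (lt_le_trans (lt_trans ty yx)).
    by exists i, d; split=> //; rewrite (le_trans ds)// ler_norm.
  + by rewrite lerD2l ler_piMr// (le_trans (ltW yx)).
have nx : \forall y \near x^'-, 0 <= y < x.
  near=> y; apply/andP; split; last by near: y; exact: nbhs_left_lt.
  by near: y; exact: nbhs_left_ge.
pose F := (fun y => gg y y) @ x^'-.
have Fr : F [set v | `|v| <= r] by rewrite /F /=; apply: filterS nx => y; exact: bnd.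
have [w [_ clw]] := norm_ball_compact (fmap_proper_filter (fun y => gg y y) (at_left_proper_filter x)) Fr.
have clw' (P : R -> Prop) (A : set V) : (\forall y \near x^'-, P y) -> nbhs w A ->
    exists y, [/\ P y, 0 <= y < x & A (gg y y)].
  move=> nP nA.
  have FP : F [set gg y y | y in [set y | P y /\ 0 <= y < x]].
    rewrite /F /=; near=> y; exists y => //; split; first by near: y.
    by near: y.
  by have [_ [[y [Py y0x] <-] Ay]] := clw _ _ FP nA; exists y.
have ew : expm p w = c x.
  apply: (@manifold_hausdorff R n M) => A B' nA nB.
  have nA' := expm_continuous complete nA.
  have nB' : \forall y \near x^'-, B' (c y) by exact: (cvg_at_left_filter (cc x)).
  have [y [By y0x Ay]] := clw' _ _ nB' nA'.
  exists (c y); split=> //; have [_ _ lg] := hg y y0x.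
  by rewrite -lg//; case/andP: y0x => -> _; rewrite lexx.
have [e e_gt0 [U nU he]] := step x w ew.
have ne : \forall y \near x^'-, `|y - x| < e.
  near=> y; rewrite distrC gtr0_norm; last by rewrite subr_gt0; near: y; exact: nbhs_left_lt.
  rewrite ltrBlDl -ltrBlDr; near: y; apply: nbhs_left_gt.
  by rewrite ltrBlDr ltrDl.
have [y [ye /andP[y0 yx] Uy]] := clw' _ _ ne nU.
apply: (he y x) => //; first by rewrite subrr normr0.
  by rewrite y0 ltW.
by exists (gg y) => //; apply: hg; rewrite y0.
Unshelve. all: by end_near. Qed.

Lemma ginner_continuous i x w : chart_dom i x ->
  {for x, continuous (fun x => ginner i x w w)}.
Proof.
move=> ix.
have d := @form_sdiff R n (fun (y : V) a b => metric i y a b) (chart i x) w w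
  (fun a b => metric_sdf a b ix).
have dv := sdiff_pair (sdiff_id (chart i x)) (sdiff_pair (sdiff_cst w (chart i x)) (sdiff_cst w (chart i x))).
have := sdiff_continuous (sdiff_comp dv d).
have -> : (fun x => ginner i x w w) = (fun y : V => form (fun y a b => metric i y a b) y w w) \o chart i.
  by apply/funext => z; rewrite ginner_form.
move=> cf; apply: (@continuous_comp _ _ _ (chart i)); last exact: cf.
exact: chart_continuous ix.
Qed.

(** [W] is a coordinate ball. The straight segments in it that start at [expm p v] have bounded
    speed and lift from [v]; the ends of the lifts form the section, which is continuous by
    [lift_param]. *)
Lemma expm_even p (y0 : M) : exists2 W : set M, nbhs y0 W & forall v, W (expm p v) ->
  exists2 sg : M -> V, sg (expm p v) = v &
    forall x : M, W x -> expm p (sg x) = x /\ {for x, continuous sg}.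
Proof.
set i := chart_at y0; have iy : chart_dom i y0 := chart_at_dom y0.
have [r r0 hr] := (near_normP _ _).1 (near_chart_img iy (@filterT _ _ (@nbhs_filter _ y0))).
have hb b : `|b - chart i y0| < r -> chart_dom i (chart_inv i b) /\ chart i (chart_inv i b) = b.
  by move=> /hr[? []].
exists [set x | chart_dom i x /\ `|chart i x - chart i y0| < r].
  suff nc : \forall y \near chart i y0, `|y - chart i y0| < r by exact: (near_chart iy nc).
  by apply/near_normP; exists r.
move=> v /= [iv vr]; set a := chart i (expm p v) in vr.
pose seg (b : V) (t : R) := a + t *: (b - a).
have segr b t : `|b - chart i y0| < r -> 0 <= t <= 1 -> `|seg b t - chart i y0| < r.
  move=> br /andP[t0 t1]; rewrite /seg.
  have -> : a + t *: (b - a) - chart i y0 = (1 - t) *: (a - chart i y0) + t *: (b - chart i y0).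
    by lmod_eq R.
  rewrite (le_lt_trans (ler_normD _ _))// !normrZ (ger0_norm t0) ger0_norm ?subr_ge0//.
  by apply: convex_lt; rewrite ?t0.
pose F (b : V) (t : R) := chart_inv i (seg b (clamp 0 1 t)).
have k01 t : 0 <= clamp 0 1 t <= (1 : R) by apply: clamp_itv; exact: ler01.
have iF b t : `|b - chart i y0| < r -> chart_dom i (F b t) /\ chart i (F b t) = seg b (clamp 0 1 t).
  by move=> br; apply: hb; exact: segr.
have cF (b : V) (t : R) : `|b - chart i y0| < r -> {for (b, t), continuous (fun z : V * R => F z.1 z.2)}.
  move=> br; apply: (@continuous_comp _ _ _ (fun z : V * R => seg z.1 (clamp 0 1 z.2)) (chart_inv i)).
    apply: cvgD; first exact: cvg_cst.
    apply: (@cvgZ _ _ _ _ _ (fun z : V * R => clamp 0 1 z.2) (fun z : V * R => z.1 - a)).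
      apply: (@continuous_comp _ _ _ snd (clamp 0 1)); first exact: cvg_snd.
      exact: clamp_continuous.
    by apply: cvgB; [exact: cvg_fst|exact: cvg_cst].
  by have [d <-] := iF b t br; exact: chart_inv_continuous d.
have cF2 b : `|b - chart i y0| < r -> continuous (F b).
  move=> br t; apply: (@continuous_comp _ _ _ (fun t => (b, t)) (fun z : V * R => F z.1 z.2)).
    by apply: continuous_pair; [exact: cvg_cst|exact: cvg_id].
  exact: cF.
have cF1 (b : V) (t : R) : `|b - chart i y0| < r -> {for b, continuous (F ^~ t)}.
  move=> br; apply: (@continuous_comp _ _ _ (fun b => (b, t)) (fun z : V * R => F z.1 z.2)).
    exact: continuous_pairl.
  exact: cF.
have F0 b : F b 0 = expm p v.
  by rewrite /F clamp_id ?lexx ?ler01// /seg scale0r addr0 chart_invK.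
have lift b : `|b - chart i y0| < r -> exists g, lifts_to (expm p) (F b) v 1 g.
  move=> br.
  (* The metric along the compact segment is bounded, which gives a speed bound for a constant
     coordinate velocity. *)
  have [|t0 _ ht0] := @EVT_max R (fun t => ginner i (F b t) (b - a) (b - a)) 0 1 ler01.
    apply: continuous_subspaceT => t.
    apply: (@continuous_comp _ _ _ (F b) (fun x => ginner i x (b - a) (b - a))); first exact: cF2.
    by apply: ginner_continuous; exact: (iF _ _ br).1.
  apply: (@lift_bounded_speed p (F b) v (Num.sqrt (ginner i (F b t0) (b - a) (b - a)))).
  - exact: cF2.
  - by rewrite F0.
  - move=> t /andP[t0' t1]; exists i, (b - a); split; first exact: (iF _ _ br).1.
    + have ds : is_derive t 1 (fun t => t *: (b - a) + a) (b - a).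
        have := is_deriveD (is_derive_scalel (b - a) t) (is_derive_cst a t 1).
        by rewrite addr0.
      apply: is_derive_near ds; apply/near_normP; exists (Num.min t (1 - t)) => [|s].
        by rewrite lt_min t0' subr_gt0.
      rewrite lt_min !ltr_distl => /andP[/andP[s1 s2] /andP[s3 s4]].
      have sI : 0 <= s <= 1 by move: s1 s2 s3 s4; clear; move=> *; apply/andP; split; lra.
      by rewrite -[RHS]/(chart i (F b s)) (iF b s br).2 (clamp_id sI) addrC.
    + rewrite /gnorm ler_sqrt; last by apply: ginner_ge0; exact: (iF _ _ br).1.
      by apply: ht0; rewrite in_itv /= !ltW.
have [G hG] : {G : V -> R -> V & forall b, `|b - chart i y0| < r -> lifts_to (expm p) (F b) v 1 (G b)}.
  apply: (@choice V (R -> V) (fun (b : V) (g : R -> V) => `|b - chart i y0| < r -> lifts_to (expm p) (F b) v 1 g)) => b.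
  case: (boolP (`|b - chart i y0| < r)) => [/lift[g hg]|_]; first by exists g.
  by exists (fun=> 0).
pose Fl b t := G b (clamp 0 1 t).
have cl0 : clamp 0 1 0 = 0 :> R by rewrite clamp_id ?lexx ?ler01.
have cl1 : clamp 0 1 1 = 1 :> R by rewrite clamp_id ?lexx ?ler01.
have Flc b : `|b - chart i y0| < r -> continuous (Fl b) /\ forall t, expm p (Fl b t) = F b t.
  move=> br; have [cg g0 lg] := hG b br; split=> [t|t].
    by apply: (@continuous_comp _ _ _ (clamp 0 1) (G b)); [exact: clamp_continuous|exact: cg].
  by rewrite /Fl lg// /F (clamp_id (k01 t)).
have Fl0 b : `|b - chart i y0| < r -> Fl b 0 = v.
  by move=> br; rewrite /Fl cl0; have [] := hG b br.
have nb b : `|b - chart i y0| < r -> \forall b' \near b, `|b' - chart i y0| < r.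
  move=> br; apply/near_normP; exists (r - `|b - chart i y0|) => [|b' hb'].
    by rewrite subr_gt0.
  rewrite -(subrK b b') -addrA (le_lt_trans (ler_normD _ _))//.
  by rewrite -ltrBrDr.
exists (fun x => Fl (chart i x) 1).
  have E : Fl a = fun=> v.
    apply: (@lift_unique R V M (expm p) rV_hausdorff (expm_injE p) (Fl a) (fun=> v) 0).
    - exact: (Flc a vr).1.
    - by move=> t; exact: cvg_cst.
    - move=> t; rewrite (Flc a vr).2 /F /seg subrr scaler0 addr0.
      exact: chart_invK.
    - exact: Fl0.
  by rewrite E.
move=> x [ix xr]; split.
  by rewrite (Flc _ xr).2 /F cl1 /seg scale1r subrKC chart_invK.
apply: (@continuous_comp _ _ _ (chart i) (Fl ^~ 1)); first exact: chart_continuous ix.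
apply: (@lift_param R V M (expm p) rV_hausdorff (expm_injE p) (@openE p) V F Fl (chart i x)).
- by move=> t; exact: cF.
- by move=> t; exact: cF1.
- by apply: filterS (nb _ xr) => b; exact: cF2.
- by apply: filterS (nb _ xr) => b; exact: Flc.
- have cv : {for chart i x, continuous (fun _ : V => v)} := @continuous_const V V v (chart i x).
  apply: near_continuous cv; apply: filterS (nb _ xr) => b br.
  by rewrite Fl0.
Qed.

Lemma expm_path_lift p c v0 : continuous c -> expm p v0 = c 0 -> exists g, lifts_to (expm p) c v0 1 g.
Proof. exact: (path_lift (expm_even p)). Qed.

Hypothesis simple : simply_connected R M.

Lemma within_clamp (T : topologicalType) (f : R -> T) : {within `[0, 1], continuous f} ->
  continuous (fun t => f (clamp 0 1 t)).
Proof.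
move=> /subspace_continuousP cf t A nA.
have k : 0 <= clamp 0 1 t <= (1 : R) by apply: clamp_itv; exact: ler01.
have kI : `[0, 1]%classic (clamp 0 1 t) by rewrite /= in_itv.
have nk : nbhs (clamp 0 1 t) [set y | `[0, 1]%classic y -> A (f y)] := cf _ kI A nA.
have nk2 : \forall s \near t, `[0, 1]%classic (clamp 0 1 s) -> A (f (clamp 0 1 s)) := @clamp_continuous R 0 1 t _ nk.
suff : \forall s \near t, A (f (clamp 0 1 s)) by [].
apply: filterS nk2 => s; apply.
by rewrite /= in_itv /=; apply: clamp_itv; exact: ler01.
Qed.

Lemma expm_surj p x : exists v, expm p v = x.
Proof.
have [f [cf f0 f1]] := simple.1 p x.
have c01 : clamp 0 1 0 = 0 :> R by rewrite clamp_id ?lexx ?ler01.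
have [|g [_ _ lg]] := @expm_path_lift p _ 0 (within_clamp cf).
  by rewrite c01 f0 expm0.
exists (g 1); rewrite lg ?lexx ?ler01// clamp_id ?lexx ?ler01//.
Qed.

(** The segment from [v] to [w] maps to a loop. The lifts of a contraction of this loop end over one
    fixed point, so their common end is constant: it is [w] for the loop itself and [v] for the
    constant loop. *)
Lemma expm_inj p : injective (expm (M := M) p).
Proof.
move=> v w E.
have c0 : clamp 0 1 0 = 0 :> R by rewrite clamp_id ?lexx ?ler01.
have c1 : clamp 0 1 1 = 1 :> R by rewrite clamp_id ?lexx ?ler01.
have k01 t : 0 <= clamp 0 1 t <= (1 : R) by apply: clamp_itv; exact: ler01.
pose seg t := v + t *: (w - v).
have cseg : continuous seg.
  move=> t; apply: cvgD; first exact: cvg_cst.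
  by apply: cvgZ; [exact: cvg_id|exact: cvg_cst].
pose f t := expm p (seg t).
have cf : continuous f.
  by move=> t; apply: (@continuous_comp _ _ _ seg); [exact: cseg|exact: (expm_continuous complete)].
have f0 : f 0 = expm p v by rewrite /f /seg scale0r addr0.
have f1 : f 1 = expm p v by rewrite /f /seg scale1r subrKC E.
have [|H [cH H0 H1]] := simple.2 f (continuous_subspaceT cf); first by rewrite f0 f1.
pose F s t := H (clamp 0 1 s, clamp 0 1 t).
have cF z : {for z, continuous (fun z : R * R => F z.1 z.2)}.
  move=> A nA; move/subspace_continuousP : cH => cH.
  have kI : (`[0, 1]%classic `*` `[0, 1]%classic) (clamp 0 1 z.1, clamp 0 1 z.2).
    by split; rewrite /= in_itv; exact: k01.
  have ck : {for z, continuous (fun z : R * R => (clamp 0 1 z.1, clamp 0 1 z.2))}.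
    apply: continuous_pair.
      by apply: (@continuous_comp _ _ _ fst (clamp 0 1)); [exact: cvg_fst|exact: clamp_continuous].
    by apply: (@continuous_comp _ _ _ snd (clamp 0 1)); [exact: cvg_snd|exact: clamp_continuous].
  have nk : nbhs (clamp 0 1 z.1, clamp 0 1 z.2) [set y | (`[0, 1]%classic `*` `[0, 1]%classic) y -> A (H y)] := cH _ kI A nA.
  have nk2 : \forall y \near z, (`[0, 1]%classic `*` `[0, 1]%classic) (clamp 0 1 y.1, clamp 0 1 y.2) -> A (F y.1 y.2) := ck _ nk.
  suff : \forall y \near z, A (F y.1 y.2) by [].
  apply: filterS nk2 => y; apply.
  by split; rewrite /= in_itv; exact: k01.
have cF2 s : continuous (F s).
  move=> t; apply: (@continuous_comp _ _ _ (fun t => (s, t)) (fun z : R * R => F z.1 z.2)).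
    by apply: continuous_pair; [exact: cvg_cst|exact: cvg_id].
  exact: cF.
have cF1 s t : {for s, continuous (F ^~ t)}.
  apply: (@continuous_comp _ _ _ (fun s => (s, t)) (fun z : R * R => F z.1 z.2)).
    exact: continuous_pairl.
  exact: cF.
have [G hG] : {G : R -> R -> V & forall s, lifts_to (expm p) (F s) v 1 (G s)}.
  apply: (@choice R (R -> V) (fun (s : R) (g : R -> V) => lifts_to (expm p) (F s) v 1 g)) => s.
  apply: expm_path_lift; first exact: cF2.
  by rewrite /F c0 (H1 _ _).1 ?in_itv//=.
pose Fl s t := G s (clamp 0 1 t).
have Flc s : continuous (Fl s) /\ forall t, expm p (Fl s t) = F s t.
  have [cg g0 lg] := hG s; split=> [t|t].
    by apply: (@continuous_comp _ _ _ (clamp 0 1) (G s)); [exact: clamp_continuous|exact: cg].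
  by rewrite /Fl lg// /F (clamp_id (k01 t)).
have Fl0 s : Fl s 0 = v by rewrite /Fl c0; have [] := hG s.
have cFl t s : {for s, continuous (Fl ^~ t)}.
  apply: (@lift_param R V M (expm p) rV_hausdorff (expm_injE p) (@openE p) R F Fl s).
  - by move=> t'; exact: cF.
  - by move=> t'; exact: cF1.
  - by apply/near_normP; exists 1 => // s' _; exact: cF2.
  - by apply/near_normP; exists 1 => // s' _; exact: Flc.
  - have cv : {for s, continuous (fun _ : R => v)} by exact: cvg_cst.
    by apply: near_continuous cv; apply/near_normP; exists 1 => // s' _; rewrite Fl0.
have E0 : Fl 0 = fun t => seg (clamp 0 1 t).
  apply: (@lift_unique R V M (expm p) rV_hausdorff (expm_injE p) _ _ 0).
  - exact: (Flc 0).1.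
  - by move=> t; apply: (@continuous_comp _ _ _ (clamp 0 1) seg); [exact: clamp_continuous|exact: cseg].
  - by move=> t; rewrite (Flc 0).2 /F c0 (H0 _ _).1 ?in_itv//=.
  - by rewrite Fl0 c0 /seg scale0r addr0.
have E1 : Fl 1 = fun=> v.
  apply: (@lift_unique R V M (expm p) rV_hausdorff (expm_injE p) _ _ 0).
  - exact: (Flc 1).1.
  - by move=> t; exact: cvg_cst.
  - by move=> t; rewrite (Flc 1).2 /F c1 (H0 _ _).2 ?in_itv//=.
  - exact: Fl0.
have E2 : Fl ^~ 1 = fun=> Fl 0 1.
  apply: (@lift_unique R V M (expm p) rV_hausdorff (expm_injE p) _ _ 0).
  - by move=> s; exact: cFl.
  - by move=> t; exact: cvg_cst.
  - move=> s; rewrite !(Flc _).2 /F c1.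
    by rewrite (H1 _ _).2 ?in_itv ?k01//= (H1 _ _).2 ?in_itv ?k01.
  - by [].
have := congr1 (@^~ 1) E2; rewrite /= E1 E0 c1 /seg scale1r subrKC.
by [].
Qed.

End LiftingCurves.

(** * The Riemannian distance and isometries *)

Section Distance.
Context {R : realType} {n : nat} (M : riemannianManifold R n).
Local Notation V := 'rV[R]_n.
Implicit Types (i j : chart_idx M) (p q x y z : M) (u v w h : V) (r s t : R) (c : R -> M).

Lemma ginner_state_continuous i (c : R -> M) (u : R -> V) t : {for t, continuous c} ->
  {for t, continuous u} -> chart_dom i (c t) ->
  {for t, continuous (fun s => ginner i (c s) (u s) (u s))}.
Proof.
move=> cc cu it.
have d := @form_sdiff R n (fun (y : V) a b => metric i y a b) (chart i (c t)) (u t) (u t)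
  (fun a b => metric_sdf a b it).
have cf := sdiff_continuous d.
have -> : (fun s => ginner i (c s) (u s) (u s)) =
  (fun s => form (fun (y : V) a b => metric i y a b) (chart i (c s)) (u s) (u s)).
  by apply/funext => s; rewrite ginner_form.
apply: (@continuous_comp _ _ _ (fun s => (chart i (c s), (u s, u s)))
  (fun z : V * (V * V) => form (fun (y : V) a b => metric i y a b) z.1 z.2.1 z.2.2)); last exact: cf.
apply: continuous_pair; last exact: continuous_pair.
by apply: (@continuous_comp _ _ _ c (chart i)); [exact: cc|exact: chart_continuous it].
Qed.

Lemma curve_speed c i t : curve_C1 c -> chart_dom i (c t) ->
  tnorm (c t) (velocity c t) = gnorm i (c t) (derive1 (chart i \o c) t).
Proof.
move=> [cc dc] it; have jt := chart_at_dom (c t).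
have [/derivable_derive1 d1 _] := dc i t it.
rewrite /velocity (derive1_is_derive (curve_trans (cc t) it jt d1)).
by rewrite /tnorm -ginner_inner -/(gnorm _ _ _) gnorm_trans.
Qed.

Lemma speed_continuous c : curve_C1 c -> continuous (fun t => tnorm (c t) (velocity c t)).
Proof.
move=> Cc t; have it := chart_at_dom (c t); set i := chart_at (c t) in it.
have [_ cd] := Cc.2 i t it.
have cG : {for t, continuous (fun s => gnorm i (c s) (derive1 (chart i \o c) s))}.
  apply: (@continuous_comp _ _ _ (fun s => ginner i (c s) (derive1 (chart i \o c) s) (derive1 (chart i \o c) s)) Num.sqrt).
    exact: ginner_state_continuous (Cc.1 t) cd it.
  exact: sqrt_continuous.
apply: near_continuous cG.
have : \forall s \near t, chart_dom i (c s) by apply: (Cc.1 t); exact: nbhs_dom.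
by apply: filterS => s it'; rewrite (curve_speed Cc it').
Qed.

Lemma curve_length_primitive c : curve_C1 c -> exists S : R -> R,
  [/\ {within `[0, 1], continuous S},
      forall t, 0 < t < 1 -> is_derive t 1 S (tnorm (c t) (velocity c t)) &
      S 1 - S 0 = curve_length c].
Proof.
move=> Cc; have cs := speed_continuous Cc; set f := fun t => _ in cs.
have fi : lebesgue_measure.-integrable `[0, 1] (EFin \o f).
  by apply: continuous_compact_integrable; [exact: segment_compact|exact: continuous_subspaceT].
exists (fun x : R => \int[lebesgue_measure]_(t in `[0, x]) f t); split.
- exact: (parameterized_integral_continuous ler01 fi).
- move=> t /andP[t0 t1].
  have [df fE] := continuous_FTC1_closed t1 fi t0 (cs t).
  by have := derivable_derive1 df; rewrite fE.
- by rewrite set_itv1 Rintegral_set1 subr0.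
Qed.

Lemma cgeodesic_curve_C1 c : cgeodesic c -> curve_C1 c.
Proof.
move=> [cc gc]; split=> // i t it; have [d1 d2] := gc i t it; split; first exact: ex_derive.
by apply/differentiable_continuous/derivable1_diffP; exact: ex_derive.
Qed.

Lemma pw_joins_cat x y z (L L' : R) : pw_joins x y L -> pw_joins y z L' -> pw_joins x z (L + L').
Proof.
move=> xy; elim: xy z L' => {x y L} [x z L'|c y L Cc _ ih z L' yz]; first by rewrite add0r.
by rewrite -addrA; apply: pw_cons => //; exact: ih.
Qed.

Lemma curve_length_ge0 c : 0 <= curve_length c.
Proof. by apply: Rintegral_ge0 => t _; exact: tnorm_ge0. Qed.

Lemma pw_joins_ge0 x y (L : R) : pw_joins x y L -> 0 <= L.
Proof. by elim=> // c z L' _ _ ih; rewrite addr_ge0// curve_length_ge0. Qed.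

Lemma tnorm0 p : tnorm p (0 : V) = 0.
Proof. by rewrite -(scale0r (0 : V)) tnormZ normr0 mul0r. Qed.

Lemma tnorm_eq0 p v : tnorm p v = 0 -> v = 0.
Proof. by have [//|/(tnorm_gt0 p)/lt0r_neq0/eqP] := eqVneq v 0. Qed.

Hypothesis complete : complete_manifold M.
Hypothesis nocp : no_conjugate_points M.
Hypothesis simple : simply_connected R M.

Lemma gam_velocity p v t : tnorm (gam p v t) (velocity (gam p v) t) = tnorm p v.
Proof. by rewrite /tnorm -ginner_inner gam_speed//; exact: chart_at_dom. Qed.

Lemma gam_length p v : curve_length (gam (M := M) p v) = tnorm p v.
Proof.
rewrite /curve_length; under eq_Rintegral do rewrite gam_velocity.
by rewrite Rintegral_cst//= lebesgue_measure_itv/= lte01 oppr0 adde0 mulr1.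
Qed.

Lemma pw_joins_expm p v : pw_joins p (expm p v) (tnorm p v).
Proof.
have := pw_cons (cgeodesic_curve_C1 (gam_cgeodesic complete p v)) (pw_refl _).
by rewrite gam0// gam_length addr0.
Qed.

Lemma pw_joins_lift p q y (L : R) : pw_joins q y L -> forall v, expm p v = q ->
  exists2 w, expm p w = y & tnorm p w <= tnorm p v + L.
Proof.
elim=> {q y L} [q v <-|c y L Cc _ ih v vE]; first by exists v => //; rewrite addr0.
have [g [cg g0 lg]] := expm_path_lift complete nocp Cc.1 vE.
have [S [cS dS SE]] := curve_length_primitive Cc.
have [|w wE hw] := ih (g 1); first by rewrite lg// ler01 lexx.
exists w => //; rewrite addrA (le_trans hw)// lerD2r -g0 -SE.
apply: (lift_growth complete nocp ler01 cg lg cS dS) => t t01.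
exists (chart_at (c t)), (derive1 (chart (chart_at (c t)) \o c) t).
have it := chart_at_dom (c t); split; [exact: it| |by rewrite (curve_speed Cc it)].
by apply: derivable_derive1; have [] := Cc.2 _ t it.
Qed.

Definition logm p x : V := xget 0 [set v | expm p v = x].

Lemma logmK p x : expm p (logm p x) = x.
Proof.
have [v vE] := expm_surj complete nocp simple p x.
exact: (@xgetPex _ (0 : V) [set v | expm p v = x] (ex_intro _ v vE)).
Qed.

Lemma expmK p v : logm p (expm p v) = v.
Proof. by apply: (expm_inj complete nocp simple (p := p)); rewrite logmK. Qed.

Lemma logm_continuous p : continuous (logm p).
Proof.
move=> x A nA; have nE := @expm_open R n M complete nocp p (logm p x) A nA.
rewrite logmK in nE; suff : \forall y \near x, A (logm p y) by [].
by apply: filterS nE => _ [v Av <-]; rewrite expmK.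
Qed.

(** The radial geodesic has length |v|. Any other joining curve lifts from 0 to a vector over the
    same point, which is [v] by injectivity, and is at least as long as the growth of the norm along
    the lift. *)
Lemma dist_expm p v : dist p (expm p v) = tnorm p v.
Proof.
have ne : [set L | pw_joins p (expm p v) L] !=set0 by exists (tnorm p v); exact: pw_joins_expm.
apply/eqP; rewrite eq_le; apply/andP; split.
  apply: ge_inf; last exact: pw_joins_expm.
  by exists 0 => L; exact: pw_joins_ge0.
apply: lb_le_inf => // L /(@pw_joins_lift p)/(_ 0 (expm0 complete p))[w].
move=> /(expm_inj complete nocp simple) ->.
by rewrite tnorm0 add0r.
Qed.

Lemma dist_logm p x : dist p x = tnorm p (logm p x).
Proof. by rewrite -{1}(logmK p x) dist_expm. Qed.

Lemma dist_ge0 x y : 0 <= dist x y.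
Proof. by rewrite dist_logm tnorm_ge0. Qed.

Lemma dist_continuous p : continuous (dist p).
Proof.
have -> : dist p = tnorm p \o logm p by apply/funext => x; exact: dist_logm.
by move=> x; apply: continuous_comp; [exact: logm_continuous|exact: tnorm_continuous].
Qed.

Lemma dist_triangle x y z : dist x z <= dist x y + dist y z.
Proof.
apply: ge_inf; first by exists 0 => L; exact: pw_joins_ge0.
apply: (@pw_joins_cat _ y).
  by have := pw_joins_expm x (logm x y); rewrite logmK -dist_logm.
by have := pw_joins_expm y (logm y z); rewrite logmK -dist_logm.
Qed.

Lemma distxx x : dist x x = 0.
Proof. by rewrite -{2}(expm0 complete x) dist_expm tnorm0. Qed.

Lemma dist_eq0 x y : dist x y = 0 -> x = y.
Proof.
by rewrite dist_logm => /tnorm_eq0 E; rewrite -(logmK x y) E expm0.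
Qed.

Lemma cgeodesic_gam c : cgeodesic c -> c = gam (c 0) (cvel (chart_at (c 0)) c 0).
Proof. by move=> gc; apply/esym/gam_eq; split. Qed.

Lemma geodesic_affine c (a b : R) : is_geodesic c -> `|a| = 1 -> is_geodesic (fun t => c (a * t + b)).
Proof.
move=> gc a1; have gc' := cgeodesic_affine a b (is_geodesic_cgeodesic gc).
rewrite (cgeodesic_gam gc'); apply: (gam_geodesic complete).
rewrite mulr0 add0r; set i := chart_at (c b).
have ib : chart_dom i (c b) := chart_at_dom _.
have [d _] := (is_geodesic_cgeodesic gc).2 i (a * 0 + b) (ltac:(rewrite mulr0 add0r; exact: ib)).
have -> : cvel i (fun t => c (a * t + b)) 0 = a *: cvel i c b.
  by rewrite /cvel (derive1_is_derive (is_derive_affine d)) mulr0 add0r.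
rewrite tnormZ a1 mul1r; have [_ + _] := gc; exact.
Qed.

Lemma geodesic_shift c s : is_geodesic c -> is_geodesic (fun t => c (t + s)).
Proof.
move=> /(@geodesic_affine _ 1 s)/(_ (normr1 _)).
by under eq_fun do rewrite mul1r.
Qed.

Lemma geodesic_dist0 c t : is_geodesic c -> dist (c 0) (c t) = `|t|.
Proof.
move=> gc; rewrite {2}(geodesic_gam gc) gam_expm// dist_expm tnormZ.
by have [_ -> _] := gc; rewrite mulr1.
Qed.

Lemma geodesic_dist c s t : is_geodesic c -> dist (c s) (c t) = `|t - s|.
Proof.
move=> gc; have := geodesic_dist0 (t - s) (geodesic_shift s gc).
by rewrite add0r subrK.
Qed.

Lemma geodesic_eq c c' t : is_geodesic c -> is_geodesic c' -> c 0 = c' 0 -> t != 0 ->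
  c t = c' t -> c = c'.
Proof.
move=> gc gc' e0 t0 et; have E := geodesic_gam gc; have E' := geodesic_gam gc'.
set v := velocity c 0 in E; set v' := velocity c' 0 in E'.
rewrite -e0 in E'.
have et' : expm (c 0) (t *: v) = expm (c 0) (t *: v').
  rewrite -(gam_expm complete _ v) -(gam_expm complete _ v').
  exact: (etrans (esym (congr1 (@^~ t) E)) (etrans et (congr1 (@^~ t) E'))).
suff vv : v = v' by exact: (etrans E (etrans (congr1 (gam (c 0)) vv) (esym E'))).
apply: (scalerI t0); apply: (expm_inj complete nocp simple (p := c 0)).
exact: et'.
Qed.

Lemma geodesic_between p x : p <> x -> exists c,
  [/\ is_geodesic c, c 0 = p & c (dist p x) = x].
Proof.
move=> px; have d0 : dist p x != 0 by apply/eqP => /dist_eq0.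
exists (gam p ((dist p x)^-1 *: logm p x)); split.
- apply: gam_geodesic => //; rewrite tnormZ -dist_logm ger0_norm ?invr_ge0 ?dist_ge0//.
  by rewrite mulVf.
- by rewrite gam0.
- by rewrite gam_expm// scalerA mulfV// scale1r logmK.
Qed.

(** Symmetry is read off a geodesic joining the points, on which [dist] is the absolute value of a
    difference; no reversal of piecewise curves occurs. *)
Lemma dist_sym x y : dist x y = dist y x.
Proof.
have [->//|/eqP/geodesic_between[c [gc <- E]]] := eqVneq x y.
have d0 := dist_ge0 (c 0) y; move: (dist (c 0) y) d0 E => d d0 <-.
by rewrite (geodesic_dist d 0 gc) sub0r normrN ger0_norm.
Qed.

(** * Isometries map geodesics to geodesics *)

Section Isometries.
Variable f : M -> M.
Hypothesis isof : is_isometry f.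

Lemma open_chart_preimage i j : open (chart i @` (chart_dom i `&` f @^-1` chart_dom j)).
Proof.
have [[cf _] _ _] := isof.
rewrite openE => _ [x [ix jx] <-]; rewrite /interior.
have := near_chart_img ix (cf x _ (nbhs_dom jx)); apply: filterS => y [iy [jy yE]].
by exists (chart_inv i y).
Qed.

Lemma isometry_sdiff i j x : chart_dom i x -> chart_dom j (f x) ->
  sdiff (chart j \o f \o chart_inv i) (chart i x)
    (fun h => h *m 'J (chart j \o f \o chart_inv i) (chart i x)).
Proof.
have [[_ sf] _ _] := isof; move=> ix jx.
have dk (a : 'I_1) (k : 'I_n) := class_C1_sdiff (@open_chart_preimage i j)
  (ex_intro2 _ _ x (conj ix jx) erefl) (sf i j k 1%N).
have E : (fun y : V => \matrix_(a, k) chart j (f (chart_inv i y)) 0 k) = chart j \o f \o chart_inv i.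
  by apply/funext => y; apply/rowP => k; rewrite mxE.
have := sdiff_mx dk; rewrite E => H.
exact: (sdiff_ext H (sdiff_jacobian H)).
Qed.

Lemma isometry_derive c t i j d : {for t, continuous c} -> chart_dom i (c t) ->
  chart_dom j (f (c t)) -> is_derive t 1 (chart i \o c) d ->
  exists2 e, is_derive t 1 (chart j \o (f \o c)) e & gnorm j (f (c t)) e = gnorm i (c t) d.
Proof.
have [_ pf _] := isof; move=> cc ic jc dc.
exists (d *m 'J (chart j \o f \o chart_inv i) (chart i (c t))); last first.
  rewrite /gnorm /ginner; congr Num.sqrt; have /= -> := pf i j (c t) ic jc.
  by rewrite trmx_mul !mulmxA.
have H := is_derive_sdiff dc (isometry_sdiff ic jc).
apply: is_derive_near H.
have : \forall s \near t, chart_dom i (c s) by apply: cc; exact: nbhs_dom.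
by apply: filterS => s /= /chart_invK ->.
Qed.

(** The image of the geodesic from [x] to [y] has the same speed, and its lift grows no faster. For
    group elements equality follows from the same bound for the inverse. *)
Lemma isometry_dist_le x y : dist (f x) (f y) <= dist x y.
Proof.
have [[cf _] _ _] := isof.
set v := logm x y; rewrite [leRHS]dist_logm -/v.
have gc := gam_cgeodesic complete x v; set c := gam x v in gc.
have cfc : continuous (f \o c) by move=> t; apply: continuous_comp; [exact: gc.1|exact: cf].
have [|g [cg g0 lg]] := @expm_path_lift R n M complete nocp (f x) (f \o c) 0 cfc.
  by rewrite expm0//= /c gam0.
have E1 : expm (f x) (g 1) = f y.
  by rewrite lg ?ler01 ?lexx//= /c -/(expm x v) logmK.
rewrite -E1 dist_expm.
have := @lift_growth R n M complete nocp (f x) g (f \o c) (fun t => tnorm x v * t)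
  (fun=> tnorm x v) 0 1 ler01 cg lg.
rewrite g0 tnorm0 mulr0 mulr1 subr0 add0r; apply.
- by apply: continuous_subspaceT => t; apply: cvgM; [exact: cvg_cst|exact: cvg_id].
- by move=> t _; have := is_derive_scalel (tnorm x v) t; under eq_fun do rewrite [_ *: _]mulrC.
- move=> t _; have it := chart_at_dom (c t); have jt := chart_at_dom (f (c t)).
  have [d _] := gc.2 _ t it.
  have [e de eE] := isometry_derive (gc.1 t) it jt d.
  exists (chart_at (f (c t))), e; split; [exact: jt|exact: de|].
  by rewrite /= eE /gnorm /c gam_speed.
Qed.

Hypothesis distf : forall x y, dist (f x) (f y) = dist x y.

Lemma jfield_radial p v i : chart_dom i (expm p v) -> jfield p v v i 1 = cvel i (gam (M := M) p v) 1.
Proof.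
move=> ie; have dE := gam_chart_sdiff complete ie.
have dl : is_derive (1 : R) 1 (fun s => s *: v) v by exact: is_derive_scalel.
have dE1 : sdiff (fun v => chart i (gam p v 1)) ((1 : R) *: v) (fun h => jfield p v h i 1).
  by rewrite scale1r.
have := is_derive_sdiff dl dE1.
have -> : (fun s => chart i (gam p (s *: v) 1)) = chart i \o gam p v.
  by apply/funext => s; rewrite /= gamZ// mulr1.
by move=> /derive1_is_derive.
Qed.

(* Equality in the Gauss and Cauchy-Schwarz inequalities forces the image of a
   geodesic to be radial. *)
Lemma isometry_ray c : is_geodesic c -> exists2 v, tnorm (f (c 0)) v = 1 &
  forall t, 0 <= t -> f (c t) = gam (f (c 0)) v t.
Proof.
have [[cf _] _ _] := isof.
move=> gc; have gc' := is_geodesic_cgeodesic gc; set p := f (c 0).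
pose w t := logm p (f (c t)).
have wE t : expm p (w t) = f (c t) by exact: logmK.
have cw : continuous w.
  move=> t; apply: (@continuous_comp _ _ _ (f \o c) (logm p)); last exact: logm_continuous.
  by apply: continuous_comp; [exact: gc'.1|exact: cf].
have wN t : tnorm p (w t) = `|t| by rewrite -dist_logm distf geodesic_dist0.
(* From |w t| = |t| one gets <w, h> = t, so by the Gauss lemma the unit vector [e] has product [t]
   with the radial vector [k] of length [t]. This forces e = k / t, and injectivity of the
   differential gives h = w / t. *)
have dw t : 0 < t -> is_derive t 1 w (t^-1 *: w t).
  move=> t0; have it := chart_at_dom (c t); have jt := chart_at_dom (f (c t)).
  set j := chart_at (f (c t)) in jt.
  have [d _] := gc'.2 _ t it.
  have [e de eE] := isometry_derive (gc'.1 t) it jt d.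
  have jw : chart_dom j (expm p (w t)) by rewrite wE.
  have [|h dh jh] := expm_lift_derive complete nocp (cw t) jw de.
    by apply/near_normP; exists 1 => // s _; exact: wE.
  have e1 : gnorm j (f (c t)) e = 1.
    by rewrite eE /gnorm (geodesic_speed gc it) sqrtr1.
  have hN : inner p (w t) h = t.
    have d1 := is_derive_inner p dh.
    have E : (fun s => inner p (w s) (w s)) = (fun s => s * s).
      by apply/funext => s; rewrite -tnorm_sqr wN -normrX ger0_norm ?sqr_ge0.
    rewrite E in d1.
    have d2 : is_derive t 1 (fun s : R => s * s) (t *: 1 + t *: 1).
      exact: (is_deriveM (is_derive_id t 1) (is_derive_id t 1)).
    have := derive1_is_derive d2; rewrite (derive1_is_derive d1) /= => E2.
    have : 2 * inner p (w t) h = 2 * t by rewrite E2 /GRing.scale /= !mulr1 mulr_natl mulr2n.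
    by apply: mulfI; rewrite pnatr_eq0.
  have G := @gauss_jfield R n M complete p (w t) h j 1 jw.
  rewrite mul1r hN jh in G.
  set k := cvel j (gam p (w t)) 1 in G.
  have kN : gnorm j (expm p (w t)) k = t.
    by rewrite /gnorm gam_speed// -tnorm_sqr sqrtr_sqr wN normr_id gtr0_norm.
  have k0 : k != 0.
    apply/eqP => k0; move: kN; rewrite k0 /gnorm ginner0l sqrtr0 => t00.
    by rewrite t00 ltxx in t0.
  have e1' : gnorm j (expm p (w t)) e = 1 by rewrite wE.
  have eK : e = t^-1 *: k.
    have := @cauchy_schwarz_eq R n M j (expm p (w t)) e k jw k0; rewrite kN e1' mul1r => H.
    by rewrite -div1r; exact: H.
  suff hE : h - t^-1 *: w t = 0 by rewrite -(subr0_eq hE).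
  have [D _ [hD _]] := expm_chart complete nocp jw.
  apply: (expm_diff_inj complete nocp jw).
  by rewrite hD mulmxBl -scalemxAl -!hD jh eK jfield_radial// subrr.
have w1 : tnorm p (w 1) = 1 by rewrite wN normr1.
exists (w 1) => // t; rewrite le_eqVlt => /orP[/eqP <-|t0].
  by rewrite gam0.
pose q s := s^-1 *: w s.
have dq s : 0 < s -> is_derive s 1 q 0.
  move=> s0; have sn : s != 0 by rewrite gt_eqF.
  have dinv := sdiff_is_derive (1 : R) (sdiff_inv sn).
  have := is_derive_sdiff (is_derive_pair dinv (dw s s0)) (sdiff_scale_pair (s^-1, w s)).
  suff -> : s^-1 *: (s^-1 *: w s) + (- (s ^- 2) * 1) *: w s = 0 by [].
  by rewrite scalerA -scalerDl mulr1 -expr2 exprVn addrN scale0r.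
have qt : q t = q 1.
  have [t1|t1] := leP t 1.
    have : `|q 1 - q t| <= 0 * (1 - t).
      apply: (@mean_value_inequality R _ q (fun=> 0)) => // s; last by rewrite normr0.
      by move=> /andP[ts _]; apply: dq; exact: lt_le_trans ts.
    by rewrite mul0r normr_le0 subr_eq0 => /eqP.
  have : `|q t - q 1| <= 0 * (t - 1).
    apply: (@mean_value_inequality R _ q (fun=> 0)) => [|s|s _]; first exact: ltW.
      by move=> /andP[ts _]; apply: dq; exact: lt_le_trans ts.
    by rewrite normr0.
  by rewrite mul0r normr_le0 subr_eq0 => /eqP.
have -> : w 1 = q t by rewrite qt /q invr1 scale1r.
by rewrite gam_expm// /q scalerA mulfV ?gt_eqF// scale1r.
Qed.

(** [isometry_ray] reaches non-negative times only. For t < 0 the ray based at [c t] overlaps the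
    one based at [c 0], and two geodesics that share two points coincide. *)
Lemma isometry_geodesic c : is_geodesic c -> is_geodesic (f \o c).
Proof.
move=> gc.
have [v0 v01 h0] := isometry_ray gc.
have g0 := gam_geodesic complete v01; set c0 := gam (f (c 0)) v0 in g0 h0.
suff -> : f \o c = c0 by [].
apply/funext => t; have [t0|t0] := leP 0 t; first exact: h0.
have [v1 v11 h1] := isometry_ray (geodesic_shift t gc).
rewrite add0r in v11 h1.
have g1 := gam_geodesic complete v11; set c1 := gam (f (c t)) v1 in g1 h1.
have g2 := geodesic_shift (- t) g1.
have E : c0 = fun s => c1 (s - t).
  apply: (geodesic_eq (t := 1) g0 g2) => //.
    by rewrite add0r -h1 ?oppr_ge0 ?(ltW t0)// addNr /c0 gam0.
  rewrite -h0// -h1 ?subrK//.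
  by rewrite subr_ge0 (le_trans (ltW t0)).
by rewrite E subrr /c1 gam0.
Qed.

End Isometries.
End Distance.

(** * Visibility and the ideal boundary *)

(** The limit is an infimum. The two conclusions are the form in which Busemann functions are
    bounded from above and from below. *)
Lemma lim_nonincreasing (R : realType) (f : R -> R) (L : R) :
  (forall s t, s <= t -> f t <= f s) -> (forall t, 0 <= t -> L <= f t) ->
  (forall t, lim (f t @[t --> +oo]) <= f t) /\
  (forall A t0 : R, (forall t, t0 <= t -> A <= f t) -> A <= lim (f t @[t --> +oo])).
Proof.
move=> nf Lf; pose I := [set f t | t in [set t | 0 <= t]].
have hI : has_inf I.
  split; first by exists (f 0); exists 0 => /=.
  by exists L => _ [t t0 <-]; exact: Lf.
have lI t : inf I <= f t.
  apply: (@le_trans _ _ (f (Num.max 0 t))); last by apply: nf; rewrite le_max lexx orbT.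
  by apply: ge_inf; [exact: hI.2|exists (Num.max 0 t) => //=; rewrite le_max lexx].
have cf : f t @[t --> +oo] --> inf I.
  apply/cvgrPdist_le => e e0.
  have [_ [t0 t00 <-] ht0] := inf_adherent e0 hI.
  exists t0; split; first exact: num_real.
  move=> t /ltW tt; rewrite distrC ger0_norm ?subr_ge0//.
  by rewrite lerBlDl (le_trans (nf _ _ tt))// ltW.
have -> : lim (f t @[t --> +oo]) = inf I by exact: cvg_lim.
split=> // A t0 hA; apply: lb_le_inf; first exact: hI.1.
move=> _ [t t_ge0 <-]; have [tt|/ltW tt] := leP t0 t; first exact: hA.
by rewrite (le_trans (hA t0 (lexx _)))// nf.
Qed.

Section Boundary.
Context {R : realType} {n : nat} (M : riemannianManifold R n).
Local Notation V := 'rV[R]_n.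
Implicit Types (p q x y z : M) (u v w : V) (r s t : R) (c : R -> M) (xi eta : ideal_boundary M).
Hypothesis complete : complete_manifold M.
Hypothesis nocp : no_conjugate_points M.
Hypothesis simple : simply_connected R M.
Hypothesis vis : visibility M.

Local Notation dist_sym := (dist_sym complete nocp simple).
Local Notation dist_triangle := (dist_triangle complete nocp simple).
Local Notation dist_ge0 := (dist_ge0 complete nocp simple).
Local Notation geodesic_dist := (geodesic_dist complete nocp simple).
Local Notation geodesic_eq := (geodesic_eq complete nocp simple).
Local Notation distxx := (distxx complete nocp simple).

Lemma asymptotic_sym c c' : asymptotic c c' -> asymptotic c' c.
Proof. by move=> [C hC]; exists C => t t0; rewrite dist_sym; exact: hC. Qed.

Lemma asymptotic_trans c1 c2 c3 : asymptotic c1 c2 -> asymptotic c2 c3 -> asymptotic c1 c3.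
Proof.
move=> [C hC] [D hD]; exists (C + D) => t t0.
by rewrite (le_trans (dist_triangle _ (c2 t) _))// lerD ?hC ?hD.
Qed.

Lemma asymptotic_refl c : asymptotic c c.
Proof. by exists 0 => t _; rewrite distxx. Qed.

Lemma at_infinity_ex xi : exists c, is_geodesic c /\ at_infinity c xi.
Proof.
case: xi => xi /= [c gc E]; exists c; split=> //; rewrite /at_infinity /= E.
by split=> //; exact: asymptotic_refl.
Qed.

Lemma at_infinity_geodesic c xi : at_infinity c xi -> is_geodesic c.
Proof. by case: xi => xi /= [c' gc' E]; rewrite /at_infinity /= E => -[]. Qed.

Lemma at_infinity_asymptotic c c' xi : at_infinity c xi -> at_infinity c' xi -> asymptotic c c'.
Proof.
case: xi => xi /= [c0 gc0 E]; rewrite /at_infinity /= E => -[_ h] [_ h'].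
exact: asymptotic_trans (asymptotic_sym h) h'.
Qed.

Lemma asymptotic_at_infinity c c' xi : at_infinity c xi -> is_geodesic c' -> asymptotic c c' ->
  at_infinity c' xi.
Proof.
case: xi => xi /= [c0 gc0 E]; rewrite /at_infinity /= E => -[_ h] gc' h'.
by split=> //; exact: asymptotic_trans h h'.
Qed.

Lemma at_infinity_eq c xi eta : at_infinity c xi -> at_infinity c eta -> xi = eta.
Proof.
move=> cx ce; suff E : sval xi = sval eta by case: xi eta E {cx ce} => a ha [b hb] /= E; exact: eq_exist.
apply/funext => c'; apply/propext; split=> h.
  exact: asymptotic_at_infinity ce (at_infinity_geodesic h) (at_infinity_asymptotic cx h).
exact: asymptotic_at_infinity cx (at_infinity_geodesic h) (at_infinity_asymptotic ce h).
Qed.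

Lemma ideal_of c : is_geodesic c -> exists xi, at_infinity c xi.
Proof.
move=> gc; exists (exist _ (asymptote_class c) (ex_intro2 _ _ c gc erefl)).
by split=> //; exact: asymptotic_refl.
Qed.

Lemma geod_unique p (x : bordification M) c : is_geodesic c -> c 0 = p -> goes_to c x ->
  (forall c', is_geodesic c' -> c' 0 = p -> goes_to c' x -> c' = c) -> geod p x = c.
Proof.
move=> gc c0 cx uniq; rewrite /geod.
have [h1 h2 h3] := @xgetPex _ (cst p) [set c | [/\ is_geodesic c, c 0 = p & goes_to c x]]
  (ex_intro _ c (And3 gc c0 cx)).
exact: uniq.
Qed.

Lemma geod_point c t : is_geodesic c -> 0 < t -> geod (c 0) (of_point (c t)) = c.
Proof.
move=> gc t0; apply: geod_unique => //; first by exists t.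
move=> c' gc' e0 [t' t'0 E].
have tt : t' = t.
  have := geodesic_dist0 complete nocp simple t' gc'; rewrite E e0 geodesic_dist0//.
  by rewrite !gtr0_norm.
by rewrite tt in E; apply: geodesic_eq E => //; rewrite gt_eqF.
Qed.

Lemma geod_pointP p z : p <> z -> [/\ is_geodesic (geod p (of_point z)), geod p (of_point z) 0 = p &
  geod p (of_point z) (dist p z) = z].
Proof.
move=> pz; have [c [gc c0 cz]] := geodesic_between complete nocp simple pz.
have d0 : 0 < dist p z.
  by rewrite lt_neqAle dist_ge0 andbT eq_sym; apply/eqP => /(dist_eq0 complete nocp simple).
have := geod_point gc d0; rewrite cz c0 => ->.
by [].
Qed.

Lemma inner_bound p u v : tnorm p u = 1 -> tnorm p v = 1 -> -1 <= inner p u v <= 1.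
Proof.
move=> u1 v1.
have cs a b : tnorm p a = 1 -> tnorm p b = 1 -> inner p a b <= 1.
  move=> a1 b1; have := cauchy_schwarz a b (chart_at_dom p).
  by rewrite ginner_inner /gnorm ginner_inner -!/(tnorm p _) a1 b1 mulr1.
apply/andP; split; last exact: cs.
rewrite lerNl -mulN1r -innerZl; apply: cs => //.
by rewrite tnormZ normrN normr1 mul1r.
Qed.

Lemma tangle_unit p u v : tnorm p u = 1 -> tnorm p v = 1 -> tangle p u v = acos (inner p u v).
Proof. by move=> u1 v1; rewrite /tangle u1 v1 mulr1 divr1. Qed.

Lemma tnorm_sub_sqr p u v : tnorm p u = 1 -> tnorm p v = 1 ->
  tnorm p (u - v) ^+ 2 = 2 - 2 * inner p u v.
Proof.
move=> u1 v1; have := ginner_sub 1 u v (chart_at_dom p).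
rewrite ginner_inner scale1r -!tnorm_sqr u1 v1 => ->.
by ring.
Qed.

(** Small angles between unit vectors are converted into short chords, for which the triangle
    inequality is elementary; [a] is the same at all points [p]. *)
Lemma tangle_chord (e : R) : 0 < e -> exists2 a : R, 0 < a & forall p u v,
  tnorm p u = 1 -> tnorm p v = 1 -> tangle p u v <= a -> tnorm p (u - v) < e.
Proof.
(* The minimum with 1 keeps [1 - k] in the domain of [acos]; an angle of at most acos(1 - k) then
   gives |u - v|^2 <= 2 k <= e^2 / 2. *)
move=> e0; pose k := Num.min 1 (e ^+ 2 / 4).
have k0 : 0 < k by rewrite lt_min ltr01 divr_gt0// exprn_gt0.
have k1 : k <= 1 by rewrite ge_min lexx.
have ke : k <= e ^+ 2 / 4 by rewrite ge_min lexx orbT.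
have kI : -1 <= 1 - k < 1 by apply/andP; split; lra.
have kI' : -1 <= 1 - k <= 1 by apply/andP; split; lra.
exists (acos (1 - k)) => [|p u v u1 v1]; first exact: acos_gt0.
have I := inner_bound u1 v1.
rewrite tangle_unit// => h.
have : 1 - k <= inner p u v.
  rewrite -[leLHS]acosK ?in_itv//= -[leRHS]acosK ?in_itv//=.
  by rewrite leNgt ltr_cos ?in_itv /= ?acos_ge0 ?acos_lepi// -leNgt.
move=> h'; rewrite -ltr_sqr ?nnegrE ?tnorm_ge0 ?(ltW e0)// tnorm_sub_sqr//.
have : 0 < e ^+ 2 by rewrite exprn_gt0.
move: (e ^+ 2) ke h' => e2 ke h' e20; lra.
Qed.

Lemma small_tangle_eq p u v : tnorm p u = 1 -> tnorm p v = 1 ->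
  (forall e : R, 0 < e -> tangle p u v <= e) -> u = v.
Proof.
move=> u1 v1 h; apply/eqP; rewrite -subr_eq0; apply/eqP/(@tnorm_eq0 _ _ _ p).
apply/eqP; rewrite eq_le tnorm_ge0 andbT; apply: le_addeps => e e0; rewrite add0r.
by have [a a0 /(_ p u v u1 v1 (h a a0))/ltW] := tangle_chord e0.
Qed.

Lemma visibility_segment p (eps : R) : 0 < eps -> exists2 r : R, 0 < r &
  forall c (a b : R), is_geodesic c -> a < b -> (forall t, a <= t <= b -> r <= dist p (c t)) ->
    angle p (of_point (c a)) (of_point (c b)) <= eps.
Proof.
move=> /(vis p)[r r0 hr]; exists r => // c a b gc ab h.
by apply: (hr c a%:E b%:E) => // t; rewrite !lee_fin => at_ tb; apply: h; rewrite at_.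
Qed.

Lemma visibility_ray p (eps : R) : 0 < eps -> exists2 r : R, 0 < r &
  forall c (a : R) xi, at_infinity c xi -> (forall t, a <= t -> r <= dist p (c t)) ->
    angle p (of_point (c a)) (of_ideal xi) <= eps.
Proof.
move=> /(vis p)[r r0 hr]; exists r => // c a xi cx h.
apply: (hr c a%:E +oo%E) => //; first exact: at_infinity_geodesic cx.
  by rewrite ltry.
by move=> t; rewrite lee_fin => at_ _; exact: h.
Qed.

Lemma geodesic_far p c t : is_geodesic c -> `|t| - dist p (c 0) <= dist p (c t).
Proof.
move=> gc; rewrite lerBlDl -(geodesic_dist0 complete nocp simple t gc).
by rewrite (dist_sym p (c 0)); exact: dist_triangle.
Qed.

Lemma velocity_cst p : velocity (cst p : R -> M) 0 = 0.
Proof.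
rewrite /velocity; have -> : chart (chart_at (cst p (0 : R))) \o cst p = fun _ : R => chart (chart_at p) p by [].
by apply: derive1_is_derive; exact: is_derive_cst.
Qed.

(** The default value of [geod] is at work: if no geodesic led from [p] to [xi], the constant curve
    would see every angle as pi / 2 > 1, whereas visibility with [eps = 1], applied to a far tail of
    a geodesic in the class [xi], bounds that angle by 1. *)
Lemma geod_ideal_ex p xi : exists c, [/\ is_geodesic c, c 0 = p & at_infinity c xi].
Proof.
apply/not_existsP => no.
have E : geod p (of_ideal xi) = cst p.
  rewrite /geod xgetPN// => c hc; exact: (no c).
have [r r0 hr] := visibility_ray p (@ltr01 R).
have [c [gc cx]] := at_infinity_ex xi.
have /(hr _ _ _ cx) : forall t, r + dist p (c 0) <= t -> r <= dist p (c t).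
  move=> t ht; rewrite (le_trans _ (geodesic_far p t gc))//.
  by rewrite lerBrDr (le_trans ht)// ler_norm.
rewrite /angle E velocity_cst /tangle innerC -(scale0r (0 : V)) innerZl mul0r mul0r acos0.
have := pihalf_ge1 R; have : pi / 2 != 1 :> R.
  apply/eqP => E1; have := cos_pihalf R; rewrite E1; have := cos1_gt0 R => h1 h0.
  by rewrite h0 ltxx in h1.
rewrite le_eqVlt eq_sym => /negPf -> /= h1 h2.
by have := lt_le_trans h1 h2; rewrite ltxx.
Qed.

(** The segment from [c t] to [c' t] has length at most [C], so for t = r + C it stays at distance
    at least [r] from [p]. By visibility the angle at [p] is below every [eps]. *)
Lemma asymptotic_from_eq c c' : is_geodesic c -> is_geodesic c' -> c 0 = c' 0 ->
  asymptotic c c' -> c = c'.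
Proof.
move=> gc gc' e0 [C hC]; set p := c 0 in e0.
have [[t t0 ct]|ne] := pselect (exists2 t, 0 < t & c t = c' t).
  by apply: geodesic_eq ct => //; rewrite gt_eqF.
have v1 : tnorm p (velocity c 0) = 1 by have [_ + _] := gc; exact.
have v1' : tnorm p (velocity c' 0) = 1 by have [_ h _] := gc'; have := h 0; rewrite -e0.
suff E : velocity c 0 = velocity c' 0.
  by rewrite (geodesic_gam gc) (geodesic_gam gc') -e0 -/p -E.
apply: (small_tangle_eq v1 v1') => eps eps0.
have [r r0 hr] := visibility_segment p eps0.
have C0 : 0 <= C by rewrite (le_trans _ (hC 0 (lexx _)))// dist_ge0.
pose t := r + C; have t0 : 0 < t by rewrite ltr_pwDl.
have ctne : c t <> c' t by move=> h; apply: ne; exists t.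
have [g [gg g0 gd]] := geodesic_between complete nocp simple ctne.
have d0 : 0 < dist (c t) (c' t).
  by rewrite lt_neqAle dist_ge0 andbT eq_sym; apply/eqP => /(dist_eq0 complete nocp simple).
have := hr g 0 (dist (c t) (c' t)) gg d0.
have Eg := geod_point gc t0; have Eg' := geod_point gc' t0; rewrite -e0 in Eg'.
rewrite g0 gd /angle Eg Eg'; apply.
move=> s /andP[s0 sd].
have h1 : dist (c t) (g s) <= C.
  by rewrite -g0 geodesic_dist0// ger0_norm// (le_trans sd)// hC// ltW.
have h2 : dist p (c t) = t by rewrite geodesic_dist0// gtr0_norm.
have := dist_triangle p (g s) (c t); rewrite h2 (dist_sym (g s)) /t => h3.
by rewrite -(lerD2r C) (le_trans h3)// lerD2l.
Qed.

Lemma geod_ideal c xi : at_infinity c xi -> geod (c 0) (of_ideal xi) = c.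
Proof.
move=> cx; apply: geod_unique => //; first exact: at_infinity_geodesic cx.
move=> c' gc' e0 c'x; apply: asymptotic_from_eq => //; first exact: at_infinity_geodesic cx.
exact: at_infinity_asymptotic c'x cx.
Qed.

Lemma geod_idealP p xi : [/\ is_geodesic (geod p (of_ideal xi)), geod p (of_ideal xi) 0 = p &
  at_infinity (geod p (of_ideal xi)) xi].
Proof.
by have [c [gc c0 cx]] := geod_ideal_ex p xi; have := geod_ideal cx; rewrite c0 => ->.
Qed.

(** The direction in which [x] is seen from [p]. It is injective on ideal points ([dirv_inj]), so
    the boundary is studied inside a unit sphere. *)
Definition dirv p (x : bordification M) : V := velocity (geod p x) 0.

Lemma dirv_unit p xi : tnorm p (dirv p (of_ideal xi)) = 1.
Proof. by have [[_ + _] c0 _] := geod_idealP p xi => /(_ 0); rewrite c0. Qed.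

Lemma dirv_point_unit p z : p <> z -> tnorm p (dirv p (of_point z)) = 1.
Proof. by move=> /geod_pointP[[_ + _] c0 _] => /(_ 0); rewrite c0. Qed.

Lemma geod_dirv p xi : geod p (of_ideal xi) = gam p (dirv p (of_ideal xi)).
Proof. by have [gc c0 _] := geod_idealP p xi; rewrite {1}(geodesic_gam gc) c0. Qed.

Lemma geod_dirv_point p z : p <> z -> geod p (of_point z) = gam p (dirv p (of_point z)).
Proof. by move=> /geod_pointP[gc c0 _]; rewrite {1}(geodesic_gam gc) c0. Qed.

Lemma dirv_inj p xi eta : dirv p (of_ideal xi) = dirv p (of_ideal eta) -> xi = eta.
Proof.
move=> E; have [_ _ h] := geod_idealP p xi; have [_ _ h'] := geod_idealP p eta.
by rewrite geod_dirv E -geod_dirv in h; exact: at_infinity_eq h h'.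
Qed.

Lemma shadowP p q r xi : shadow p q r xi <->
  exists2 t, 0 < t & dist q (geod p (of_ideal xi) t) < r.
Proof.
have [gc c0 cx] := geod_idealP p xi.
split=> [[z [qz zp zx]]|[t t0 qt]].
  have pz : p <> z by move=> E; exact: zp.
  have [gz z0 zd] := geod_pointP pz.
  have := geod_ideal zx; rewrite z0 => ->; exists (dist p z); last by rewrite zd.
  by rewrite lt_neqAle dist_ge0 andbT eq_sym; apply/eqP => /(dist_eq0 complete nocp simple).
exists (geod p (of_ideal xi) t); split=> //.
  move=> E; have := geodesic_dist0 complete nocp simple t gc.
  by rewrite E c0 distxx gtr0_norm// => E0; rewrite -E0 ltxx in t0.
by have := geod_point gc t0; rewrite c0 => ->.
Qed.

Lemma angle_dirv p (x y : bordification M) : angle p x y = tangle p (dirv p x) (dirv p y).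
Proof. by []. Qed.

Lemma at_infinity_far x c (r : R) : is_geodesic c -> exists2 T : R, 0 < T &
  forall t, T <= t -> r <= dist x (c t).
Proof.
move=> gc; exists (1 + `|r| + dist x (c 0)) => [|t ht].
  by rewrite ltr_wpDr ?dist_ge0// ltr_pwDl.
rewrite (le_trans _ (geodesic_far x t gc))// lerBrDr.
rewrite (le_trans _ (ler_norm _))// (le_trans _ ht)// lerD2r.
by rewrite (le_trans (ler_norm _))// lerDr.
Qed.

Lemma dirv_tail x c xi (e : R) : at_infinity c xi -> 0 < e -> exists2 T : R, 0 < T &
  forall t, T <= t -> x <> c t /\
    tnorm x (dirv x (of_point (c t)) - dirv x (of_ideal xi)) < e.
Proof.
move=> cx e0; have gc := at_infinity_geodesic cx.
have [a a0 ha] := tangle_chord e0.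
have [r r0 hr] := visibility_ray x a0.
have [T T0 hT] := at_infinity_far x r gc.
exists T => // t Tt.
have xc : x <> c t.
  by move=> E; have := hT t Tt; rewrite -E distxx leNgt r0.
split=> //; apply: ha; [exact: dirv_point_unit|exact: dirv_unit|].
rewrite -angle_dirv; apply: hr => // s ts; apply: hT; exact: le_trans ts.
Qed.

(** * Estimates of Busemann functions *)

Section Busemann.
Variables (xi : ideal_boundary M) (x q : M).
Let c := geod q (of_ideal xi).

Lemma busemann_bounds : (forall t, busemann xi x q <= dist x (c t) - t) /\
  (forall A t0 : R, (forall t, t0 <= t -> A <= dist x (c t) - t) -> A <= busemann xi x q).
Proof.
have [gc c0 cx] := geod_idealP q xi; rewrite -/c in gc c0 cx.
apply: (@lim_nonincreasing R (fun t => dist x (c t) - t) (- dist x (c 0))) => [s t st|t t0].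
  rewrite lerBlDr (le_trans (dist_triangle _ (c s) _))// geodesic_dist//.
  by rewrite ger0_norm ?subr_ge0// addrA addrAC.
by rewrite lerBrDl (le_trans _ (geodesic_far x t gc))// ger0_norm.
Qed.

Lemma busemann_le : busemann xi x q <= dist x q.
Proof.
have [h _] := busemann_bounds; have := h 0; rewrite subr0.
by have [_ + _] := geod_idealP q xi; rewrite -/c => ->.
Qed.

Lemma busemann_ge : - dist x q <= busemann xi x q.
Proof.
have [gc c0 cx] := geod_idealP q xi; rewrite -/c in gc c0 cx.
have [_ h] := busemann_bounds; apply: (h _ 0) => t t0.
by rewrite lerBrDl (le_trans _ (geodesic_far x t gc))// c0 ger0_norm.
Qed.

(** The ball is open, so for large [t] the geodesic from [x] to [c t] also enters it at time [s].
    The passage near [q] costs [r] twice: d(x, c t) = s + d(g s, c t), with s >= d(x, q) - r and d(g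
    s, c t) >= t - r. *)
Lemma busemann_shadow r : shadow x q r xi -> dist x q - 2 * r <= busemann xi x q.
Proof.
move=> /shadowP[s s0 hs].
have [gc c0 cx] := geod_idealP q xi; rewrite -/c in gc c0 cx.
have nW : \forall v \near dirv x (of_ideal xi), dist q (gam x v s) < r.
  have cd : {for dirv x (of_ideal xi), continuous (fun v => dist q (gam x v s))}.
    apply: (@continuous_comp _ _ _ (fun v => gam x v s) (dist q)).
      exact: gam_continuous.
    exact: dist_continuous.
  rewrite geod_dirv in hs.
  exact: (cvgr_lt _ cd _ hs).
have [e e0 he] := (near_normP _ _).1 nW.
have [C C0 hC] := tnorm_norm x.
have eC : 0 < e / C by rewrite divr_gt0.
have [T T0 hT] := dirv_tail x cx eC.
have [T' T'0 hT'] := at_infinity_far x s gc.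
have [_ h] := busemann_bounds; apply: (h _ (Num.max T T')) => t.
rewrite ge_max => /andP[/hT[xct hd] /hT' sd].
have [gg g0 gd] := geod_pointP xct.
have hq : dist q (geod x (of_point (c t)) s) < r.
  rewrite geod_dirv_point//; apply: he.
  by rewrite (le_lt_trans (hC _))// mulrC -ltr_pdivlMr.
set g := geod x (of_point (c t)) in gg g0 gd hq.
have E1 : dist x (g s) = s by rewrite -{1}g0 geodesic_dist0// gtr0_norm.
have E2 : dist (g s) (c t) = dist x (c t) - s.
  by rewrite -{1}gd geodesic_dist// ger0_norm// subr_ge0.
have E3 : t - r <= dist (g s) (c t).
  have h1 := geodesic_far (g s) t gc; rewrite c0 in h1.
  have h2 := ler_norm t; rewrite (dist_sym (g s)) in h1.
  lra.
have E4 := dist_triangle x (g s) q; rewrite E1 (dist_sym (g s)) in E4.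
lra.
Qed.

End Busemann.

(* By visibility the geodesic from [x] to [y] passes near [o]. *)
Lemma visibility_product o (eps : R) : 0 < eps -> exists2 r : R, 0 < r &
  forall x y, o <> x -> o <> y -> eps < angle o (of_point x) (of_point y) ->
    dist o x + dist o y - 2 * r <= dist x y.
Proof.
move=> e0; have [r r0 hr] := visibility_segment o e0; exists r => // x y ox oy xy.
have [E|xny] := pselect (x = y).
  have v1 := dirv_point_unit oy.
  have : angle o (of_point x) (of_point y) = 0.
    rewrite E angle_dirv tangle_unit//.
    by rewrite -tnorm_sqr v1 expr1n acos1.
  by move=> E0; rewrite E0 ltNge (ltW e0) in xy.
have [g [gg g0 gd]] := geodesic_between complete nocp simple xny.
have d0 : 0 < dist x y.
  by rewrite lt_neqAle dist_ge0 andbT eq_sym; apply/eqP => /(dist_eq0 complete nocp simple).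
have [far|/existsNP[t /not_implyP[/andP[t0 td]]]] := pselect (forall t, 0 <= t <= dist x y -> r <= dist o (g t)).
  by have := hr g 0 _ gg d0 far; rewrite g0 gd leNgt xy.
move=> /negP; rewrite -ltNge => tr.
have E1 : dist x (g t) = t by rewrite -{1}g0 geodesic_dist0// ger0_norm.
have E2 : dist (g t) y = dist x y - t by rewrite -{1}gd geodesic_dist// ger0_norm// subr_ge0.
have E3 := dist_triangle o (g t) x; rewrite (dist_sym (g t)) E1 in E3.
have E4 := dist_triangle o (g t) y; rewrite E2 in E4.
lra.
Qed.

(** All points [c t] of the ray from [o] to [xi] are seen from [o] in the same direction, so
    [visibility_product] applies to [x] and [c t] with one constant. *)
Lemma busemann_far o (eps : R) : 0 < eps -> exists2 r : R, 0 < r &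
  forall x xi, o <> x -> eps < angle o (of_point x) (of_ideal xi) ->
    dist o x - 2 * r <= busemann xi x o.
Proof.
move=> /(visibility_product o)[r r0 hr]; exists r => // x xi ox a.
have [gc c0 cx] := geod_idealP o xi; set c := geod o (of_ideal xi) in gc c0 cx.
have [_ h] := busemann_bounds xi x o; apply: (h _ 1) => t t1.
have t0 : 0 < t by rewrite (lt_le_trans ltr01).
have ot : dist o (c t) = t by rewrite -{1}c0 geodesic_dist0// gtr0_norm.
have oct : o <> c t by move=> E; rewrite -E distxx in ot; rewrite -ot ltxx in t0.
have := hr x (c t) ox oct; rewrite ot.
have E : angle o (of_point x) (of_point (c t)) = angle o (of_point x) (of_ideal xi).
  have Eg := geod_point gc t0; rewrite c0 in Eg.
  by rewrite !angle_dirv /dirv Eg.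
rewrite E => /(_ a) h1; rewrite -/c lerBrDr addrAC; exact: h1.
Qed.

(** A ray from [x] that misses the ball around [q] keeps the distance [r0] from [o], because [r]
    exceeds [r0] by d(o, q). The constant [r0] depends on [o] and [eps] alone. *)
Lemma shadow_complement o (eps : R) : 0 < eps -> exists2 r0 : R, 0 < r0 &
  forall x q r xi, r0 + dist o q <= r -> ~ shadow x q r xi ->
    o <> x /\ angle o (of_point x) (of_ideal xi) <= eps.
Proof.
move=> e0; have [r0 r00 hr] := visibility_ray o e0; exists r0 => // x q r xi rq ns.
have [gc c0 cx] := geod_idealP x xi; set c := geod x (of_ideal xi) in gc c0 cx.
have far t : 0 < t -> r <= dist q (c t).
  move=> t0; rewrite leNgt; apply/negP => h; apply: ns; apply/shadowP.
  by exists t.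
(* Shadows see positive times only; time 0 follows in the limit. *)
have far0 t : 0 <= t -> r <= dist q (c t).
  rewrite le_eqVlt => /orP[/eqP <-|]; last exact: far.
  apply: le_addeps => e e_gt0; rewrite (le_trans (far e e_gt0))//.
  rewrite (le_trans (dist_triangle _ (c 0) _))// lerD2l.
  by rewrite geodesic_dist0// gtr0_norm.
have faro t : 0 <= t -> r0 <= dist o (c t).
  move=> /far0 h; have := dist_triangle q o (c t); rewrite (dist_sym q o) => h2.
  lra.
split; last by rewrite -c0; exact: hr.
by move=> E; have := faro 0 (lexx _); rewrite c0 -E distxx leNgt r00.
Qed.

End Boundary.

(** * Arithmetic of the ping-pong estimate, with D = d(o, g o) *)

Section PingPongNumbers.
Context {R : realFieldType}.
Implicit Types D d r s t x : R.

Lemma pingpong_num1 D r1 r2 r3 s t d : D <= t + d -> d < r1 -> 0 < r2 -> 0 < r3 ->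
  r1 + r2 + 2 * r3 < D -> 0 < t.
Proof. by lra. Qed.

Lemma pingpong_num2 D r1 r2 r3 s d x : D <= x + s -> s <= d -> d < r1 -> 0 < r3 ->
  r1 + r2 + 2 * r3 < D -> r2 <= x.
Proof. by lra. Qed.

Lemma pingpong_num3 D r1 r2 r3 : 0 < r1 -> 0 < r3 -> r1 + r2 + 2 * r3 < D -> r2 <= D.
Proof. by lra. Qed.

Lemma pingpong_num4 D r1 r2 r3 s x : D + s - 2 * r3 <= x -> 0 < s -> 0 < r1 ->
  r1 + r2 + 2 * r3 < D -> r2 <= x.
Proof. by lra. Qed.

Lemma le_halfn (e x : R) k : 0 < e -> (1 <= k)%N -> k%:R * e <= x -> e <= x.
Proof. by move=> e0 k1; apply: le_trans; rewrite ler_peMl ?ler1n// ltW. Qed.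

End PingPongNumbers.

(** * The action on the ideal boundary *)

Section IdealTopology.
Context {R : realType} {n : nat} (M : riemannianManifold R n).
Local Notation V := 'rV[R]_n.
Implicit Types (p q o x y z : M) (u v w : V) (r s t : R) (c : R -> M) (xi eta : ideal_boundary M).

Lemma cone_subbase_open (A : set (bordification M)) : cone_subbase A -> open A.
Proof.
move=> hA; exists [set A]; last by rewrite bigcup_set1.
by move=> _ ->; exact: finI_from1.
Qed.

Lemma open_measurable_bordification (A : set (bordification M)) : open A ->
  measurable (A : set (borel_bordification M)).
Proof. by move=> oA; exact: sub_sigma_algebra. Qed.

Lemma measurable_points : measurable (range (@of_point R n M) : set (borel_bordification M)).
Proof.
apply: open_measurable_bordification; apply: cone_subbase_open; left.
by exists setT => //; exact: openT.
Qed.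

Lemma ideal_pointsC : range (@of_ideal R n M) = ~` range (@of_point R n M).
Proof.
apply/seteqP; split=> [_ [xi _ <-] [x _]|] //.
by case=> [x|xi] h; [exfalso; apply: h; exists x|exists xi].
Qed.

Lemma measurable_ideal : measurable (range (@of_ideal R n M) : set (borel_bordification M)).
Proof. by rewrite ideal_pointsC; apply: measurableC; exact: measurable_points. Qed.

Hypothesis complete : complete_manifold M.
Hypothesis nocp : no_conjugate_points M.
Hypothesis simple : simply_connected R M.
Hypothesis vis : visibility M.

Local Notation dist_sym := (dist_sym complete nocp simple).
Local Notation dist_triangle := (dist_triangle complete nocp simple).
Local Notation dist_ge0 := (dist_ge0 complete nocp simple).
Local Notation geodesic_dist := (geodesic_dist complete nocp simple).
Local Notation geodesic_dist0 := (geodesic_dist0 complete nocp simple).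
Local Notation distxx := (distxx complete nocp simple).
Local Notation dist_eq0 := (dist_eq0 complete nocp simple).
Local Notation geod_idealP := (geod_idealP complete nocp simple vis).
Local Notation geod_pointP := (geod_pointP complete nocp simple).
Local Notation geod_ideal := (geod_ideal complete nocp simple vis).
Local Notation geod_point := (geod_point complete nocp simple).
Local Notation dirv_unit := (dirv_unit complete nocp simple vis).
Local Notation dirv_point_unit := (dirv_point_unit complete nocp simple).
Local Notation shadowP := (shadowP complete nocp simple vis).

Lemma chord_ball p v (W : set V) : nbhs v W -> exists2 e : R, 0 < e & forall u, tnorm p (u - v) < e -> W u.
Proof.
move=> nW; have [e e0 he] := (near_normP _ _).1 nW.
have [C C0 hC] := tnorm_norm p; exists (e / C) => [|u hu]; first exact: divr_gt0.
by apply: he; rewrite (le_lt_trans (hC _))// mulrC -ltr_pdivlMr.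
Qed.

(** [F] collects the open sets of the bordification whose ideal points have directions in [W]; the
    truncated cones of small angle show that the union of [F] catches all of them. *)
Lemma ideal_dir_measurable p (W : set V) : (forall v, W v -> nbhs v W) ->
  measurable (@of_ideal R n M @` [set xi | W (dirv p (of_ideal xi))] : set (borel_bordification M)).
Proof.
move=> oW; pose F := [set U : set (bordification M) | open U /\
  forall xi, U (of_ideal xi) -> W (dirv p (of_ideal xi))].
have oF : open (\bigcup_(U in F) U) by apply: bigcup_open => U [].
suff -> : @of_ideal R n M @` [set xi | W (dirv p (of_ideal xi))] =
    (\bigcup_(U in F) U) `&` range (@of_ideal R n M).
  by apply: measurableI; [exact: open_measurable_bordification|exact: measurable_ideal].
apply/seteqP; split=> [_ [xi Wx <-]|x [[U [oU hU] Ux] [xi _ E]]]; last first.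
  by exists xi => //; apply: hU; rewrite E.
split; last by exists xi.
have [e e0 he] := chord_ball p (oW _ Wx).
have [a a0 ha] := tangle_chord M e0.
have u1 := dirv_unit p xi.
exists (truncated_cone p (dirv p (of_ideal xi)) a 1); first split.
- apply: cone_subbase_open; right; exists p, (dirv p (of_ideal xi)), a, 1.
  by split => //; exact: u1.
- move=> eta [/ltW he2 _]; apply: he; apply: ha; [exact: dirv_unit|exact: u1|exact: he2].
- split=> //; rewrite -/(dirv p (of_ideal xi)) tangle_unit//.
  by rewrite -tnorm_sqr u1 expr1n acos1.
Qed.

Lemma shadow_measurable p q r :
  measurable (@of_ideal R n M @` shadow p q r : set (borel_bordification M)).
Proof.
pose W := [set v | exists2 t, 0 < t & dist q (gam p v t) < r].
have -> : shadow p q r = [set xi | W (dirv p (of_ideal xi))].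
  apply/seteqP; split=> xi.
    by move=> /shadowP; rewrite (geod_dirv complete nocp simple vis).
  by move=> h; apply/shadowP; rewrite (geod_dirv complete nocp simple vis).
apply: ideal_dir_measurable => v [t t0 ht].
have cd : {for v, continuous (fun v => dist q (gam p v t))}.
  apply: (@continuous_comp _ _ _ (fun v => gam p v t) (dist q)).
    exact: gam_continuous.
  exact: dist_continuous.
have nd : \forall v' \near v, dist q (gam p v' t) < r by exact: (cvgr_lt _ cd _ ht).
suff : \forall v' \near v, W v' by [].
by apply: filterS nd => v' h; exists t.
Qed.

Section Action.
Variable Gamma : set (M -> M).
Hypothesis discrete : discrete_isometry_group Gamma.

Lemma group_dist a x y : Gamma a -> dist (a x) (a y) = dist x y.
Proof.
have [iso _ _ inv _] := discrete; move=> Ga.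
have [b [Gb ab ba]] := inv a Ga.
apply/eqP; rewrite eq_le (isometry_dist_le complete nocp simple (iso a Ga))/=.
by have := isometry_dist_le complete nocp simple (iso b Gb) (a x) (a y); rewrite !ab.
Qed.

Lemma group_geodesic a c : Gamma a -> is_geodesic c -> is_geodesic (a \o c).
Proof.
have [iso _ _ _ _] := discrete; move=> Ga.
by apply: (isometry_geodesic complete nocp simple (iso a Ga)) => x y; exact: group_dist.
Qed.

Lemma group_at_infinity a c c' xi eta : Gamma a -> at_infinity c xi -> at_infinity (a \o c) eta ->
  at_infinity c' xi -> at_infinity (a \o c') eta.
Proof.
move=> Ga cx ace c'x.
apply: (asymptotic_at_infinity complete nocp simple ace).
  exact/group_geodesic/(at_infinity_geodesic c'x).
have [C hC] := at_infinity_asymptotic complete nocp simple cx c'x.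
by exists C => t t0; rewrite /= group_dist//; exact: hC.
Qed.

Lemma shadow_image a b p q r : Gamma a -> Gamma b -> cancel a b -> cancel b a ->
  shadow p (a q) r = ideal_image a (shadow (b p) q r).
Proof.
move=> Ga Gb ab ba; apply/seteqP; split=> xi.
  move=> /shadowP[t t0 ht].
  have [gc c0 cx] := geod_idealP p xi; set c := geod p _ in ht gc c0 cx.
  have gbc := group_geodesic Gb gc.
  have [eta be] := ideal_of complete nocp simple gbc.
  have E : a \o (b \o c) = c by apply/funext => s /=; rewrite ba.
  exists eta, (b \o c); split; [|exact: be|by rewrite E].
  have Eg := geod_ideal be; rewrite /= c0 in Eg.
  by apply/shadowP; rewrite Eg; exists t => //=; rewrite -[q]ab group_dist.
move=> [eta [c [/shadowP[t t0 ht] ce acx]]].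
have [gg g0 ge] := geod_idealP (b p) eta; set g := geod (b p) _ in ht gg g0 ge.
have agx := group_at_infinity Ga ce acx ge.
have Eg := geod_ideal agx; rewrite /= g0 ba in Eg.
by apply/shadowP; rewrite Eg; exists t => //=; rewrite group_dist.
Qed.

Lemma limit_set_near o eta (a r : R) : limit_set Gamma o eta -> 0 < a -> 0 < r ->
  exists2 g, Gamma g & [/\ o <> g o, r < dist o (g o) &
    tnorm o (dirv o (of_point (g o)) - dirv o (of_ideal eta)) < a].
Proof.
move=> he a0 r0; have [b b0 hb] := tangle_chord M a0.
have u1 := dirv_unit o eta.
have oT : open (truncated_cone o (dirv o (of_ideal eta)) b r).
  apply: cone_subbase_open; right; exists o, (dirv o (of_ideal eta)), b, r.
  by split => //; exact: u1.
have nT : nbhs (of_ideal eta) (truncated_cone o (dirv o (of_ideal eta)) b r).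
  apply: open_nbhs_nbhs; split=> //; split=> //.
  rewrite -/(dirv o (of_ideal eta)) tangle_unit//.
  by rewrite -tnorm_sqr u1 expr1n acos1.
have [_ [[g Gg <-] [/ltW h1 h2]]] := he _ nT.
have og : o <> g o by move=> E; move: h2; rewrite /= -E distxx ltNge (ltW r0).
exists g => //; split=> //; apply: hb; [exact: dirv_point_unit|exact: u1|exact: h1].
Qed.

Lemma chord_triangle o u v w : tnorm o (u - w) <= tnorm o (u - v) + tnorm o (v - w).
Proof.
rewrite -(subrKA v u (- w)); move: (u - v) (v - w) => A B.
have := cauchy_schwarz A B (chart_at_dom o).
rewrite ginner_inner /gnorm ginner_inner -!/(tnorm o _) => h.
rewrite -ler_sqr ?nnegrE ?addr_ge0 ?tnorm_ge0// tnorm_sqr innerDl.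
rewrite (innerC o A (A + B)) (innerC o B (A + B)) !innerDl sqrrD !tnorm_sqr (innerC o B A).
rewrite mulr2n addrA; lra.
Qed.

Lemma chord_lt o u v w (a b : R) : tnorm o (u - v) < a -> tnorm o (v - w) < b -> tnorm o (u - w) < a + b.
Proof. by move=> h1 h2; rewrite (le_lt_trans (chord_triangle _ _ v _))// ltrD. Qed.

Lemma chord_sym o u v : tnorm o (u - v) = tnorm o (v - u).
Proof. by rewrite -[u - v]opprB -scaleN1r tnormZ normrN normr1 mul1r. Qed.

Definition fixes_ideal xi := forall a c, Gamma a -> at_infinity c xi -> at_infinity (a \o c) xi.

(** Let [b] be the inverse of [g]. As the group fixes [xi], the point [b o] is seen from [o] nearly
    in the direction of [xi]. The point [y] is not, so the geodesic from [o] to [y] stays far from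
    [b o]; its image under [g] joins [g o] to [g y] far from [o], and both ends are seen in nearly
    the same direction. *)
Lemma pingpong_element o xi eta (e : R) : fixes_ideal xi -> limit_set Gamma o eta -> 0 < e ->
  4 * e <= tnorm o (dirv o (of_ideal eta) - dirv o (of_ideal xi)) ->
  exists2 g, Gamma g & forall y, o <> y ->
    2 * e <= tnorm o (dirv o (of_point y) - dirv o (of_ideal xi)) ->
    o <> g y /\ tnorm o (dirv o (of_point (g y)) - dirv o (of_ideal eta)) < e.
Proof.
move=> fx le e0 sep; set u := dirv o (of_ideal xi) in sep *; set w := dirv o (of_ideal eta) in sep *.
have e2 : 0 < e / 2 by rewrite divr_gt0.
have [a a0 ha] := tangle_chord M e2.
have [r1 r10 h1] := visibility_ray vis o a0.
have [r2 r20 h2] := visibility_segment vis o a0.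
have [r3 r30 h3] := visibility_product complete nocp simple vis o a0.
(* [r1] controls the ray from [g o] to [xi], [r2] the two geodesic segments that must avoid [o], and
   [2 * r3] is the loss in [visibility_product]. *)
pose L := r1 + r2 + 2 * r3.
have L0 : 0 < L by rewrite !addr_gt0// mulr_gt0.
have [g Gg [ogo gL gw]] := limit_set_near le e2 L0.
exists g => // y oy yu.
have [iso Gid Gcomp inv _] := discrete.
have [b [Gb gb bg]] := inv g Gg.
have u1 : tnorm o u = 1 := dirv_unit o xi.
have bo : dist o (b o) = dist o (g o) by rewrite -(group_dist _ _ Gg) bg dist_sym.
have obo : o <> b o.
  by move=> E; rewrite -E distxx in bo; rewrite -bo in gL; have := lt_trans L0 gL; rewrite ltxx.
(* The ray from [g o] to [xi] passes near [o], hence [b o] lies near the ray from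
   [o] to [xi]. *)
have [t t0 ht] : exists2 t, 0 <= t & dist (b o) (geod o (of_ideal xi) t) < r1.
  have [gc c0 cx] := geod_idealP (g o) xi; set c := geod (g o) _ in gc c0 cx.
  have [far|/existsNP[t /not_implyP[t0 /negP]]] := pselect (forall t, 0 <= t -> r1 <= dist o (c t)).
    have := h1 c 0 xi cx far; rewrite c0 angle_dirv -/u => h.
    have hc := ha o _ _ (dirv_point_unit ogo) u1 h.
    rewrite chord_sym in gw; have := chord_lt gw hc; rewrite -splitr ltNge.
    by rewrite (le_halfn e0 _ sep).
  rewrite -ltNge => ht; exists t => //.
  have bx := fx b c Gb cx; have Eg := geod_ideal bx; rewrite /= c0 gb in Eg.
  by rewrite Eg /= group_dist.
have [gz z0 zx] := geod_idealP o xi; set c := geod o (of_ideal xi) in ht gz z0 zx.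
have bu : tnorm o (dirv o (of_point (b o)) - u) < e / 2.
  have oz := dist_triangle o (c t) (b o); rewrite (dist_sym (c t)) bo in oz.
  have ot : dist o (c t) = t by rewrite -{1}z0 geodesic_dist0// ger0_norm.
  have t0' : 0 < t by rewrite -ot; exact: pingpong_num1 oz ht r20 r30 gL.
  have Eu : dirv o (of_point (c t)) = u.
    by have Eg := geod_point gz t0'; rewrite z0 in Eg; rewrite /dirv Eg.
  have [Ez|bz] := pselect (b o = c t).
    by rewrite Ez Eu subrr tnorm0.
  have [k [gk k0 kd]] := geodesic_between complete nocp simple bz.
  have d0 : 0 < dist (b o) (c t).
    by rewrite lt_neqAle dist_ge0 andbT eq_sym; apply/eqP => /dist_eq0.
  apply: ha; [exact: dirv_point_unit|exact: u1|].
  have := h2 k 0 (dist (b o) (c t)) gk d0.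
  rewrite k0 kd angle_dirv Eu; apply=> s /andP[s0 sd].
  have E1 : dist (b o) (k s) = s by rewrite -{1}k0 geodesic_dist0// ger0_norm.
  have := dist_triangle o (k s) (b o); rewrite (dist_sym (k s)) bo E1 => h.
  exact: pingpong_num2 h sd ht r30 gL.
have [gy y0 yd] := geod_pointP oy; set k := geod o (of_point y) in gy y0 yd.
have dy : 0 < dist o y by rewrite lt_neqAle dist_ge0 andbT eq_sym; apply/eqP => /dist_eq0.
(* The points [k s] lie in the direction of [y], which makes an angle larger than [a] with that of
   [b o]; hence d(b o, k s) is at least d(o, b o) + s - 2 r3. *)
have far s : 0 <= s <= dist o y -> r2 <= dist (b o) (k s).
  move=> /andP[]; rewrite le_eqVlt => /orP[/eqP <- _|s0 sd].
    rewrite y0 dist_sym bo; exact: pingpong_num3 r10 r30 gL.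
  have os : dist o (k s) = s by rewrite -{1}y0 geodesic_dist0// gtr0_norm.
  have oks : o <> k s by move=> E; rewrite -E distxx in os; rewrite -os ltxx in s0.
  have Es : dirv o (of_point (k s)) = dirv o (of_point y).
    by have Eg := geod_point gy s0; rewrite y0 in Eg; rewrite /dirv Eg.
  have := h3 (b o) (k s) obo oks; rewrite bo os angle_dirv Es => h.
  have [hs|hs] := leP (tangle o (dirv o (of_point (b o))) (dirv o (of_point y))) a.
    have := ha o _ _ (dirv_point_unit obo) (dirv_point_unit oy) hs => h'.
    rewrite chord_sym in h'; have := chord_lt h' bu; rewrite -splitr ltNge.
    by rewrite (le_halfn e0 _ yu).
  exact: pingpong_num4 (h hs) s0 r10 gL.
have ogy : o <> g y.
  move=> E; have /far : 0 <= dist o y <= dist o y by rewrite dist_ge0 lexx.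
  by rewrite yd {1}E gb distxx leNgt r20.
split=> //.
have ggk := group_geodesic Gg gy.
have h4 : tnorm o (dirv o (of_point (g o)) - dirv o (of_point (g y))) < e / 2.
  apply: ha; [exact: dirv_point_unit|exact: dirv_point_unit|].
  have := h2 (g \o k) 0 (dist o y) ggk dy; rewrite /= y0 yd; apply=> s hs.
  have := far s hs; by rewrite -(group_dist (b o) (k s) Gg) bg.
rewrite chord_sym in h4.
by have := chord_lt h4 gw; rewrite -splitr.
Qed.

End Action.
End IdealTopology.

(** * Free semigroups and the critical exponent *)

Section FreeSemigroup.
Context {R : realType}.

Lemma bernoulli_third k : 1 + k%:R / 3 <= (4 / 3 : R) ^+ k.
Proof.
elim: k => [|k ih]; first by rewrite mul0r addr0 expr0.
have k0 : 0 <= k%:R :> R by [].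
rewrite exprS -natr1 (le_trans _ (ler_wpM2l _ ih))//; first lra.
Qed.

Lemma esum_ge_card (I : finType) (J : choiceType) (G : set J) (f : I -> J) (a : J -> R) (k : R) :
  injective f -> (forall i, G (f i)) -> (forall i, k <= a (f i)) ->
  ((k *+ #|I|)%:E <= \esum_(j in G) (a j)%:E)%E.
Proof.
move=> fi Gf ka; apply: esum_ge; pose s := [seq f i | i <- enum I].
have us : uniq s by rewrite map_inj_uniq ?enum_uniq.
exists [set` s].
  by split=> [|_ /= /mapP[i _ ->]]; [exact: finite_seq|exact: Gf].
rewrite -fsbig_seq// sumEFin lee_fin /s big_map big_enum /=.
by rewrite -sumr_const ler_sum.
Qed.

Lemma common_bound (a b : R) : 0 <= a -> 0 <= b -> exists D, [/\ 0 < D, a <= D & b <= D].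
Proof. by move=> a0 b0; exists (a + b + 1); split; lra. Qed.

Lemma quarter_le (e x : R) : 0 < e -> 4 * e <= x -> [/\ e + 2 * e <= x, e + e <= x & 2 * e <= x].
Proof. by move=> *; split; lra. Qed.

Lemma quarter_min (a b c : R) : 0 < a -> 0 < b -> 0 < c ->
  exists2 e, 0 < e & [/\ 4 * e <= a, 4 * e <= b & 4 * e <= c].
Proof.
move=> a0 b0 c0; exists (Num.min a (Num.min b c) / 4).
  by rewrite divr_gt0// !lt_min a0 b0.
by rewrite mulrC divfK// !ge_min !lexx !orbT.
Qed.

Variables (T : Type) (g1 g2 : T -> T) (S C1 C2 : set T).
Hypothesis inj1 : injective g1.
Hypothesis inj2 : injective g2.
Hypothesis S0 : S !=set0.
Hypothesis h1 : forall y, S y -> C1 (g1 y).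
Hypothesis h2 : forall y, S y -> C2 (g2 y).
Hypothesis C1S : C1 `<=` S.
Hypothesis C2S : C2 `<=` S.
Hypothesis C12 : forall y, C1 y -> C2 y -> False.

Fixpoint semigroup_word (w : seq bool) : T -> T :=
  if w is b :: w' then (if b then g1 else g2) \o semigroup_word w' else id.

Lemma semigroup_word_stable w y : S y -> S (semigroup_word w y).
Proof.
by move=> Sy; elim: w => //= b w ih; case: b => /=; [apply/C1S/h1|apply/C2S/h2].
Qed.

(** The value at a point of [S] reveals the first letter, as [C1] and [C2] are disjoint; injectivity
    cancels it. Words of equal length are all that the count of 2^k elements uses. *)
Lemma semigroup_word_inj w w' : size w = size w' -> semigroup_word w = semigroup_word w' -> w = w'.
Proof.
have [y Sy] := S0.
elim: w w' => [|b w ih] [|b' w'] //= [sw] /funeqP E.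
have Sw := semigroup_word_stable w Sy; have Sw' := semigroup_word_stable w' Sy.
case: b b' E => -[] /= E.
- congr (_ :: _); apply: ih => //; apply/funext => x; exact/inj1/E.
- by exfalso; apply: (C12 (h1 Sw)); have := E y => /= ->; exact: h2.
- by exfalso; apply: (C12 (h1 Sw')); have := E y => /= <-; exact: h2.
- congr (_ :: _); apply: ih => //; apply/funext => x; exact/inj2/E.
Qed.

End FreeSemigroup.

(** * Positivity of the critical exponent *)

Section CriticalExponent.
Context {R : realType} {n : nat} (M : riemannianManifold R n).
Implicit Types (p q o x y z : M) (r s t : R) (c : R -> M) (xi eta : ideal_boundary M).
Hypothesis complete : complete_manifold M.
Hypothesis nocp : no_conjugate_points M.
Hypothesis simple : simply_connected R M.
Hypothesis vis : visibility M.
Variable Gamma : set (M -> M).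
Hypothesis discrete : discrete_isometry_group Gamma.

Local Notation group_dist := (group_dist complete nocp simple discrete).

Lemma pingpong_divergence o (g1 g2 : M -> M) (S C1 C2 : set M) : Gamma g1 -> Gamma g2 ->
  S !=set0 -> (forall y, S y -> C1 (g1 y)) -> (forall y, S y -> C2 (g2 y)) ->
  C1 `<=` S -> C2 `<=` S -> (forall y, C1 y -> C2 y -> False) ->
  exists2 s0 : R, 0 < s0 & forall s, 0 <= s <= s0 -> poincare_series Gamma s o o = +oo%E.
Proof.
move=> G1 G2 S0 h1 h2 C1S C2S C12; have [iso Gid Gcomp inv _] := discrete.
have ginj g : Gamma g -> injective g by move=> /inv[b [_ gb _]]; exact: can_inj gb.
have d0 x y : 0 <= dist x y := dist_ge0 complete nocp simple x y.
have [D [D0 D1 D2]] := common_bound (d0 o (g1 o)) (d0 o (g2 o)).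
pose W := semigroup_word g1 g2.
have GW w : Gamma (W w).
  by elim: w => //= b w ih; apply: Gcomp => //; case: b.
have dW w : dist o (W w o) <= (size w)%:R * D.
  elim: w => [|b w ih] /=; first by rewrite mul0r (distxx complete nocp simple).
  have Gb : Gamma (if b then g1 else g2) by case: b.
  rewrite (le_trans (dist_triangle complete nocp simple _ ((if b then g1 else g2) o) _))//.
  rewrite group_dist// -natr1 mulrDl mul1r addrC lerD//.
  by case: b {Gb}.
(* For s D <= 1/3 a letter costs at most the factor e^(-s D) >= 2/3, so the 2^k words of length [k]
   contribute at least (4/3)^k >= 1 + k/3, which is unbounded. *)
exists (1 / (3 * D)) => [|s /andP[s0 sD]]; first by rewrite divr_gt0// mulr_gt0.
have sD3 : s * D <= 1 / 3.
  by rewrite -ler_pdivlMr// (le_trans sD)// invfM mulrA.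
have eD : 2 / 3 <= expR (- (s * D)).
  by rewrite (le_trans _ (expR_ge1Dx _))//; lra.
have lower k : ((1 + k%:R / 3)%:E <= poincare_series Gamma s o o)%E.
  have winj : injective (fun t : k.-tuple bool => W t).
    move=> t t' E; apply: val_inj.
    by apply: (semigroup_word_inj (ginj _ G1) (ginj _ G2) S0 h1 h2 C1S C2S C12 _ E); rewrite !size_tuple.
  have tk (t : k.-tuple bool) : expR (- (s * D)) ^+ k <= expR (- s * dist o (W t o)).
    rewrite -expRM_natl ler_expR mulNr mulrN lerN2 mulrCA ler_wpM2l//.
    by rewrite (le_trans (dW t))// size_tuple.
  have := @esum_ge_card R (k.-tuple bool) (M -> M) Gamma (fun t : k.-tuple bool => W t)
    (fun a => expR (- s * dist o (a o))) (expR (- (s * D)) ^+ k) winj (fun t : k.-tuple bool => GW t) tk.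
  rewrite card_tuple card_bool; apply: le_trans.
  rewrite lee_fin (le_trans (bernoulli_third k))//.
  rewrite -[leRHS]mulr_natl natrX -exprMn.
  by apply: lerXn2r; rewrite ?nnegrE ?mulr_ge0 ?expR_ge0//; lra.
apply/eqP; rewrite eq_le leey /=; apply/eqP => //.
move: lower; case: (poincare_series Gamma s o o) => [r lower|//|lower]; last first.
  by have := lower 0%N; rewrite leeNy_eq.
exfalso; have [k hk] : exists k : nat, 3 * r < k%:R.
  exists (Num.truncn `|3 * r|).+1; rewrite (le_lt_trans (ler_norm _))//.
  by rewrite truncnS_gt.
have := lower k; rewrite lee_fin; lra.
Qed.

Lemma exponent_gt0 o xi (delta : R) : fixes_ideal Gamma xi -> non_elementary Gamma o ->
  critical_exponent (fun s => poincare_series Gamma s o o) = delta%:E -> 0 < delta.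
Proof.
move=> fx ne crit.
have [eta1 [l1 e1]] : exists eta, limit_set Gamma o eta /\ eta <> xi.
  have := infinite_setD ne (finite_set1 xi).
  by move=> /infinite_setN0[eta [l e]]; exists eta.
have [eta2 [l2 [e2 e12]]] : exists eta, limit_set Gamma o eta /\ eta <> xi /\ eta <> eta1.
  have := infinite_setD ne (finite_set2 xi eta1).
  by move=> /infinite_setN0[eta [l e]]; exists eta; split=> //; split=> E; apply: e; [left|right].
have du eta := dirv_unit complete nocp simple vis o eta.
have sep eta eta' : eta <> eta' -> 0 < tnorm o (dirv o (of_ideal eta) - dirv o (of_ideal eta')).
  move=> ee; apply: tnorm_gt0; rewrite subr_eq0; apply/eqP => E; apply: ee.
  exact: (dirv_inj complete nocp simple vis E).
(* With [e] a quarter of the least chord between the three directions, the [e]-cones around [eta1]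
   and [eta2] are disjoint and lie in [S], the complement of the [2 * e]-cone around [xi]. *)
have [e e0 [ea1 ea2 ea3]] := quarter_min (sep _ _ e1) (sep _ _ e2) (sep _ _ e12).
have [g1 G1 h1] := pingpong_element complete nocp simple vis discrete fx l1 e0 ea1.
have [g2 G2 h2] := pingpong_element complete nocp simple vis discrete fx l2 e0 ea2.
pose cone eta := [set y | o <> y /\ tnorm o (dirv o (of_point y) - dirv o (of_ideal eta)) < e].
pose S := [set y | o <> y /\ 2 * e <= tnorm o (dirv o (of_point y) - dirv o (of_ideal xi))].
have coneS eta : 4 * e <= tnorm o (dirv o (of_ideal eta) - dirv o (of_ideal xi)) -> cone eta `<=` S.
  move=> h y [oy hy]; split; [exact: oy|]; rewrite leNgt; apply/negP => hy'.
  rewrite chord_sym in hy; have := chord_lt hy hy'; rewrite ltNge => /negP; apply.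
  by have [] := quarter_le e0 h.
have Sne : S !=set0.
  have [gg g0 _] := geod_idealP complete nocp simple vis o eta1.
  set c := geod o (of_ideal eta1) in gg g0.
  have oc : dist o (c 1) = 1 by rewrite -{1}g0 (geodesic_dist0 complete nocp simple 1 gg) normr1.
  have Eg := geod_point complete nocp simple gg ltr01; rewrite g0 in Eg.
  exists (c 1); split.
    by move=> E; rewrite -E (distxx complete nocp simple) in oc; move/eqP: oc; rewrite eq_sym oner_eq0.
  rewrite /dirv Eg.
  by have [] := quarter_le e0 ea1.
have disj y : cone eta1 y -> cone eta2 y -> False.
  move=> [_ hy1] [_ hy2]; rewrite chord_sym in hy2.
  have := chord_lt hy2 hy1; rewrite ltNge => /negP; apply.
  by have [] := quarter_le e0 ea3.
have [s0 s00 hs] := @pingpong_divergence o g1 g2 S (cone eta1) (cone eta2) G1 G2 Sne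
  (fun y Sy => h1 y Sy.1 Sy.2) (fun y Sy => h2 y Sy.1 Sy.2) (coneS _ ea1) (coneS _ ea2) disj.
rewrite -lte_fin -crit (@lt_le_trans _ _ s0%:E) ?lte_fin//.
apply: le_ereal_inf_tmp => _ [s [s_ge0 Ps] <-]; rewrite lee_fin leNgt; apply/negP => ss0.
by rewrite hs ?s_ge0 ?ltW// in Ps.
Qed.

End CriticalExponent.

(** * Conformal densities and shadows *)

Section DensityBounds.
Context {d : measure_display} {T : measurableType d} {R : realType}.
Variable mu : {measure set T -> \bar R}.
Local Open Scope ereal_scope.

(** A Radon-Nikodym derivative may be negative on a null set, while monotonicity of the integral is
    applied to non-negative functions; [maxe 0 f] mends this without changing the integral. *)
Lemma ae_integral_max0 (f : T -> \bar R) (A : set T) : measurable A -> mu.-integrable setT f ->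
  {ae mu, forall x, A x -> 0 <= f x} ->
  exists f1 : T -> \bar R, [/\ measurable_fun A f1, forall x, 0 <= f1 x,
    forall x, 0 <= f x -> f1 x = f x & \int[mu]_(x in A) f x = \int[mu]_(x in A) f1 x].
Proof.
move=> mA fi f0; have mf : measurable_fun A f.
  by apply: measurable_funTS; case/integrableP: fi.
pose f1 : T -> \bar R := fun x => maxe 0 (f x).
have mf1 : measurable_fun A f1 by apply: measurable_maxe => //; exact: measurable_cst.
have f1E x : 0 <= f x -> f1 x = f x by move=> fx; rewrite /f1 max_r.
exists f1; split=> //; first by move=> x; rewrite /f1 le_max lexx.
apply: ae_eq_integral => //.
by apply: filterS f0 => x h Ax; rewrite f1E// h.
Qed.

Lemma ae_density_ge (Q : T -> Prop) (f : T -> \bar R) (A : set T) (k : R) :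
  measurable A -> mu.-integrable setT f -> (0 <= k)%R -> {ae mu, forall x, Q x} ->
  (forall x, Q x -> A x -> k%:E <= f x) -> k%:E * mu A <= \int[mu]_(x in A) f x.
Proof.
move=> mA fi k0 hQ hf.
have f0 : {ae mu, forall x, A x -> 0 <= f x}.
  by apply: filterS hQ => x h Ax; rewrite (le_trans _ (hf x h Ax))// lee_fin.
have [f1 [mf1 f10 f1E ->]] := ae_integral_max0 mA fi f0.
rewrite -integral_cst//; apply: ae_ge0_le_integral => //.
- apply: filterS hQ => x h Ax; have hx := hf x h Ax.
  by rewrite f1E// (le_trans _ hx)// lee_fin.
Qed.

Lemma ae_density_le (Q : T -> Prop) (f : T -> \bar R) (A : set T) (k : R) :
  measurable A -> mu.-integrable setT f -> (0 <= k)%R -> {ae mu, forall x, Q x} ->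
  (forall x, Q x -> A x -> 0 <= f x <= k%:E) -> \int[mu]_(x in A) f x <= k%:E * mu A.
Proof.
move=> mA fi k0 hQ hf.
have f0 : {ae mu, forall x, A x -> 0 <= f x}.
  by apply: filterS hQ => x h Ax; case/andP: (hf x h Ax).
have [f1 [mf1 f10 f1E ->]] := ae_integral_max0 mA fi f0.
rewrite -integral_cst//; apply: ae_ge0_le_integral => //.
- by apply: filterS hQ => x h Ax; case/andP: (hf x h Ax) => hx hk; rewrite f1E.
Qed.

End DensityBounds.

Section ConformalDensities.
Context {R : realType} {n : nat} (M : riemannianManifold R n).
Local Notation V := 'rV[R]_n.
Implicit Types (p q o x y z : M) (r s t : R) (xi eta : ideal_boundary M) (S : set (ideal_boundary M)).
Variables (Gamma : set (M -> M)) (o : M) (delta : R) (mu : boundary_measures M).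
Hypothesis conf : conformal_density Gamma o delta mu.
Hypothesis delta0 : 0 <= delta.

Definition ideal_set S : set (borel_bordification M) := @of_ideal R n M @` S.

Lemma conformal_ge x q S (b : R) : measurable (ideal_set S) ->
  (forall xi, S xi -> busemann xi x q <= b) ->
  ((expR (- delta * b))%:E * mu q (ideal_set S) <= mu x (ideal_set S))%E.
Proof.
move=> mS hb; have [_ _ /(_ x q)[ac dens] _] := conf.
have E := Radon_Nikodym_integral (nu := charge_of_finite_measure (mu x)) (mu := mu q) ac mS.
rewrite [leRHS](E : mu x (ideal_set S) = _); apply: (ae_density_ge mS _ _ dens) => [||y hy [xi Sx yE]].
- exact: Radon_Nikodym_integrable.
- exact: expR_ge0.
- by rewrite (hy xi (esym yE)) lee_fin ler_expR !mulNr lerN2 ler_wpM2l// hb.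
Qed.

Lemma conformal_le x q S (b : R) : measurable (ideal_set S) ->
  (forall xi, S xi -> b <= busemann xi x q) ->
  (mu x (ideal_set S) <= (expR (- delta * b))%:E * mu q (ideal_set S))%E.
Proof.
move=> mS hb; have [_ _ /(_ x q)[ac dens] _] := conf.
have E := Radon_Nikodym_integral (nu := charge_of_finite_measure (mu x)) (mu := mu q) ac mS.
rewrite [leLHS](E : mu x (ideal_set S) = _); apply: (ae_density_le mS _ _ dens) => [||y hy [xi Sx yE]].
- exact: Radon_Nikodym_integrable.
- exact: expR_ge0.
- by rewrite (hy xi (esym yE)) !lee_fin expR_ge0 ler_expR !mulNr lerN2 ler_wpM2l// hb.
Qed.

Lemma ideal_setT_mass p : mu p (ideal_set setT) = mu p setT.
Proof.
have [null _ _ _] := conf.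
have -> : [set: borel_bordification M] = ideal_set setT `|` range (@of_point R n M).
  apply/seteqP; split=> // -[x|xi] _; [right|left]; first by exists x.
  by exists xi.
rewrite measureU; [|exact: measurable_ideal|exact: measurable_points|].
  by rewrite [X in (_ + X)%E]null adde0.
by apply/seteqP; split=> // x [[xi _ <-] [y _]].
Qed.

End ConformalDensities.

(** * Normalization of the measure at the base point *)

Section TotalMass.
Context {R : realType} {n : nat} (M : riemannianManifold R n).
Variables (Gamma : set (M -> M)) (o : M) (delta : R) (h : R -> {posnum R}) (mu : boundary_measures M).
Hypothesis dist0 : forall x y : M, 0 <= dist x y.
Hypothesis Gid : Gamma id.
Hypothesis patt : patterson_function Gamma delta h.
Hypothesis ps : patterson_sullivan Gamma o delta h mu.

(** The infimum provides an exponent s' < s at which the series is finite, and its terms decrease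
    with the exponent. *)
Lemma modified_series_fin s : delta < s -> modified_series h Gamma s o o \is a fin_num.
Proof.
move=> ds; have [_ _ /(_ o o)[crit _] _] := patt.
have s0 q : (0 <= modified_series h Gamma q o o)%E.
  by apply: esum_ge0 => a _; rewrite lee_fin mulr_ge0// expR_ge0.
rewrite ge0_fin_numE//.
have : (critical_exponent (fun s => modified_series h Gamma s o o) < s%:E)%E by rewrite crit lte_fin.
move=> /ereal_inf_lt[_ [s' [s'0 fin] <-]]; rewrite lte_fin => s's.
apply: le_lt_trans fin; apply: le_esum => a _; rewrite lee_fin.
by rewrite ler_wpM2l// ler_expR !mulNr lerN2 ler_wpM2r ?(ltW s's).
Qed.

Lemma modified_series_gt0 s : (0 < modified_series h Gamma s o o)%E.
Proof.
apply: (@lt_le_trans _ _ ((h (dist o o))%:num * expR (- s * dist o o))%:E).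
  by rewrite lte_fin mulr_gt0// expR_gt0.
apply: esum_ge; exists [set id].
  by split=> [|_ ->]; [exact: finite_set1|exact: Gid].
by rewrite fsbig_set1.
Qed.

Lemma ps_approx_mass s : delta < s -> ps_approx h Gamma o o s setT = 1%E.
Proof.
move=> ds; have fin := modified_series_fin ds; have pos := modified_series_gt0 s.
rewrite /ps_approx /= /mscale /= /weighted_dirac /=.
have -> : (\esum_(i in Gamma) ((ps_weight h s o o i)%:num%:E *
    \d_(of_point (i o) : borel_bordification M) setT))%E = modified_series h Gamma s o o.
  by apply: eq_esum => a _; rewrite diracT mule1.
rewrite -{2}(fineK fin) -EFinM mulVf// gt_eqF//.
by rewrite fine_gt0// pos ltey_eq fin.
Qed.

(** The denominator of [ps_approx] gives the approximating measures at [o] mass 1, and the constant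
    1 is a test function on the bordification. *)
Lemma total_mass : mu o setT = 1%E.
Proof.
have [_ [s_ [ds _ _ /(_ o) cvg]]] := ps.
have c0 : continuous (fun _ : bordification M => 1 : R).
  by move=> x; exact: (@continuous_const (bordification M) R 1 x).
have := cvg _ c0.
under eq_fun do rewrite integral_cst//= mul1e ps_approx_mass//.
rewrite integral_cst//= mul1e => c1.
have c2 : (1%E : \bar R) @[_ --> \oo] --> (1%E : \bar R) by exact: cvg_cst.
exact: (cvg_unique (@ereal_hausdorff R) c1 c2).
Qed.

End TotalMass.

(** * Small caps do not carry almost all of the mass *)

Section NoAtom.
Context {R : realType} {n : nat} (M : riemannianManifold R n).
Local Notation V := 'rV[R]_n.
Implicit Types (p q x y z : M) (r s t : R) (xi eta : ideal_boundary M) (S : set (ideal_boundary M)) (v : V).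
Hypothesis complete : complete_manifold M.
Hypothesis nocp : no_conjugate_points M.
Hypothesis simple : simply_connected R M.
Hypothesis vis : visibility M.
Variables (Gamma : set (M -> M)) (o : M) (delta : R) (mu : boundary_measures M).
Hypothesis discrete : discrete_isometry_group Gamma.
Hypothesis nonelem : non_elementary Gamma o.
Hypothesis crit : critical_exponent (fun s => poincare_series Gamma s o o) = delta%:E.
Hypothesis conf : conformal_density Gamma o delta mu.
Hypothesis mass1 : mu o setT = 1%E.

Definition ideal_cap v (e : R) : set (ideal_boundary M) :=
  [set xi | tnorm o (dirv o (of_ideal xi) - v) < e].

Lemma exponent_ge0 : 0 <= delta.
Proof.
rewrite -lee_fin -crit; apply: le_ereal_inf_tmp => _ [s [s0 _] <-].
by rewrite lee_fin.
Qed.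

Lemma chord_continuous (v u : V) : {for u, continuous (fun z : V => tnorm o (z - v))}.
Proof.
apply: (@continuous_comp _ _ _ (fun z : V => z - v) (tnorm o)); last exact: tnorm_continuous.
exact: (sdiff_continuous (sdiffB (sdiff_id u) (sdiff_cst v u))).
Qed.

Lemma measurable_cap v (e : R) : measurable (ideal_set (ideal_cap v e)).
Proof.
apply: (@ideal_dir_measurable R n M complete nocp simple vis o
  [set u | tnorm o (u - v) < e]) => u hu.
exact: (cvgr_lt _ (@chord_continuous v u) _ hu).
Qed.

Lemma cap_bigcap v : \bigcap_k ideal_set (ideal_cap v k.+1%:R^-1) =
  ideal_set [set xi | dirv o (of_ideal xi) = v].
Proof.
apply/seteqP; split=> [x hx|_ [xi E <-] k _]; last first.
  exists xi => //; rewrite /ideal_cap /= E subrr tnorm0.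
  by rewrite invr_gt0.
have [xi _ xE] := hx 0%N I; rewrite -xE in hx *; exists xi => //=.
apply/eqP; rewrite -subr_eq0; apply/eqP/(@tnorm_eq0 _ _ _ o).
apply/eqP; rewrite eq_le tnorm_ge0 andbT; apply: le_addeps => e e0; rewrite add0r.
have [k hk] := ltr_add_invr (y := 0) (x := e) e0.
rewrite add0r in hk; have [xi' hxi' [E']] := hx k I.
by rewrite -E' (le_trans _ (ltW hk))// ltW.
Qed.

Lemma measurable_ideal1 xi : measurable (ideal_set [set xi]).
Proof.
have -> : [set xi] = [set eta | dirv o (of_ideal eta) = dirv o (of_ideal xi)].
  apply/seteqP; split=> [_ ->//|eta /= E].
  exact: (dirv_inj complete nocp simple vis E).
by rewrite -cap_bigcap; apply: bigcap_measurable => // k _; exact: measurable_cap.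
Qed.

Lemma ideal_set_sub S S' : S `<=` S' -> ideal_set S `<=` ideal_set S'.
Proof. by move=> SS; exact: image_subset. Qed.

Lemma mass_le1 (A : set (borel_bordification M)) : measurable A -> (mu o A <= 1)%E.
Proof. by move=> mA; rewrite -mass1; apply: le_measure; rewrite ?inE. Qed.

(** If [a] moved [xi] to another point [eta], invariance would give [eta] the mass 1 at [a o], while
    its mass at [o] is 0 because [xi] exhausts the total; absolute continuity excludes this. *)
Lemma atom_fixed xi : mu o (ideal_set [set xi]) = 1%E -> fixes_ideal Gamma xi.
Proof.
move=> m1 a c Ga cx.
have [eta aeta] := ideal_of complete nocp simple
  (group_geodesic complete nocp simple discrete Ga (at_infinity_geodesic cx)).
suff E : eta = xi by rewrite -E.
apply: contrapT => ne.
have E : ideal_image a [set xi] = [set eta].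
  apply/seteqP; split=> [eta' [_ [c' [-> c'x ac']]]|_ ->]; last by exists xi, c.
  have := group_at_infinity complete nocp simple discrete Ga c'x ac' cx.
  by move=> h; exact: (at_infinity_eq complete nocp simple h aeta).
have [_ _ dens /(_ a o [set xi] Ga (measurable_ideal1 xi))] := conf.
rewrite E => E2; have : mu (a o) (ideal_set [set eta]) = 1%E by rewrite -m1; exact: E2.
have [ac _] := dens (a o) o.
suff m0 : mu o (ideal_set [set eta]) = 0%E.
  have /null_content_dominatesP := ac; move=> /(_ _ (measurable_ideal1 eta) m0) ->.
  by move=> /esym/eqP; rewrite onee_eq0.
have mU : (mu o (ideal_set [set xi] `|` ideal_set [set eta]) <= 1)%E.
  by apply: mass_le1; apply: measurableU; exact: measurable_ideal1.
rewrite measureU in mU; [|exact: measurable_ideal1|exact: measurable_ideal1|]; last first.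
  by apply/seteqP; split=> // _ [[_ -> <-] [_ -> [E']]]; apply: ne.
move: mU; rewrite [X in (X + _)%E]m1 -[X in (_ <= X)%E]adde0 leeD2lE// => m0.
by apply/eqP; rewrite eq_le m0 /=; exact: measure_ge0.
Qed.

Lemma no_full_atom xi : mu o (ideal_set [set xi]) = 1%E -> False.
Proof.
move=> m1; have fx := atom_fixed m1.
have d0 : 0 < delta := exponent_gt0 complete nocp simple vis discrete fx nonelem crit.
have [eta [le ne]] : exists eta, limit_set Gamma o eta /\ eta <> xi.
  have := infinite_setD nonelem (finite_set1 xi).
  by move=> /infinite_setN0[eta [l e]]; exists eta.
pose w := tnorm o (dirv o (of_ideal eta) - dirv o (of_ideal xi)).
have w0 : 0 < w / 2.
  rewrite divr_gt0//; apply: tnorm_gt0; rewrite subr_eq0; apply/eqP => E; apply: ne.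
  exact: (dirv_inj complete nocp simple vis E).
have [a a0 ha] := tangle_chord M w0.
have [r r0 hr] := busemann_far complete nocp simple vis o a0.
have r20 : 0 < 2 * r by rewrite mulr_gt0.
(* Beyond the distance [2 * r] the Busemann function is positive at [g o]; as [0 < delta], the mass
   of [xi] at [g o] falls strictly below 1, against invariance. *)
have [g Gg [og gr gw]] := limit_set_near complete nocp simple vis le w0 r20.
have ang : a < angle o (of_point (g o)) (of_ideal xi).
  rewrite ltNge; apply/negP => h.
  have := ha o _ _ (dirv_point_unit complete nocp simple og) (dirv_unit complete nocp simple vis o xi) h.
  by rewrite chord_sym in gw; move=> h2; have := chord_lt gw h2; rewrite -splitr -/w ltxx.
have hb := hr _ _ og ang.
have E : ideal_image g [set xi] = [set xi].
  have [gc c0 cx] := geod_idealP complete nocp simple vis o xi.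
  apply/seteqP; split=> [eta' [_ [c' [-> c'x ac']]]|_ ->].
    exact: (at_infinity_eq complete nocp simple ac' (fx g c' Gg c'x)).
  by exists xi, (geod o (of_ideal xi)); split => //; exact: fx.
have [_ _ _ /(_ g o [set xi] Gg (measurable_ideal1 xi))] := conf.
rewrite E => E2; have m2 : mu (g o) (ideal_set [set xi]) = 1%E by rewrite -m1; exact: E2.
have := conformal_le conf exponent_ge0 (x := g o) (q := o) (measurable_ideal1 xi)
  (b := dist o (g o) - 2 * r) (ltac:(by move=> _ ->)).
rewrite m1 m2 mule1 lee_fin leNgt => /negP; apply.
by rewrite expR_lt1 mulNr oppr_lt0 mulr_gt0// subr_gt0.
Qed.

(** The caps of radius 1/(k+1) shrink to the ideal points with direction [v], of which there is at
    most one. Masses above 1 - 1/(k+1) would leave a full atom or mass 1 on the empty set. One [e]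
    serves as radius and as deficit. *)
Lemma cap_small v : exists2 e : R, 0 < e &
  (mu o (ideal_set (ideal_cap v e)) <= (1 - e)%:E)%E.
Proof.
apply: contrapT => no.
have big (k : nat) : ((1 - k.+1%:R^-1)%:E < mu o (ideal_set (ideal_cap v k.+1%:R^-1)))%E.
  by rewrite ltNge; apply/negP => h; apply: no; exists k.+1%:R^-1.
have mcap : measurable (\bigcap_k ideal_set (ideal_cap v k.+1%:R^-1)).
  by apply: bigcap_measurable => // k _; exact: measurable_cap.
have cv : mu o (ideal_set (ideal_cap v k.+1%:R^-1)) @[k --> \oo] -->
    mu o (\bigcap_k ideal_set (ideal_cap v k.+1%:R^-1)).
  apply: nonincreasing_cvg_mu => //.
  - by rewrite (le_lt_trans (mass_le1 (measurable_cap _ _)))// ltry.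
  - by move=> k; exact: measurable_cap.
  - move=> k l kl; apply/subsetPset; apply: ideal_set_sub => xi /= h.
    by rewrite /ideal_cap /= (lt_le_trans h)// lef_pV2 ?posrE// ler_nat.
have ge1 : (1 <= mu o (\bigcap_k ideal_set (ideal_cap v k.+1%:R^-1)))%E.
  have c2 : ((1 - k.+1%:R^-1)%:E @[k --> \oo] --> (1 - 0 : R)%:E)%E.
    by apply: cvg_EFin; [exact: nearW|apply: cvgB; [exact: cvg_cst|exact: cvg_harmonic]].
  rewrite subr0 in c2.
  rewrite -(cvg_lim (@ereal_hausdorff R) c2) -(cvg_lim (@ereal_hausdorff R) cv).
  apply: lee_lim; [exact: cvgP c2|exact: cvgP cv|].
  by apply: nearW => k; exact: ltW.
rewrite cap_bigcap in ge1 mcap.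
have [[xi xiE]|nxi] := pselect (exists xi, dirv o (of_ideal xi) = v).
  apply: (@no_full_atom xi); apply/eqP; rewrite eq_le (mass_le1 (measurable_ideal1 _))/=.
  apply: le_trans ge1 _; apply: le_measure; rewrite ?inE//; first exact: measurable_ideal1.
  apply: ideal_set_sub => eta /= E; apply: (dirv_inj complete nocp simple vis (p := o)).
  by rewrite E xiE.
move: ge1; have -> : ideal_set [set xi | dirv o (of_ideal xi) = v] = set0.
  by apply/seteqP; split=> // _ [xi /= E _]; apply: nxi; exists xi.
by rewrite measure0 leNgt lte01.
Qed.

(** The cap of radius s < e / 2 around a vector within e / 2 of [v] lies in the cap of radius [e]
    around [v], so the estimate is locally uniform and the unit sphere is compact. *)
Lemma cap_small_uniform : exists2 e : R, 0 < e & forall v, tnorm o v = 1 ->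
  (mu o (ideal_set (ideal_cap v e)) <= (1 - e)%:E)%E.
Proof.
pose S := [set v : V | tnorm o v = 1].
have cS : compact S.
  apply: bounded_closed_compact.
    have [C C0 hC] := tnorm_norm o.
    exists C; split; first exact: num_real.
    by move=> x Cx v /= v1; rewrite (le_trans (hC v))// v1 mulr1 ltW.
  have -> : S = tnorm o @^-1` [set 1] by [].
  by apply: closed_comp; [move=> v _; exact: tnorm_continuous|exact: closed_eq].
have := (compact_near_coveringP S).1 cS R (0^'+)
  (fun e v => (mu o (ideal_set (ideal_cap v e)) <= (1 - e)%:E)%E) _.
case.
  move=> v _; have [e e0 he] := cap_small v.
  have e2 : 0 < e / 2 by rewrite divr_gt0.
  have nv : \forall u \near v, tnorm o (u - v) < e / 2.
    by apply: (cvgr_lt _ (@chord_continuous v v)); rewrite subrr tnorm0.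
  exists ([set u | tnorm o (u - v) < e / 2], [set s | s < e / 2]).
    by split => //; exact: nbhs_right_lt.
  move=> [u s] [/= uv se]; apply: le_trans (le_trans _ he) _; last first.
    by rewrite lee_fin lerD2l lerN2 ltW// (lt_trans se)// ltr_pdivrMr// ltr_pMr// ltr1n.
  apply: le_measure; rewrite ?inE; [exact: measurable_cap|exact: measurable_cap|].
  apply: ideal_set_sub => xi /= h; rewrite /ideal_cap /= [e]splitr.
  apply: chord_lt uv; exact: lt_trans se.
move=> e0 /= e0_gt0 hs; exists (e0 / 2) => [|v v1]; first by rewrite divr_gt0.
apply: hs => //=; last by rewrite divr_gt0.
by rewrite sub0r normrN gtr0_norm ?divr_gt0// ltr_pdivrMr// ltr_pMr// ltr1n.
Qed.

End NoAtom.

(** * A uniform lower bound for the mass of shadows at the base point *)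

Section ShadowMass.
Context {R : realType} {n : nat} (M : riemannianManifold R n).
Implicit Types (p q x y z : M) (r s t : R) (xi eta : ideal_boundary M).
Hypothesis complete : complete_manifold M.
Hypothesis nocp : no_conjugate_points M.
Hypothesis simple : simply_connected R M.
Hypothesis vis : visibility M.
Variables (Gamma : set (M -> M)) (o : M) (delta : R) (mu : boundary_measures M).
Hypothesis discrete : discrete_isometry_group Gamma.
Hypothesis nonelem : non_elementary Gamma o.
Hypothesis crit : critical_exponent (fun s => poincare_series Gamma s o o) = delta%:E.
Hypothesis conf : conformal_density Gamma o delta mu.
Hypothesis mass1 : mu o setT = 1%E.

Lemma compact_dist_bounded (K : set M) : compact K -> exists2 D : R, 0 <= D & forall q, K q -> dist o q <= D.
Proof.
move=> cK; have [K0|K0] := pselect (K !=set0); last first.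
  by exists 0 => // q Kq; exfalso; apply: K0; exists q.
have [|z _ hz] := compact_EVT_max K0 cK (f := dist o).
  by apply: continuous_subspaceT; exact: dist_continuous.
exists (dist o z); first exact: (dist_ge0 complete nocp simple).
by move=> q Kq; apply: hz; rewrite inE.
Qed.

(** A shadow is either everything, of mass 1, or its complement lies in the cap of radius [e] around
    the direction of [x] and has mass at most 1 - e. The viewpoint [x] is arbitrary. *)
Lemma shadow_mass_ge : exists r0 m : R, [/\ 0 < r0, 0 < m & forall x q r, r0 + dist o q <= r ->
  (m%:E <= mu o (ideal_set (shadow x q r)))%E].
Proof.
have [e e0 he] := cap_small_uniform complete nocp simple vis discrete nonelem crit conf mass1.
have [a a0 ha] := tangle_chord M e0.
have [r0 r00 hr] := shadow_complement complete nocp simple vis o a0.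
exists r0, (Num.min e 1); split=> //; first by rewrite lt_min e0 ltr01.
move=> x q r rq; have mS := shadow_measurable complete nocp simple vis x q r.
have massT : mu o (ideal_set setT) = 1%E by rewrite (ideal_setT_mass conf).
have [all|/existsNP[xi0 nxi0]] := pselect (forall xi, shadow x q r xi).
  have -> : shadow x q r = setT by apply/seteqP; split=> // xi _; exact: all.
  by rewrite massT lee_fin ge_min lexx orbT.
have [ox _] := hr x q r xi0 rq nxi0.
have v1 := dirv_point_unit complete nocp simple ox; set v := dirv o (of_point x) in v1.
have mC := measurable_cap complete nocp simple vis o v e.
have cover : ideal_set setT `<=` ideal_set (shadow x q r) `|` ideal_set (ideal_cap o v e).
  move=> _ [xi _ <-]; have [h|h] := pselect (shadow x q r xi); [left|right]; exists xi => //.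
  have [_ ang] := hr x q r xi rq h; rewrite /ideal_cap /= chord_sym.
  by apply: ha; [exact: v1|exact: dirv_unit|exact: ang].
have le1 : (1 <= mu o (ideal_set (shadow x q r)) + (1 - e)%:E)%E.
  rewrite -massT (le_trans (le_measure _ _ _ cover)) ?inE//; [exact: measurable_ideal|exact: measurableU|].
  by rewrite (le_trans (measureU2 _ _ _))// leeD2l// he.
have fin : mu o (ideal_set (shadow x q r)) \is a fin_num by exact: fin_num_measure.
rewrite -(fineK fin) lee_fin; rewrite -(fineK fin) -EFinD lee_fin in le1.
by rewrite ge_min; apply/orP; left; lra.
Qed.

End ShadowMass.

Section ShadowEstimates.
Context {R : realType} {n : nat} (M : riemannianManifold R n).
Implicit Types (p q x y z : M) (r s t : R) (xi eta : ideal_boundary M).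
Hypothesis complete : complete_manifold M.
Hypothesis nocp : no_conjugate_points M.
Hypothesis simple : simply_connected R M.
Hypothesis vis : visibility M.
Variables (Gamma : set (M -> M)) (o : M) (delta : R) (mu : boundary_measures M).
Hypothesis conf : conformal_density Gamma o delta mu.
Hypothesis delta0 : 0 <= delta.

(** The measure at [q] is in turn compared with the one at [o], whose total mass is known; the
    resulting factor depends on d(q, o), which stays bounded for [q] in a compact set. *)
Lemma shadow_measure_le x q r : mu o setT = 1%E ->
  (mu x (ideal_set (shadow x q r)) <=
    (expR (- delta * (dist x q - 2 * r)) * expR (delta * dist q o))%:E)%E.
Proof.
move=> mass1; have mS := shadow_measurable complete nocp simple vis x q r.
have h1 := conformal_le conf delta0 (x := x) (q := q) mS
  (fun xi h => busemann_shadow complete nocp simple vis h).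
have h2 := conformal_le conf delta0 (x := q) (q := o) (@measurable_ideal R n M)
  (fun xi _ => busemann_ge complete nocp simple vis xi q o).
rewrite (ideal_setT_mass conf o) mass1 mule1 mulrNN in h2.
rewrite (le_trans h1)// EFinM lee_wpmul2l ?lee_fin ?expR_ge0//.
rewrite (le_trans _ h2)//; apply: le_measure; rewrite ?inE//; first exact: measurable_ideal.
exact: ideal_set_sub.
Qed.

Lemma shadow_measure_ge x q r (m : R) : (m%:E <= mu o (ideal_set (shadow x q r)))%E ->
  ((expR (- delta * dist x q) * (expR (- delta * dist q o) * m))%:E <=
    mu x (ideal_set (shadow x q r)))%E.
Proof.
move=> hm; have mS := shadow_measurable complete nocp simple vis x q r.
have h1 := conformal_ge conf delta0 (x := x) (q := q) mS
  (fun xi _ => busemann_le complete nocp simple vis xi x q).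
have h2 := conformal_ge conf delta0 (x := q) (q := o) mS
  (fun xi _ => busemann_le complete nocp simple vis xi q o).
rewrite (le_trans _ h1)// EFinM lee_wpmul2l ?lee_fin ?expR_ge0//.
by rewrite (le_trans _ h2)// EFinM lee_wpmul2l ?lee_fin ?expR_ge0.
Qed.

Hypothesis discrete : discrete_isometry_group Gamma.

Lemma shadow_measure_image a b p q r : Gamma a -> Gamma b -> cancel a b -> cancel b a ->
  mu p (ideal_set (shadow p (a q) r)) = mu (b p) (ideal_set (shadow (b p) q r)).
Proof.
move=> Ga Gb ab ba; have [_ _ _ inv] := conf.
rewrite (shadow_image complete nocp simple vis discrete p q r Ga Gb ab ba).
have := inv a (b p) _ Ga (shadow_measurable complete nocp simple vis (b p) q r).
by rewrite ba.
Qed.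

End ShadowEstimates.

Lemma ratio_bounds (R : realFieldType) (A B E X : R) : 0 < A -> 0 < B -> 0 < E ->
  E * B <= X -> X <= E * A -> (A + B^-1)^-1 <= X / E <= A + B^-1.
Proof.
move=> A0 B0 E0 h1 h2; have B0' : 0 < B^-1 by rewrite invr_gt0.
apply/andP; split.
  rewrite ler_pdivlMr// mulrC (le_trans _ h1)// ler_pM2l//.
  by rewrite invf_ple ?posrE ?addr_gt0// lerDr ltW.
by rewrite ler_pdivrMr// mulrC (le_trans h2)// ler_pM2l// lerDl ltW.
Qed.

Theorem theorem4p5 (R : realType) (n : nat) (M : riemannianManifold R n)
    (Gamma : set (M -> M)) (o : M) (delta : R) (h : R -> {posnum R})
    (mu : boundary_measures M) (K : set M) :
  complete_manifold M ->
  simply_connected R M ->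
  no_conjugate_points M ->
  visibility M ->
  discrete_isometry_group Gamma ->
  non_elementary Gamma o ->
  critical_exponent (fun s => poincare_series Gamma s o o) = delta%:E ->
  patterson_function Gamma delta h ->
  patterson_sullivan Gamma o delta h mu ->
  compact K ->
  exists2 r0 : R, 0 < r0 & forall r, r0 <= r ->
  exists2 C : R, 0 < C & forall a p q, Gamma a -> K p -> K q ->
    C^-1 <= fine (mu p (@of_ideal _ _ M @` shadow p (a q) r))
              / expR (- delta * dist p (a q)) <= C.

Proof.
move=> complete simple nocp vis discrete nonelem crit patt ps cK.
have [conf _] := ps; have [_ Gid _ inv _] := discrete.
have delta0 := exponent_ge0 crit.
have d0 x y : 0 <= dist x y := dist_ge0 complete nocp simple x y.
have mass1 := total_mass d0 Gid patt ps.
have [D D0 hD] := compact_dist_bounded complete nocp simple o cK.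
have [r0 [m [r00 m0 hm]]] :=
  shadow_mass_ge complete nocp simple vis discrete nonelem crit conf mass1.
(* Adding the bound [D] for d(o, q) makes the condition of [shadow_mass_ge] on the radius hold for
   every [q] in [K]. *)
exists (r0 + D) => [|r rD]; first by rewrite ltr_pwDl.
(* [A] and [B] are the factors in the two shadow estimates with d(q, o) replaced by [D]; the
   constant [A + B^-1] dominates both [A] and [B^-1]. *)
pose A := expR (delta * (2 * r)) * expR (delta * D).
pose B := expR (- delta * D) * m.
have A0 : 0 < A by rewrite mulr_gt0 ?expR_gt0.
have B0 : 0 < B by rewrite mulr_gt0 ?expR_gt0.
exists (A + B^-1) => [|a p q Ga Kp Kq]; first by rewrite addr_gt0 ?invr_gt0.
(* The inverse [b] brings the centre of the ball back to [q] in [K]. Only the viewpoint [x = b p] is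
   then unbounded, and the estimates are uniform in it. *)
have [b [Gb ab ba]] := inv a Ga.
have -> : dist p (a q) = dist (b p) q.
  by rewrite -[RHS](group_dist complete nocp simple discrete _ _ Ga) ba.
rewrite -/(ideal_set _) (shadow_measure_image complete nocp simple vis conf discrete p q r Ga Gb ab ba).
set x := b p; have mS := shadow_measurable complete nocp simple vis x q r.
have fin : mu x (ideal_set (shadow x q r)) \is a fin_num by exact: fin_num_measure.
have qD : dist q o <= D by rewrite (dist_sym complete nocp simple) hD.
have le := shadow_measure_le complete nocp simple vis conf delta0 x q r mass1.
have ge := shadow_measure_ge complete nocp simple vis conf delta0
  (hm x q r (le_trans (lerD (lexx r0) (hD q Kq)) rD)).
rewrite -(fineK fin) lee_fin in le; rewrite -(fineK fin) lee_fin in ge.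
apply: ratio_bounds => //; first exact: expR_gt0.
  apply: le_trans ge; rewrite ler_pM2l ?expR_gt0// /B ler_pM2r// ler_expR !mulNr lerN2.
  exact: ler_wpM2l.
apply: (le_trans le); rewrite mulrBr mulNr expRD mulNr opprK -mulrA ler_pM2l ?expR_gt0//.
by rewrite /A ler_pM2l ?expR_gt0// ler_expR ler_wpM2l.
Qed.
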